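(* Consider the multiple-relay channel with source node $0$, relay nodes $\mathcal{N}=\{1,\dots,n\}$ and destination node $n+1$. A rate $R$ is achievable if for some $\mathcal{M}\subseteq\mathcal{N}$ with $|\mathcal{M}|=M$ there exist a permutation $\pi$ of $\{0\}\cup\mathcal{M}\cup\{n+1\}$ (indexed as $\pi(1),\dots,\pi(M+2)$) with $\pi(1)=0$ and $\pi(M+2)=n+1$, and a distribution of the form $$p(q)\,p(x_0|q)\,p(x_{\mathcal{M}}|x_0,q)\prod_{i\in\mathcal{N}\setminus\mathcal{M}}p(x_i|q)\,p(\hat y_i|y_i,x_i,q),$$ such that for every $k=2,3,\dots,M+2$, $$R<\max_{\mathcal{T}_k\subseteq\mathcal{N}\setminus\mathcal{M}}\ \min_{\mathcal{S}\subseteq\mathcal{T}_k} I(X_{\pi(1:k-1)},X_{\mathcal{S}};\hat Y_{\mathcal{T}_k\setminus\mathcal{S}},Y_{\pi(k)}\mid X_{\mathcal{T}_k\setminus\mathcal{S}},X_{\pi(k:M+1)},Q)-I(Y_{\mathcal{S}};\hat Y_{\mathcal{S}}\mid X_{\pi(1:M+1)},X_{\mathcal{T}_k},Y_{\pi(k)},\hat Y_{\mathcal{T}_k\setminus\mathcal{S}},Q).$$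
   Context: The multiple-relay channel has $n+2$ nodes: source $0$, relays $1,\dots,n$, destination $n+1$. It is given by input alphabets $\mathcal{X}_0,\mathcal{X}_1,\dots,\mathcal{X}_n$, output alphabets $\mathcal{Y}_{n+1},\mathcal{Y}_1,\dots,\mathcal{Y}_n$, and a (memoryless) transition law $p(y_{n+1},y_1,\dots,y_n|x_0,x_1,\dots,x_n)$; $x_0$ is the source input, $y_{n+1}$ the destination output, $y_i$ the output at relay $i$. Relay $i$ transmits $x_i(t)=r_{i,t}(y_i(t-1),y_i(t-2),\dots)$ for an arbitrary causal function $r_{i,t}$. A rate $R$ is achievable if there are codes with $2^{TR}$ messages (source encoder, causal relay functions, decoder at node $n+1$) whose probability of decoding error tends to $0$ as the block length $T\to\infty$. Notation: for a set $\mathcal{S}$ of node indices, $X_{\mathcal{S}}=\{X_i:i\in\mathcal{S}\}$ (similarly for $Y,\hat Y$); $\pi(k_1:k_2)=\{\pi(k_1),\pi(k_1+1),\dots,\pi(k_2)\}$. $Q$ is a time-sharing variable, $\hat Y_i$ are auxiliary (compression) variables for $i\in\mathcal{N}\setminus\mathcal{M}$, and all mutual informations are evaluated under the stated input/auxiliary distribution combined with the channel transition law. *)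

(* Defs.v *)
From HB Require Import structures.
From mathcomp Require Import all_boot all_order all_algebra.
From mathcomp Require Import reals exp.
Set Implicit Arguments. Unset Strict Implicit. Unset Printing Implicit Defensive.
Import Order.TTheory GRing.Theory Num.Theory.
Local Open Scope ring_scope.

(* logarithm in base 2 (rates are in bits: 2^{TR} messages) *)
Definition log2 {R : realType} (x : R) : R := ln x / ln 2.

Definition prob {R : realType} {Om : finType} (P : Om -> R) (E : pred Om) : R :=
  \sum_(w | E w) P w.

(* conditional mutual information I(A;B|C) of the random variables A, B, C
   (functions on the sample space), in bits:
   sum_{a,b,c} p(a,b,c) log2 ( p(a,b,c) p(c) / (p(a,c) p(b,c)) ),
   terms with p(a,b,c) = 0 contribute 0. *)
Definition cmi {R : realType} {Om TA TB TC : finType} (P : Om -> R)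
    (A : Om -> TA) (B : Om -> TB) (C : Om -> TC) : R :=
  \sum_(a : TA) \sum_(b : TB) \sum_(c : TC)
    let pabc := prob P (fun w => [&& A w == a, B w == b & C w == c]) in
    let pc   := prob P (fun w => C w == c) in
    let pac  := prob P (fun w => (A w == a) && (C w == c)) in
    let pbc  := prob P (fun w => (B w == b) && (C w == c)) in
    pabc * log2 (pabc * pc / (pac * pbc)).

(* Nodes are 'I_n.+2 : node 0 (= ord0) is the source, nodes 1..n are the
   relays, node n+1 (= ord_max) is the destination.  Every node i has an
   input alphabet Xa i and an output alphabet Ya i; the source has no output
   and the destination no input, which is encoded by requiring the
   corresponding alphabets to be singletons (see the theorem). *)

Definition relays (n : nat) : {set 'I_n.+2} := [set i : 'I_n.+2 | (0 < i < n.+1)%N].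

Definition restr {n : nat} {F : 'I_n.+2 -> finType} (S : {set 'I_n.+2})
    (v : {dffun forall i, F i}) : {dffun forall i, option (F i)} :=
  finfun (fun i => (if i \in S then Some (v i) else None) : option (F i)).

Definition is_channel {R : realType} {n : nat} {Xa Ya : 'I_n.+2 -> finType}
    (ch : {dffun forall i, Xa i} -> {dffun forall i, Ya i} -> R) : Prop :=
  forall x, (forall y, 0 <= ch x y) /\ \sum_y ch x y = 1.

(* A code of block length T with Mw messages is given by node functions
   f i w t h : the symbol sent by node i at time t when the message is w and
   node i has received h (h s = y_i(s)).  Relays (and the destination) must
   not depend on w and must be causal: they only use y_i(s) for s < t.
   The source input is f ord0 w t _ (its output alphabet is a singleton, so
   this is an arbitrary encoder of w). *)
Definition causal_code {n : nat} {Xa Ya : 'I_n.+2 -> finType} {T Mw : nat}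
    (f : forall i : 'I_n.+2, 'I_Mw -> 'I_T -> ('I_T -> Ya i) -> Xa i) : Prop :=
  forall (i : 'I_n.+2), i != ord0 ->
  forall (w w' : 'I_Mw) (t : 'I_T) (h h' : 'I_T -> Ya i),
    (forall s : 'I_T, (s < t)%N -> h s = h' s) -> f i w t h = f i w' t h'.

Definition code_error {R : realType} {n : nat} {Xa Ya : 'I_n.+2 -> finType}
    (ch : {dffun forall i, Xa i} -> {dffun forall i, Ya i} -> R) {T Mw : nat}
    (f : forall i : 'I_n.+2, 'I_Mw -> 'I_T -> ('I_T -> Ya i) -> Xa i)
    (dec : ('I_T -> Ya ord_max) -> 'I_Mw) : R :=
  (Mw%:R)^-1 *
  \sum_(w : 'I_Mw)
   \sum_(ys : {ffun 'I_T -> {dffun forall i, Ya i}} | dec (fun t => ys t ord_max) != w)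
     \prod_(t : 'I_T)
       ch (finfun (fun i => f i w t (fun s => ys s i)) : {dffun forall i, Xa i}) (ys t).

Definition achievable {R : realType} {n : nat} {Xa Ya : 'I_n.+2 -> finType}
    (ch : {dffun forall i, Xa i} -> {dffun forall i, Ya i} -> R) (rate : R) : Prop :=
  forall eps : R, 0 < eps -> exists T0 : nat, forall T : nat, (T0 <= T)%N ->
    exists (Mw : nat)
           (f : forall i : 'I_n.+2, 'I_Mw -> 'I_T -> ('I_T -> Ya i) -> Xa i)
           (dec : ('I_T -> Ya ord_max) -> 'I_Mw),
      (Mw : int) = Num.ceil (powR 2 (T%:R * rate)) /\
      causal_code f /\ code_error ch f dec <= eps.

(* Sample space: (q, x, y, yhat).  The pmf is
     p(q) p(x_0, x_M | q) prod_{i in N\M} p(x_i | q) p(y | x)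
       prod_i p(yhat_i | y_i, x_i, q),
   where p(x_0, x_M | q) = p(x_0|q) p(x_{M}|x_0,q) is the marginal on the
   coordinates {0} u M of an arbitrary conditional pmf g(. | q) on input
   vectors.  Only yhat_i for i in N\M enter the rate expressions; the other
   yhat_i are dummy auxiliaries. *)
Definition joint_pmf {R : realType} {n : nat} {Xa Ya Yh : 'I_n.+2 -> finType}
    {Qt : finType} (ch : {dffun forall i, Xa i} -> {dffun forall i, Ya i} -> R)
    (Mset : {set 'I_n.+2})
    (pq : Qt -> R) (g : Qt -> {dffun forall i, Xa i} -> R)
    (px : forall i : 'I_n.+2, Qt -> Xa i -> R)
    (pyh : forall i : 'I_n.+2, Qt -> Xa i -> Ya i -> Yh i -> R)
    (w : Qt * ({dffun forall i, Xa i} * ({dffun forall i, Ya i} * {dffun forall i, Yh i})))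
    : R :=
  let q := w.1 in let x := w.2.1 in let y := w.2.2.1 in let yh := w.2.2.2 in
  pq q
  * (\sum_(x' : {dffun forall i, Xa i} | [forall i, (i \in ord0 |: Mset) ==> (x' i == x i)]) g q x')
  * (\prod_(i in relays n :\: Mset) px i q (x i))
  * ch x y
  * \prod_(i : 'I_n.+2) pyh i q (x i) (y i) (yh i).

Definition fmax {R : realType} {I : finType} (A : pred I) (i0 : I) (F : I -> R) : R :=
  \big[Num.max/F i0]_(i | A i) F i.
Definition fmin {R : realType} {I : finType} (A : pred I) (i0 : I) (F : I -> R) : R :=
  \big[Num.min/F i0]_(i | A i) F i.

(* Main.v *)
(* The relays outside M compress and forward, those in M decode and forward, and the two schemes are nested.

   Time sharing, superposition and compression are first made part of the network.  A functional representation
   writes the inputs as deterministic functions of q and of independent letters u_i.  On blocks, a public dither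
   and importance resampling turn each kernel p(yhat|y,x,q) into a deterministic map of (q,x,y,dither), with exact
   output law and H(yhat|x,q,dither) at most n0 (I(Y;Yhat|X,Q) + delta).

   Compress-and-forward is a recursion on levels: level b+1 runs N independent copies of level b, then every relay
   sends for one more block a fresh random function of everything it quantized at level b.  For independent random
   maps, ln t <= t - 1 applied to a two-point resampling bounds from below the output entropy given the maps by a
   minimum over the sets C of relays whose messages agree; this is the origin of the minimum over S.  After many
   levels, the whole run is a memoryless superletter through which node pi(k) sees the decode-and-forward layers at
   nearly the claimed rate.

   Decode-and-forward over superletters is sliding-window decoding: layer j of round b carries message b-j, node
   pi(k) sends the layers j >= k, and decodes by adding the information densities of k consecutive rounds. *)

Require Import Defs.
From HB Require Import structures.
From mathcomp Require Import all_boot all_order all_algebra.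
From mathcomp Require Import reals sequences exp.
From mathcomp Require boolp.
From mathcomp Require Import lra ring zify.
Set Implicit Arguments. Unset Strict Implicit. Unset Printing Implicit Defensive.
Import Order.TTheory GRing.Theory Num.Theory.
Local Open Scope ring_scope.

(** * Expectations under product laws *)

Section Expectation.
Context {R : realType}.
Implicit Types (A B Om : finType).

(** No compression index is ever decoded. The rate of a node is a difference of two entropies of its
    whole observation: given the layers it already knows, and given all layers. Random maps bound
    the first from below, the chain rule bounds the second from above. One level of the recursion
    takes in a bound containing the input entropy of the agreeing set and a letter bound containing
    its negative; the agreeing set cancels, so any number of levels costs one boundary term
    [h (T k)]. This is why whole runs are nested.

    Node pi(j) knows only the layers j' >= j, so its input has to be a function of q and of the
    letters of pi(j), pi(j+1), ...; inputs are therefore generated from the last transmitter back to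
    the source. Entropies of letters, time sharing and dither are large, but they enter both sides
    of the difference and cancel exactly; hence the insistence on exact laws for the inputs and for
    the quantizer. What the dither leaves behind is H(Yhat|Y,X,Q) for each compressed letter, which
    completes the entropies to the subtracted mutual information. *)

Definition pmf A (p : A -> R) : Prop := (forall a, 0 <= p a) /\ \sum_a p a = 1.

Definition Ex A (p f : A -> R) : R := \sum_a p a * f a.

Lemma pmf_ge0 A (p : A -> R) a : pmf p -> 0 <= p a. Proof. by case. Qed.
Lemma pmf_sum1 A (p : A -> R) : pmf p -> \sum_a p a = 1. Proof. by case. Qed.

Lemma pmf_inhab A (p : A -> R) : pmf p -> exists a, 0 < p a.
Proof.
move=> [p0 p1]; apply/existsP; apply: contraT => /existsPn h.
suff : (1 : R) = 0 by move/eqP; rewrite oner_eq0.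
by rewrite -p1 big1 // => a _; apply/eqP; move: (h a); rewrite lt0r p0 andbT negbK.
Qed.

Lemma eq_Ex A (p f g : A -> R) : (forall a, p a != 0 -> f a = g a) -> Ex p f = Ex p g.
Proof.
move=> h; apply: eq_bigr => a _; case: (eqVneq (p a) 0) => [->|/h-> //].
by rewrite !mul0r.
Qed.

Lemma ExD A (p f g : A -> R) : Ex p (fun a => f a + g a) = Ex p f + Ex p g.
Proof. by rewrite /Ex -big_split; apply: eq_bigr => a _; rewrite mulrDr. Qed.

Lemma ExN A (p f : A -> R) : Ex p (fun a => - f a) = - Ex p f.
Proof. by rewrite /Ex -sumrN; apply: eq_bigr => a _; rewrite mulrN. Qed.

Lemma ExB A (p f g : A -> R) : Ex p (fun a => f a - g a) = Ex p f - Ex p g.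
Proof. by rewrite ExD ExN. Qed.

Lemma ExZ A (p f : A -> R) c : Ex p (fun a => c * f a) = c * Ex p f.
Proof. by rewrite /Ex mulr_sumr; apply: eq_bigr => a _; rewrite mulrCA. Qed.

Lemma ExZr A (p f : A -> R) c : Ex p (fun a => f a * c) = Ex p f * c.
Proof. by rewrite /Ex mulr_suml; apply: eq_bigr => a _; rewrite mulrA. Qed.

Lemma Ex_cst A (p : A -> R) c : pmf p -> Ex p (fun=> c) = c.
Proof. by move=> [_ p1]; rewrite /Ex -mulr_suml p1 mul1r. Qed.

Lemma Ex_sum A (p : A -> R) (J : finType) (P : pred J) (F : J -> A -> R) :
  Ex p (fun a => \sum_(j | P j) F j a) = \sum_(j | P j) Ex p (F j).
Proof.
rewrite /Ex exchange_big; apply: eq_bigr => a _ /=.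
by rewrite mulr_sumr.
Qed.

Lemma Ex_swap A B (p : A -> R) (q : B -> R) F :
  Ex p (fun a => Ex q (F a)) = Ex q (fun b => Ex p (F^~ b)).
Proof.
rewrite /Ex; under eq_bigr do rewrite mulr_sumr.
rewrite exchange_big; apply: eq_bigr => b _; rewrite mulr_sumr.
by apply: eq_bigr => a _; rewrite mulrCA.
Qed.

Lemma ler_Ex A (p f g : A -> R) : (forall a, 0 <= p a) ->
  (forall a, 0 < p a -> f a <= g a) -> Ex p f <= Ex p g.
Proof.
move=> p0 h; apply: ler_sum => a _; move: (p0 a); rewrite le_eqVlt.
case/orP => [/eqP<-|pa]; first by rewrite !mul0r.
by rewrite ler_wpM2l ?p0 // h.
Qed.

Lemma Ex_ge0 A (p f : A -> R) : (forall a, 0 <= p a) ->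
  (forall a, 0 < p a -> 0 <= f a) -> 0 <= Ex p f.
Proof.
move=> p0 h; have := ler_Ex p0 h.
by rewrite /Ex big1 // => a _; rewrite mulr0.
Qed.

Lemma Ex_le1 A (p f : A -> R) : pmf p -> (forall a, f a <= 1) -> Ex p f <= 1.
Proof.
by move=> pp h; rewrite -(Ex_cst 1 pp); apply: ler_Ex => [a|a _]; [exact: pmf_ge0|exact: h].
Qed.

Definition jn A B (p : A -> R) (k : A -> B -> R) (w : A * B) : R := p w.1 * k w.1 w.2.

Lemma pmf_jn A B (p : A -> R) (k : A -> B -> R) :
  pmf p -> (forall a, pmf (k a)) -> pmf (jn p k).
Proof.
move=> [p0 p1] kk; split=> [[a b]|].
  by rewrite mulr_ge0 //; case: (kk a).
rewrite -(pair_bigA _ (fun a b => p a * k a b)) /= -[RHS]p1; apply: eq_bigr => a _.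
by rewrite -mulr_sumr pmf_sum1 ?mulr1.
Qed.

Lemma Ex_jn A B (p : A -> R) (k : A -> B -> R) f :
  Ex (jn p k) f = Ex p (fun a => Ex (k a) (fun b => f (a, b))).
Proof.
rewrite /Ex; under [RHS]eq_bigr do rewrite mulr_sumr.
rewrite pair_bigA; apply: eq_bigr => -[a b] _ /=.
by rewrite /jn /= mulrA.
Qed.

Definition prd (I A : finType) (p : I -> A -> R) (f : {ffun I -> A}) : R :=
  \prod_i p i (f i).

Lemma pmf_prd (I A : finType) (p : I -> A -> R) :
  (forall i, pmf (p i)) -> pmf (prd p).
Proof.
move=> pp; split=> [f|]; first by apply: prodr_ge0 => i _; case: (pp i).
by rewrite -(bigA_distr_bigA p) big1 // => i _; rewrite pmf_sum1.
Qed.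

Lemma Ex_prd_prod (I A : finType) (p g : I -> A -> R) :
  Ex (prd p) (fun f => \prod_i g i (f i)) = \prod_i Ex (p i) (g i).
Proof.
rewrite /Ex (bigA_distr_bigA (fun i a => p i a * g i a)).
by apply: eq_bigr => f _; rewrite -big_split.
Qed.

Definition merge (I A : finType) (S : pred I) (f g : {ffun I -> A}) : {ffun I -> A} :=
  [ffun i => if S i then f i else g i].

(** Exchanging the coordinates of [f] and [g] outside [S] is an involution of pairs that carries one
    product weight to the other; the second component then integrates to 1. *)
Lemma Ex_merge2 (I A : finType) (p p' : I -> A -> R) (S : pred I) F :
  (forall i, pmf (p i)) -> (forall i, pmf (p' i)) ->
  Ex (prd p) (fun f => Ex (prd p') (fun g => F (merge S f g))) =
  Ex (prd (fun i => if S i then p i else p' i)) F.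
Proof.
move=> hp hp'.
pose m (f g : {ffun I -> A}) := prd (fun i => if S i then p i else p' i) f * prd (fun i => if S i then p' i else p i) g.
have P1 : pmf (prd (fun i => if S i then p' i else p i)) by apply: pmf_prd => i; case: ifP.
transitivity (\sum_(w : {ffun I -> A} * {ffun I -> A}) prd p w.1 * prd p' w.2 * F (merge S w.1 w.2)).
  rewrite -(pair_bigA _ (fun f g => prd p f * prd p' g * F (merge S f g))) /=.
  by apply: eq_bigr => f _; rewrite mulr_sumr; apply: eq_bigr => g _; rewrite mulrA.
pose h (w : {ffun I -> A} * {ffun I -> A}) := (merge S w.1 w.2, merge S w.2 w.1).
have hK : involutive h.
  by case=> f g; congr (_, _); apply/ffunP => i; rewrite !ffunE /=; case: (S i).
rewrite (reindex h) /=; last by exists h => w _; exact: hK.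
transitivity (\sum_(w : {ffun I -> A} * {ffun I -> A}) m w.1 w.2 * F w.1).
  apply: eq_bigr => -[f g] _ /=; congr (_ * F _).
    rewrite /m /prd -!big_split; apply: eq_bigr => i _ /=; rewrite !ffunE.
    by case: (S i) => //; rewrite mulrC.
  by apply/ffunP => i; rewrite !ffunE; case: (S i).
rewrite -(pair_bigA _ (fun f g => m f g * F f)) /=.
apply: eq_bigr => f _; rewrite -mulr_suml /m -mulr_sumr (pmf_sum1 P1).
by rewrite mulr1.
Qed.

(** Read from right to left, it makes the coordinates outside [S] fresh while those in [S] are kept.
    Most independence arguments below take this form. *)
Lemma Ex_merge (I A : finType) (p : I -> A -> R) (S : pred I) F :
  (forall i, pmf (p i)) ->
  Ex (prd p) (fun f => Ex (prd p) (fun g => F (merge S f g))) = Ex (prd p) F.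
Proof.
move=> pp; rewrite (Ex_merge2 S F pp pp); apply: eq_bigr => f _; congr (_ * _).
by apply: eq_bigr => i _; case: (S i).
Qed.

Lemma big_codom (T : Type) (idx : T) (op : Monoid.com_law idx) (I J : finType) (e : J -> I)
  (F : I -> T) : injective e ->
  \big[op/idx]_(i in codom e) F i = \big[op/idx]_j F (e j).
Proof.
move=> einj; have ue : uniq (codom e) by apply/injectiveP.
by rewrite -(big_uniq _ ue) big_image; apply: eq_bigl.
Qed.

(** The indicator that [f] agrees with [f'] along [e] is a product of one-coordinate factors, so its
    expectation factors, and the coordinates off the image contribute 1. It turns lookups in a
    random table at distinct places into independent letters. *)
Lemma Ex_prd_inj (I J A : finType) (p : I -> A -> R) (e : J -> I) F :
  (forall i, pmf (p i)) -> injective e ->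
  Ex (prd p) (fun f => F [ffun j => f (e j)]) = Ex (prd (fun j => p (e j))) F.
Proof.
move=> pp einj.
pose h (f' : {ffun J -> A}) i a : R := if [pick j | e j == i] is Some j then (a == f' j)%:R else 1.
have hE f' (f : {ffun I -> A}) : \prod_i h f' i (f i) = ([ffun j => f (e j)] == f')%:R.
  have -> : \prod_i h f' i (f i) = \prod_(i in codom e) h f' i (f i).
    rewrite [LHS](bigID (mem (codom e))) /= [X in _ * X]big1 ?mulr1 // => i ni.
    rewrite /h; case: pickP => // j /eqP ej; case/negP: ni.
    by rewrite -ej codom_f.
  rewrite (big_codom _ _ einj).
  have -> : \prod_(j : J) h f' (e j) (f (e j)) = \prod_j (f (e j) == f' j)%:R.
    apply: eq_bigr => j _; rewrite /h; case: pickP => [j' /eqP /einj -> //|].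
    by move=> /(_ j); rewrite eqxx.
  case: eqP => [<-|ne].
    by rewrite big1 // => j _; rewrite ffunE eqxx.
  case: (pickP (fun j => f (e j) != f' j)) => [j nj|al].
    by rewrite (bigD1 j) //= (negbTE nj) mul0r.
  by case: ne; apply/ffunP => j; rewrite ffunE; apply/eqP; move: (al j) => /negbFE.
have -> : Ex (prd p) (fun f => F [ffun j => f (e j)]) =
   Ex (prd p) (fun f => \sum_f' F f' * \prod_i h f' i (f i)).
  apply: eq_Ex => f _; rewrite (bigD1 [ffun j => f (e j)]) //= hE eqxx mulr1.
  by rewrite big1 ?addr0 // => f' /negbTE nf; rewrite hE eq_sym nf mulr0.
rewrite Ex_sum; apply: eq_bigr => f' _; rewrite ExZ Ex_prd_prod mulrC; congr (_ * _).
have E0 i : i \notin codom e -> Ex (p i) (h f' i) = 1.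
  move=> ni; rewrite -[RHS](Ex_cst 1 (pp i)); apply: eq_Ex => a _; rewrite /h.
  by case: pickP => // j /eqP ej; case/negP: ni; rewrite -ej codom_f.
have -> : \prod_i Ex (p i) (h f' i) = \prod_(i in codom e) Ex (p i) (h f' i).
  by rewrite [LHS](bigID (mem (codom e))) /= [X in _ * X]big1 ?mulr1.
rewrite (big_codom _ _ einj).
apply: eq_bigr => j _; rewrite /Ex (bigD1 (f' j)) //= big1 => [|a na].
  rewrite addr0 /h; case: pickP => [j' /eqP /einj -> |/(_ j)]; last by rewrite eqxx.
  by rewrite eqxx mulr1.
rewrite /h; case: pickP => [j' /eqP /einj -> |/(_ j)]; last by rewrite eqxx.
by rewrite (negbTE na) mulr0.
Qed.

Lemma Ex_prd1 (I A : finType) (p : I -> A -> R) i F :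
  (forall i, pmf (p i)) -> Ex (prd p) (fun f => F (f i)) = Ex (p i) F.
Proof.
move=> pp.
have einj : injective (fun _ : unit => i) by move=> [] [].
have := Ex_prd_inj (fun f : {ffun unit -> A} => F (f tt)) pp einj.
under eq_Ex do rewrite ffunE; move=> ->.
rewrite /Ex (reindex (fun a : A => [ffun _ : unit => a])) /=.
  by apply: eq_bigr => a _; rewrite /prd (big_pred1 tt) ?ffunE // => -[].
exists (fun f : {ffun unit -> A} => f tt) => [a _|f _]; first by rewrite ffunE.
by apply/ffunP => -[]; rewrite ffunE.
Qed.

Lemma Ex_prd_indep (I A : finType) (p : I -> A -> R) (S : pred I) F G :
  (forall i, pmf (p i)) ->
  (forall f f' : {ffun I -> A}, {in S, f =1 f'} -> F f = F f') ->
  (forall f f' : {ffun I -> A}, {in predC S, f =1 f'} -> G f = G f') ->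
  Ex (prd p) (fun f => F f * G f) = Ex (prd p) F * Ex (prd p) G.
Proof.
move=> pp hF hG; rewrite -(Ex_merge S _ pp).
rewrite -ExZr; apply: eq_Ex => f _; rewrite -ExZ; apply: eq_Ex => g _; congr (_ * _).
  by apply: hF => i iS; rewrite ffunE (iS : S i).
by apply: hG => i iS; rewrite ffunE (negbTE (iS : ~~ S i)).
Qed.

Lemma Ex_prd_sum (I A : finType) (p : I -> A -> R) (g : I -> A -> R) :
  (forall i, pmf (p i)) ->
  Ex (prd p) (fun f => \sum_i g i (f i)) = \sum_i Ex (p i) (g i).
Proof.
by move=> pp; rewrite Ex_sum; apply: eq_bigr => i _; exact: (Ex_prd1 i (g i) pp).
Qed.

Lemma Ex_prd_sqr (I A : finType) (p : I -> A -> R) (g : I -> A -> R) :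
  (forall i, pmf (p i)) -> (forall i, Ex (p i) (g i) = 0) ->
  Ex (prd p) (fun f => (\sum_i g i (f i)) ^+ 2) = \sum_i Ex (p i) (fun a => g i a ^+ 2).
Proof.
move=> pp g0.
under eq_Ex do rewrite expr2 mulr_suml.
rewrite Ex_sum; apply: eq_bigr => i _.
under eq_Ex do rewrite mulr_sumr.
rewrite Ex_sum (bigD1 i) //= big1 ?addr0; last first.
  move=> j ji; rewrite (@Ex_prd_indep _ _ p (pred1 i)) //.
  - by rewrite (Ex_prd1 i (g i) pp) g0 mul0r.
  - by move=> f f' h; rewrite (h i) // inE.
  - by move=> f f' h; rewrite (h j) // !inE.
by rewrite (Ex_prd1 i (fun a => g i a * g i a) pp); apply: eq_Ex => a _; rewrite expr2.
Qed.

Definition var A (p f : A -> R) : R := Ex p (fun a => (f a - Ex p f) ^+ 2).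

Lemma var_ge0 A (p f : A -> R) : pmf p -> 0 <= var p f.
Proof. by move=> [p0 _]; apply: Ex_ge0 => // a _; rewrite sqr_ge0. Qed.

(** Pointwise |s| <= s^2 / (2 d n) + d n / 2, and the variance bound makes the mean of the first
    summand at most d n / 2. A bound in mean can be inserted directly under an expected
    logarithm. *)
Lemma lln_L1 (I A : finType) (p : I -> A -> R) (g : I -> A -> R) (v d : R) :
  (forall i, pmf (p i)) -> (forall i, var (p i) (g i) <= v) -> 0 < d ->
  ((0 < #|I|)%N -> v <= d ^+ 2 * #|I|%:R) ->
  Ex (prd p) (fun f => `| \sum_i g i (f i) - \sum_i Ex (p i) (g i) |) <= d * #|I|%:R.
Proof.
move=> pp hv d0 hN; have [P0 P1] := pmf_prd pp.
case: (posnP #|I|) => [I0|Ipos].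
  rewrite I0 mulr0 /Ex big1 // => f _; rewrite -sumrB big1 ?normr0 ?mulr0 // => i.
  by have := card0_eq I0 i; rewrite inE.
set n : R := #|I|%:R; have n0 : 0 < n by rewrite ltr0n.
pose g' i a := g i a - Ex (p i) (g i).
have g'0 i : Ex (p i) (g' i) = 0.
  by rewrite /g' ExB Ex_cst ?subrr.
have sq := Ex_prd_sqr pp g'0.
have le2 : \sum_i Ex (p i) (fun a => g' i a ^+ 2) <= n * v.
  rewrite /n -sumr_const mulr_suml; apply: ler_sum => i _; rewrite mul1r.
  exact: hv.
have key f : `|\sum_i g i (f i) - \sum_i Ex (p i) (g i)| <=
    (2 * d * n)^-1 * (\sum_i g' i (f i)) ^+ 2 + d * n / 2.
  rewrite -sumrB; set s := (X in `|X|).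
  have -> : \sum_i g' i (f i) = s by [].
  rewrite -[X in X ^+ 2]/(s) -real_normK ?num_real //; set t := `|s|.
  have dn : 0 < d * n by rewrite mulr_gt0.
  have : 0 <= (t - d * n) ^+ 2 / (2 * d * n) by rewrite divr_ge0 ?sqr_ge0 // -mulrA mulr_ge0 // ltW.
  rewrite -[t <= _]subr_ge0; congr (0 <= _).
  by field; rewrite !gt_eqF.
apply: (le_trans (ler_Ex P0 (fun f _ => key f))).
have -> : Ex (prd p) (fun f => (2 * d * n)^-1 * (\sum_i g' i (f i)) ^+ 2 + d * n / 2) =
    (2 * d * n)^-1 * (\sum_i Ex (p i) (fun a => g' i a ^+ 2)) + d * n / 2.
  rewrite -sq -ExZ -[X in _ = _ + X](Ex_cst _ (pmf_prd pp)).
  exact: ExD.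
have h2 : (2 * d * n)^-1 * (\sum_i Ex (p i) (fun a => g' i a ^+ 2)) <= d * n / 2.
  rewrite mulrC ler_pdivrMr ?mulr_gt0 //.
  apply: (le_trans le2); apply: (le_trans (ler_wpM2l (ltW n0) (hN Ipos))).
  by rewrite le_eqVlt; apply/orP; left; apply/eqP; field.
apply: (le_trans (lerD h2 (lexx _))).
by rewrite -splitr.
Qed.

Lemma markov A (p f : A -> R) (c : R) (E : pred A) : pmf p -> 0 < c ->
  (forall a, 0 < p a -> 0 <= f a) -> (forall a, 0 < p a -> E a -> c <= f a) ->
  Ex p (fun a => (E a)%:R) <= Ex p f / c.
Proof.
move=> [p0 _] c0 f0 h; rewrite ler_pdivlMr // -ExZr; apply: ler_Ex => // a pa.
by case: (boolP (E a)) => Ea; rewrite ?mul1r ?mul0r ?h ?f0.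
Qed.

End Expectation.

(** * Entropy *)

Section Entropy.
Context {R : realType} {Om : finType}.
Implicit Types (P : Om -> R) (T : eqType).

Definition pr P T (A : Om -> T) (a : T) : R := Ex P (fun w => (A w == a)%:R).

(** Entropy in nats, written as an expectation over the sample space: the values may lie in any
    [eqType], and no sum over them occurs. *)
Definition ent P T (A : Om -> T) : R := Ex P (fun w => - ln (pr P A (A w))).

Definition cent P T1 T2 (A : Om -> T1) (B : Om -> T2) : R :=
  ent P (fun w => (A w, B w)) - ent P B.

Definition det P T1 T2 (B : Om -> T1) (A : Om -> T2) : Prop :=
  forall w w', 0 < P w -> 0 < P w' -> B w = B w' -> A w = A w'.

Context (P : Om -> R) (hP : pmf P).
Let P0 : forall w, 0 <= P w. Proof. by case: hP. Qed.

Lemma pr_ge0 T (A : Om -> T) a : 0 <= pr P A a.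
Proof. by apply: Ex_ge0 => // w _; rewrite ler0n. Qed.

Lemma pr_gt0 T (A : Om -> T) w : 0 < P w -> 0 < pr P A (A w).
Proof.
move=> pw; rewrite /pr /Ex (bigD1 w) //= eqxx mulr1 ltr_pwDl // sumr_ge0 // => w' _.
by rewrite mulr_ge0 // ler0n.
Qed.

Lemma pr_le1 T (A : Om -> T) a : pr P A a <= 1.
Proof. by apply: Ex_le1 => // w; case: (_ == _); rewrite ?ler01. Qed.

Lemma ler_pr T1 T2 (A : Om -> T1) (B : Om -> T2) a b :
  (forall w, 0 < P w -> A w = a -> B w = b) -> pr P A a <= pr P B b.
Proof.
move=> h; apply: ler_Ex => // w pw; case: eqP => [e|_]; last by rewrite ler0n.
by rewrite (h _ pw e) eqxx.
Qed.

Lemma ent_ge0 T (A : Om -> T) : 0 <= ent P A.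
Proof. by apply: Ex_ge0 => // w pw; rewrite oppr_ge0 ln_le0 // pr_le1. Qed.

Lemma ent_det T1 T2 (A : Om -> T1) (B : Om -> T2) : det P B A -> ent P A <= ent P B.
Proof.
move=> h; apply: ler_Ex => // w pw; rewrite lerN2 ler_ln ?posrE ?pr_gt0 //.
by apply: ler_pr => w' pw' e; apply: h.
Qed.

Lemma ent_eq T1 T2 (A : Om -> T1) (B : Om -> T2) : det P B A -> det P A B -> ent P A = ent P B.
Proof. by move=> h1 h2; apply/le_anti; rewrite !ent_det. Qed.

Lemma ent_cst T (a : T) : ent P (fun=> a) = 0.
Proof.
have h b : b = a -> pr P (fun=> a) b = 1 by move=> ->; rewrite /pr eqxx Ex_cst.
by rewrite /ent /= h // ln1 oppr0 Ex_cst.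
Qed.

(** The integrated form of ln t <= t - 1, to which submodularity, the Gibbs inequality and the
    random-map bound all reduce. *)
Lemma Ex_ln_le (t : Om -> R) : (forall w, 0 < P w -> 0 < t w) -> Ex P t <= 1 ->
  Ex P (fun w => ln (t w)) <= 0.
Proof.
move=> t0 t1; apply: (@le_trans _ _ (Ex P (fun w => t w - 1))).
  apply: ler_Ex => // w /t0 tw; rewrite -{1}(subrK 1 (t w)) addrC.
  by apply: le_ln1Dx; rewrite ltrBrDl addrN.
by rewrite ExB Ex_cst // subr_le0.
Qed.

Lemma ent_gibbs T (A : Om -> T) (q : Om -> R) : (forall w, 0 < P w -> 0 < q w) ->
  Ex P (fun w => q w / pr P A (A w)) <= 1 -> ent P A <= Ex P (fun w => - ln (q w)).
Proof.
move=> q0 h; rewrite -subr_le0 /ent -ExB.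
rewrite (_ : Ex P _ = Ex P (fun w => ln (q w / pr P A (A w)))); last first.
  apply: eq_Ex => w /eqP pw; have pw' : 0 < P w by rewrite lt0r P0 andbT; apply/eqP.
  by rewrite ln_div ?posrE ?q0 ?pr_gt0 // opprK addrC.
by apply: Ex_ln_le => // w pw; rewrite divr_gt0 ?q0 ?pr_gt0.
Qed.

Lemma Ex_inv_pr T (A : Om -> T) a : Ex P (fun w => (A w == a)%:R / pr P A (A w)) <= 1.
Proof.
rewrite (_ : Ex _ _ = Ex P (fun w => (A w == a)%:R * (pr P A a)^-1)); last first.
  by apply: eq_Ex => w _; case: eqP => [->|]; rewrite ?mul0r.
rewrite ExZr -/(pr P A a); case: (eqVneq (pr P A a) 0) => [->|h]; first by rewrite mul0r ler01.
by rewrite divff.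
Qed.

(** The expectation of [t] is expanded over three copies of the outcome: [w1] supplies (A, C), [w2]
    supplies (B, C), and [w] sits in the denominator. Averaging over [w] leaves at most 1 / p(c) by
    [Ex_inv_pr], and averaging over [w2] cancels p(c). *)
Lemma ent_submod T1 T2 T3 (A : Om -> T1) (B : Om -> T2) (C : Om -> T3) :
  ent P (fun w => (A w, B w, C w)) + ent P C <=
  ent P (fun w => (A w, C w)) + ent P (fun w => (B w, C w)).
Proof.
set AC := fun w => (A w, C w); set BC := fun w => (B w, C w).
set J := fun w => (A w, B w, C w).
pose t w := (pr P AC (AC w) * pr P BC (BC w)) / (pr P J (J w) * pr P C (C w)).
have t0 w : 0 < P w -> 0 < t w by move=> pw; rewrite divr_gt0 ?mulr_gt0 ?pr_gt0.
suff ht : Ex P t <= 1.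
  have := Ex_ln_le t0 ht; rewrite -[_ + _ <= _]subr_le0.
  congr (_ <= _); rewrite /ent -!ExD -ExB; apply: eq_Ex => w /eqP pw.
  have pw' : 0 < P w by rewrite lt0r P0 andbT; apply/eqP.
  rewrite /t ln_div ?posrE ?mulr_gt0 ?pr_gt0 // !lnM ?posrE ?pr_gt0 //; ring.
have e1 : Ex P t = Ex P (fun w1 => Ex P (fun w2 => Ex P (fun w =>
    (AC w1 == AC w)%:R * (BC w2 == BC w)%:R / (pr P J (J w) * pr P C (C w))))).
  rewrite [RHS](_ : _ = Ex P (fun w => Ex P (fun w1 => Ex P (fun w2 =>
    (AC w1 == AC w)%:R * (BC w2 == BC w)%:R / (pr P J (J w) * pr P C (C w)))))); last first.
    rewrite [RHS]Ex_swap; apply: eq_Ex => w1 _; exact: Ex_swap.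
  apply: eq_Ex => w _; rewrite /t {1}/pr -!ExZr; apply: eq_Ex => w1 _.
  by rewrite /pr -ExZ -ExZr.
have e2 : Ex P t <= Ex P (fun w1 => Ex P (fun w2 => (C w2 == C w1)%:R / pr P C (C w1))).
  rewrite e1; apply: ler_Ex => // w1 pw1; apply: ler_Ex => // w2 pw2.
  case: (eqVneq (C w2) (C w1)) => [ec|nc]; last first.
    rewrite mul0r (_ : Ex _ _ = 0) //; rewrite -(Ex_cst 0 hP); apply: eq_Ex => w _.
    rewrite -!pair_eqE /= /pair_eq /=; case: (eqVneq (C w1) (C w)) => [e|]; last by rewrite andbF !mul0r.
    by rewrite -e (negbTE nc) andbF mulr0 !mul0r.
  rewrite mul1r -[leRHS]mul1r.
  rewrite (_ : Ex _ _ = Ex P (fun w => ((J w == (A w1, B w2, C w1))%:R / pr P J (J w)) * (pr P C (C w1))^-1)).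
    by rewrite ExZr ler_wpM2r ?invr_ge0 ?pr_ge0 // Ex_inv_pr.
  apply: eq_Ex => w _; rewrite -!pair_eqE /= /pair_eq /= -!pair_eqE /= /pair_eq /= ec.
  rewrite (eq_sym (A w1)) (eq_sym (B w2)) (eq_sym (C w1)).
  case: (eqVneq (C w) (C w1)) => [->|]; rewrite ?andbF ?andbT ?mul0r ?mulr0 ?mul0r //.
  by case: (_ == _); case: (_ == _); rewrite /= ?mul0r ?mulr0 ?mul0r // !mul1r invfM.
apply: (le_trans e2); rewrite -[leRHS](Ex_cst 1 hP); apply: ler_Ex => // w pw.
by rewrite ExZr -/(pr P C (C w)) divff // gt_eqF // pr_gt0.
Qed.

Lemma cent_ge0 T1 T2 (A : Om -> T1) (B : Om -> T2) : 0 <= cent P A B.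
Proof. by rewrite subr_ge0 ent_det // => w w' _ _ []. Qed.

Lemma entE T1 T2 (A : Om -> T1) (B : Om -> T2) : ent P (fun w => (A w, B w)) = ent P B + cent P A B.
Proof. by rewrite /cent addrC subrK. Qed.

Lemma cent_cond T1 T2 T3 (A : Om -> T1) (B : Om -> T2) (B' : Om -> T3) :
  det P B' B -> cent P A B' <= cent P A B.
Proof.
move=> h; have := ent_submod A B' B.
rewrite (@ent_eq _ _ _ (fun w => (A w, B' w))); first last.
- by move=> w w' pw pw' [-> -> _].
- by move=> w w' pw pw' [-> e]; rewrite e (h w w').
rewrite (@ent_eq _ _ (fun w => (B' w, B w)) B'); first last.
- by move=> w w' pw pw' [->].
- by move=> w w' pw pw' e; rewrite e (h w w').
rewrite /cent; lra.
Qed.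

Lemma cent_arg T1 T2 T3 (A : Om -> T1) (A' : Om -> T2) (B : Om -> T3) :
  det P (fun w => (A' w, B w)) A -> cent P A B <= cent P A' B.
Proof.
move=> h; rewrite /cent lerD2r ent_det // => w w' pw pw' e.
by rewrite (h w w') //; case: e => _ ->.
Qed.

Lemma cent_chain T1 T2 T3 (A : Om -> T1) (A' : Om -> T2) (B : Om -> T3) :
  cent P (fun w => (A w, A' w)) B = cent P A B + cent P A' (fun w => (A w, B w)).
Proof.
rewrite /cent (@ent_eq _ _ (fun w => (A w, A' w, B w)) (fun w => (A' w, (A w, B w)))); first lra.
  by move=> w w' _ _ [-> -> ->].
by move=> w w' _ _ [-> -> ->].
Qed.

Lemma cent_sub T1 T2 T3 (A : Om -> T1) (A' : Om -> T2) (B : Om -> T3) :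
  cent P (fun w => (A w, A' w)) B <= cent P A B + cent P A' B.
Proof. by rewrite cent_chain lerD2l cent_cond // => w w' _ _ []. Qed.

Lemma cent_det T1 T2 (A : Om -> T1) (B : Om -> T2) : det P B A -> cent P A B = 0.
Proof.
move=> h; apply/eqP; rewrite subr_eq0; apply/eqP/ent_eq => w w' pw pw' => [e|[_ ->//]].
by rewrite e (h w w').
Qed.

Lemma cent_eq T1 T2 T3 T4 (A : Om -> T1) (A' : Om -> T2) (B : Om -> T3) (B' : Om -> T4) :
  det P B B' -> det P B' B ->
  det P (fun w => (A w, B w)) A' -> det P (fun w => (A' w, B' w)) A ->
  cent P A B = cent P A' B'.
Proof.
move=> h1 h2 h3 h4; rewrite /cent (ent_eq h2 h1); congr (_ - _); apply: ent_eq.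
  by move=> w w' pw pw' e; rewrite (h4 w w') // (h2 w w') //; case: e.
by move=> w w' pw pw' e; rewrite (h3 w w') // (h1 w w') //; case: e.
Qed.

Lemma cent_ent T1 T2 (A : Om -> T1) (B : Om -> T2) : cent P A B <= ent P A.
Proof.
have := @cent_cond _ _ _ A (fun=> tt) B; rewrite /cent ent_cst subr0.
rewrite (@ent_eq _ _ (fun w => (A w, tt)) A); last by move=> w w' _ _ [].
  by apply.
by move=> w w' _ _ ->.
Qed.

Lemma ent_indep T1 T2 (A : Om -> T1) (B : Om -> T2) :
  (forall a b, pr P (fun w => (A w, B w)) (a, b) = pr P A a * pr P B b) ->
  ent P (fun w => (A w, B w)) = ent P A + ent P B.
Proof.
move=> h; rewrite /ent -ExD; apply: eq_Ex => w /eqP pw.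
have pw' : 0 < P w by rewrite lt0r P0 andbT; apply/eqP.
by rewrite h lnM ?posrE ?pr_gt0 // opprD.
Qed.

(** A factorisation of the joint law on the support is enough, so explicit kernels yield conditional
    entropies without dividing by null probabilities. *)
Lemma cent_kernel T1 T2 (A : Om -> T1) (B : Om -> T2) (k : Om -> R) :
  (forall w, 0 < P w -> pr P (fun w => (B w, A w)) (B w, A w) = pr P A (A w) * k w) ->
  cent P B A = Ex P (fun w => - ln (k w)).
Proof.
move=> h; rewrite /cent /ent -ExB; apply: eq_Ex => w /eqP pw.
have pw' : 0 < P w by rewrite lt0r P0 andbT; apply/eqP.
have k0 : 0 < k w.
  have := pr_gt0 (fun w => (B w, A w)) pw'; rewrite h //.
  by rewrite pmulr_rgt0 // pr_gt0.
by rewrite h // lnM ?posrE ?pr_gt0 //; ring.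
Qed.

End Entropy.

(** * Equality of laws and entropies of product laws *)

Section EntropyLaws.
Context {R : realType}.

(** Laws are compared by testing against all real functions, so that equality transports along maps
    and is proved by rewriting expectations. *)
Definition samelaw (Om Om' : finType) (P : Om -> R) (P' : Om' -> R) (T : eqType)
  (A : Om -> T) (A' : Om' -> T) : Prop :=
  forall phi : T -> R, Ex P (fun w => phi (A w)) = Ex P' (fun w => phi (A' w)).

Lemma samelaw_pr (Om Om' : finType) (P : Om -> R) (P' : Om' -> R) (T : eqType)
  (A : Om -> T) (A' : Om' -> T) a : samelaw P P' A A' -> pr P A a = pr P' A' a.
Proof. by move=> h; exact: (h (fun b => (b == a)%:R)). Qed.

Lemma samelaw_comp (Om Om' : finType) (P : Om -> R) (P' : Om' -> R) (T T' : eqType)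
  (A : Om -> T) (A' : Om' -> T) (h : T -> T') : samelaw P P' A A' ->
  samelaw P P' (fun w => h (A w)) (fun w => h (A' w)).
Proof. by move=> e phi; exact: (e (fun t => phi (h t))). Qed.

Lemma samelaw_ent (Om Om' : finType) (P : Om -> R) (P' : Om' -> R) (T : eqType)
  (A : Om -> T) (A' : Om' -> T) : samelaw P P' A A' -> ent P A = ent P' A'.
Proof.
move=> h; rewrite /ent -(h (fun a => - ln (pr P' A' a))); apply: eq_Ex => w _.
by rewrite (samelaw_pr _ h).
Qed.

Lemma ent_fst (Om Om' : finType) (P : Om -> R) (k : Om -> Om' -> R) (T : eqType) (A : Om -> T) :
  (forall w, pmf (k w)) -> ent (jn P k) (fun w => A w.1) = ent P A.
Proof.
move=> hk; apply: samelaw_ent => phi; rewrite Ex_jn; apply: eq_Ex => w _.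
by rewrite /= Ex_cst.
Qed.

Lemma ent_jn_indep (Om Om' : finType) (P : Om -> R) (Q : Om' -> R) (T T' : eqType)
  (A : Om -> T) (B : Om' -> T') : pmf P -> pmf Q ->
  ent (jn P (fun=> Q)) (fun w => (A w.1, B w.2)) = ent P A + ent Q B.
Proof.
move=> hP hQ; rewrite (@ent_indep _ _ _ _ _ _ (fun w => A w.1) (fun w => B w.2)).
- congr (_ + _); first exact: ent_fst.
  by apply: samelaw_ent => phi; rewrite Ex_jn /= Ex_cst.
- by apply: pmf_jn.
- move=> a b; rewrite /pr !Ex_jn /= (Ex_cst (Ex Q _) hP) -ExZr; apply: eq_Ex => w _.
  rewrite (Ex_cst (A w == a)%:R hQ) -ExZ; apply: eq_Ex => w' _; rewrite -!pair_eqE /= /pair_eq /=.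
  by rewrite -mulnb natrM.
Qed.

Lemma pr_prd (I Om : finType) (p : I -> Om -> R) (T : eqType) (A : I -> Om -> T)
  (a : {ffun I -> T}) :
  pr (prd p) (fun f => [ffun i => A i (f i)]) a = \prod_i pr (p i) (A i) (a i).
Proof.
rewrite -Ex_prd_prod; apply: eq_Ex => f _.
case: eqP => [<-|ne]; first by rewrite big1 // => i _; rewrite ffunE eqxx.
case: (pickP (fun i => A i (f i) != a i)) => [i ni|al].
  by rewrite (bigD1 i) //= (negbTE ni) mul0r.
by case: ne; apply/ffunP => i; rewrite ffunE; apply/eqP; move: (al i) => /negbFE.
Qed.

Lemma ln_prod (I : finType) (F : I -> R) : (forall i, 0 < F i) ->
  ln (\prod_i F i) = \sum_i ln (F i).
Proof.
move=> h; have : 0 < \prod_i F i /\ ln (\prod_i F i) = \sum_i ln (F i); last by case.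
elim/big_ind2: _ => //; first by rewrite ln1.
move=> x1 x2 y1 y2 [h1 <-] [h2 <-]; split; first exact: mulr_gt0.
by rewrite lnM.
Qed.

Lemma prd_gt0 (I Om : finType) (p : I -> Om -> R) (f : {ffun I -> Om}) i :
  (forall i, pmf (p i)) -> 0 < prd p f -> 0 < p i (f i).
Proof.
move=> hp; rewrite /prd (bigD1 i) //= => h.
have := pmf_ge0 (f i) (hp i); rewrite le_eqVlt => /orP[/eqP e|//].
by move: h; rewrite -e mul0r ltxx.
Qed.

Lemma ent_prd (I Om : finType) (p : I -> Om -> R) (T : eqType) (A : I -> Om -> T) :
  (forall i, pmf (p i)) ->
  ent (prd p) (fun f => [ffun i => A i (f i)]) = \sum_i ent (p i) (A i).
Proof.
move=> hp; rewrite /ent -(Ex_prd_sum (fun i w => - ln (pr (p i) (A i) (A i w)))) //.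
apply: eq_Ex => f /eqP pf; have pf' : 0 < prd p f.
  by rewrite lt0r (pmf_ge0 _ (pmf_prd hp)) andbT; apply/eqP.
rewrite pr_prd ln_prod ?sumrN => [|i]; last by rewrite ffunE pr_gt0 // (prd_gt0 i hp pf').
by congr (- _); apply: eq_bigr => i _; rewrite ffunE.
Qed.

Lemma samelaw_cent (Om Om' : finType) (P : Om -> R) (P' : Om' -> R) (T1 T2 : eqType)
  (A : Om -> T1) (A' : Om' -> T1) (B : Om -> T2) (B' : Om' -> T2) :
  samelaw P P' (fun w => (A w, B w)) (fun w => (A' w, B' w)) -> cent P A B = cent P' A' B'.
Proof. by move=> h; rewrite /cent (samelaw_ent h) (samelaw_ent (samelaw_comp snd h)). Qed.

Lemma cent_prd (J Om : finType) (P : Om -> R) (T1 T2 : eqType) (A : Om -> T1) (B : Om -> T2) :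
  pmf P ->
  cent (prd (fun _ : J => P)) (fun f : {ffun J -> Om} => [ffun s => A (f s)]) (fun f : {ffun J -> Om} => [ffun s => B (f s)]) =
  #|J|%:R * cent P A B.
Proof.
move=> hP; rewrite /cent (ent_prd (fun _ => B)) // mulrBr.
rewrite (@ent_eq _ _ _ _ _ _ _ (fun f : {ffun J -> Om} => [ffun s => (A (f s), B (f s))])).
- by rewrite (ent_prd (fun _ w => (A w, B w))) // !sumr_const !mulr_natl.
- exact: pmf_prd.
- move=> f f' _ _ /ffunP h; congr (_, _); apply/ffunP => s; have := h s; rewrite !ffunE => -[] //.
- move=> f f' _ _ [/ffunP h1 /ffunP h2]; apply/ffunP => s; rewrite !ffunE.
  by have := h1 s; have := h2 s; rewrite !ffunE => -> ->.
Qed.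

Lemma Ex_push (Om : finType) (P : Om -> R) (T : finType) (X : Om -> T) F :
  Ex (pr P X) F = Ex P (fun w => F (X w)).
Proof.
rewrite /pr {1}/Ex; under eq_bigr do rewrite -ExZr.
rewrite -Ex_sum; apply: eq_Ex => w _; rewrite (bigD1 (X w)) //= eqxx mul1r.
by rewrite big1 ?addr0 // => t /negbTE nt; rewrite eq_sym nt mul0r.
Qed.

Lemma pmf_push (Om : finType) (P : Om -> R) (T : finType) (X : Om -> T) : pmf P -> pmf (pr P X).
Proof.
move=> hP; split=> [t|]; first exact: pr_ge0.
by rewrite -[RHS](Ex_cst 1 hP) -(Ex_push P X (fun=> 1)); apply: eq_bigr => t _; rewrite mulr1.
Qed.

Lemma Ex_prd_push (J Om T : finType) (P : J -> Om -> R) (X : J -> Om -> T) F :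
  Ex (prd (fun s => pr (P s) (X s))) F = Ex (prd P) (fun f => F [ffun s => X s (f s)]).
Proof.
rewrite -(Ex_push _ (fun f : {ffun J -> Om} => [ffun s => X s (f s)])); apply: eq_bigr => w _.
by rewrite pr_prd.
Qed.

Lemma pr_gt0_ex (Om : finType) (P : Om -> R) (T : eqType) (X : Om -> T) t :
  pmf P -> 0 < pr P X t -> exists w, 0 < P w /\ X w = t.
Proof.
move=> [P0 _] h; case: (pickP (fun w => (0 < P w) && (X w == t))) => [w /andP[pw /eqP]|al].
  by exists w.
suff e : pr P X t = 0 by move: h; rewrite e ltxx.
apply: big1 => w _; have := al w; rewrite lt0r P0 andbT.
by case: eqP => [->|_]; rewrite ?mul0r //= => ->; rewrite mulr0.
Qed.

End EntropyLaws.

(** * Rearranging iterated product laws *)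

Section ProductLaws.
Context {R : realType}.

Lemma Ex_prd_transpose_dep (I J A : finType) (p : I -> J -> A -> R) F :
  Ex (prd (fun i => prd (p i))) F =
  Ex (prd (fun s => prd (fun i => p i s))) (fun y : {ffun J -> {ffun I -> A}} => F [ffun i => [ffun s => y s i]]).
Proof.
rewrite /Ex (reindex (fun y : {ffun J -> {ffun I -> A}} => [ffun i => [ffun s => y s i]])) /=.
  apply: eq_bigr => y _; congr (_ * _); rewrite /prd exchange_big /=.
  by apply: eq_bigr => i _; apply: eq_bigr => s _; rewrite !ffunE.
exists (fun f : {ffun I -> {ffun J -> A}} => [ffun s => [ffun i => f i s]]) => y _;
  by apply/ffunP => i; rewrite ffunE; apply/ffunP => s; rewrite !ffunE.
Qed.

Lemma Ex_prd_transpose (I J A : finType) (p : I -> A -> R) F :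
  Ex (prd (fun i : I => prd (fun _ : J => p i))) F =
  Ex (prd (fun _ : J => prd p)) (fun y => F [ffun i => [ffun s => y s i]]).
Proof. exact: (Ex_prd_transpose_dep (fun i _ => p i) F). Qed.

Lemma Ex_prd_zip (J A B : finType) (p : J -> A -> R) (k : J -> A -> B -> R) F :
  Ex (prd p) (fun x => Ex (prd (fun s => k s (x s))) (fun w => F x w)) =
  Ex (prd (fun s => jn (p s) (k s))) (fun y => F [ffun s => (y s).1] [ffun s => (y s).2]).
Proof.
rewrite /Ex; under eq_bigr do rewrite mulr_sumr.
rewrite pair_bigA /=.
rewrite (reindex (fun y : {ffun J -> A * B} => ([ffun s => (y s).1], [ffun s => (y s).2]))) /=.
  apply: eq_bigr => y _; rewrite mulrA; congr (_ * _); rewrite /prd -big_split.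
  by apply: eq_bigr => s _; rewrite /jn !ffunE.
exists (fun w : {ffun J -> A} * {ffun J -> B} => [ffun s => (w.1 s, w.2 s)]) => [y _|[x w] _].
  by apply/ffunP => s; rewrite !ffunE; case: (y s).
by congr (_, _); apply/ffunP => s; rewrite !ffunE.
Qed.

Lemma Ex_curry (A B C : finType) (q : A -> B -> C -> R) F :
  Ex (prd (fun i : A => prd (q i))) F =
  Ex (prd (fun k : A * B => q k.1 k.2)) (fun g => F [ffun i => [ffun v => g (i, v)]]).
Proof.
rewrite /Ex (reindex (fun g : {ffun A * B -> C} => [ffun i => [ffun v => g (i, v)]])) /=.
  apply: eq_bigr => g _; congr (_ * _); rewrite /prd pair_bigA; apply: eq_bigr => -[i v] _ /=.
  by rewrite !ffunE.
exists (fun x : {ffun A -> {ffun B -> C}} => [ffun k => x k.1 k.2]) => g _.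
  by apply/ffunP => -[i v]; rewrite !ffunE.
by apply/ffunP => i; apply/ffunP => v; rewrite !ffunE.
Qed.

End ProductLaws.

(** * Random maps *)

Section RandomMap.
Context {R : realType} {I : finType}.

(** The value [None] outside [C] gives all subfamilies one type that does not depend on [C]. *)
Definition vres (Om : finType) (VV : eqType) (C : {set I}) (V : I -> Om -> VV) (w : Om) :
  {ffun I -> option VV} := [ffun i => if i \in C then Some (V i w) else None].

Lemma vresP (Om Om' : finType) (VV : eqType) (C : {set I}) (V : I -> Om -> VV)
  (V' : I -> Om' -> VV) w w' :
  vres C V w = vres C V' w' <-> {in C, forall i, V i w = V' i w'}.
Proof.
split=> [/ffunP h i iC|h]; first by have := h i; rewrite !ffunE iC => -[].
by apply/ffunP => i; rewrite !ffunE; case: ifP => // /h ->.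
Qed.

Context {X WO : finType} (pX : I -> X -> R) (hpX : forall i, pmf (pX i)).
Context (kap : {ffun I -> X} -> WO -> R) (hkap : forall x, pmf (kap x)).

(** As the inputs are independent, this is the conditional law of the output given the inputs in
    [C]; see [kapC_cent]. *)
Definition kapC (C : {set I}) (x : {ffun I -> X}) (w : WO) : R :=
  Ex (prd pX) (fun x' => kap (merge (mem C) x x') w).

Lemma kapC_ge0 C x w : 0 <= kapC C x w.
Proof. by apply: Ex_ge0 => [a|a _]; [exact: pmf_ge0 (pmf_prd hpX)|exact: pmf_ge0]. Qed.

Lemma kapC_gt0 C x w : 0 < prd pX x -> 0 < kap x w -> 0 < kapC C x w.
Proof.
move=> px kx; rewrite /kapC /Ex (bigD1 x) //= ltr_pwDl //.
  rewrite mulr_gt0 // (_ : merge _ x x = x) //.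
  by apply/ffunP => i; rewrite ffunE; case: ifP.
by apply: sumr_ge0 => x' _; rewrite mulr_ge0 ?(pmf_ge0 _ (pmf_prd hpX)) ?(pmf_ge0 _ (hkap _)).
Qed.

(** The table [g] is the random map: relay i sends the entry at its own message, and entries at
    different messages are independent letters. *)
Definition gmap (VV : finType) (g : {ffun I * VV -> X}) (v : I -> VV) : {ffun I -> X} :=
  [ffun i => g (i, v i)].

Definition gpmf (VV : finType) (k : I * VV) : X -> R := pX k.1.

Lemma hgpmf (VV : finType) (k : I * VV) : pmf (gpmf k). Proof. exact: hpX. Qed.

Lemma Ex_gmap (VV : finType) (v : I -> VV) F :
  Ex (prd (@gpmf VV)) (fun g => F (gmap g v)) = Ex (prd pX) F.
Proof.
have einj : injective (fun i : I => (i, v i)) by move=> i j [].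
exact: (Ex_prd_inj F (@hgpmf VV) einj).
Qed.

(* Two trajectories see the same input at the relays where they agree, independent ones elsewhere. *)
Lemma Ex_gmap2 (VV : finType) (v v' : I -> VV) F :
  Ex (prd (@gpmf VV)) (fun g => F (gmap g v) (gmap g v')) =
  Ex (prd pX) (fun x => Ex (prd pX) (fun x' => F x (merge (mem [set i | v i == v' i]) x x'))).
Proof.
rewrite -(Ex_merge (fun k => k.2 == v k.1) _ (@hgpmf VV)).
rewrite -(Ex_gmap v); apply: eq_Ex => g _; rewrite -(Ex_gmap v'); apply: eq_Ex => g' _.
congr (F _ _); apply/ffunP => i; rewrite !ffunE /= ?eqxx // inE eq_sym.
by case: eqP => [->|].
Qed.

Context {Om VV : finType} {ZT FT : eqType}.
Context (P : Om -> R) (hP : pmf P) (V : I -> Om -> VV) (Z : Om -> ZT) (F : Om -> FT).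

Definition rmlaw : Om * ({ffun I * VV -> X} * WO) -> R :=
  jn P (fun om => jn (prd (@gpmf VV)) (fun g => kap (gmap g (V^~ om)))).

Lemma pmf_rmlaw : pmf rmlaw.
Proof.
apply: pmf_jn => // om; apply: pmf_jn => [|g]; [exact: pmf_prd (@hgpmf VV)|exact: hkap].
Qed.

(** The comparison density of the entropy bound. Its term at [C] stands for the outcomes whose
    messages agree with those of [om] on [C], weighted by the output law when all inputs outside [C]
    are fresh. *)
Definition rmq (T : {set I}) (om : Om) (x : {ffun I -> X}) (w : WO) : R :=
  \sum_(C : {set I} | C \subset T)
    kapC C x w * (pr P (fun o => (vres C V o, Z o, F o)) (vres C V om, Z om, F om) / pr P F (F om)).

Lemma rmlaw_gt0 om g w : 0 < rmlaw (om, (g, w)) ->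
  [/\ 0 < P om, 0 < prd (@gpmf VV) g, 0 < prd pX (gmap g (V^~ om)) & 0 < kap (gmap g (V^~ om)) w].
Proof.
rewrite /rmlaw /jn /= => h.
have h1 : 0 < P om.
  have := pmf_ge0 om hP; rewrite le_eqVlt => /orP[/eqP e|//].
  by move: h; rewrite -e mul0r ltxx.
rewrite pmulr_rgt0 // in h.
have h2 : 0 < prd (@gpmf VV) g.
  have := pmf_ge0 g (pmf_prd (@hgpmf VV)); rewrite le_eqVlt => /orP[/eqP e|//].
  by move: h; rewrite -e mul0r ltxx.
rewrite pmulr_rgt0 // in h; split=> //.
apply: prodr_gt0 => i _; rewrite ffunE.
exact: (prd_gt0 (i, V i om) (@hgpmf VV) h2).
Qed.

Lemma rmq_gt0 T om x w : 0 < P om -> 0 < prd pX x -> 0 < kap x w -> 0 < rmq T om x w.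
Proof.
move=> h1 h2 h3; rewrite /rmq (bigD1 set0) ?sub0set //= ltr_pwDl //.
  by rewrite mulr_gt0 ?kapC_gt0 // divr_gt0 // pr_gt0.
by apply: sumr_ge0 => C _; rewrite mulr_ge0 ?kapC_ge0 // divr_ge0 // pr_ge0.
Qed.

(** The joint law of output and table is an average over a second outcome [o]. The table gives [om]
    and [o] equal inputs where their messages agree and independent ones elsewhere, so [o]
    contributes to the term of [rmq] at the agreeing set. Allowing every [C] only enlarges the total
    and leaves the quotient [rmq / rmq]. *)
Lemma random_map_oneshot (T : {set I}) :
  (forall (x x' : {ffun I -> X}) w, {in T, x =1 x'} -> kap x w = kap x' w) ->
  Ex P (fun om => Ex (prd pX) (fun x => Ex (kap x) (fun w => - ln (rmq T om x w)))) <=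
  cent rmlaw (fun s => (s.2.2, Z s.1)) (fun s => (s.2.1, F s.1)).
Proof.
move=> kT; have hL := pmf_rmlaw.
pose q (s : Om * ({ffun I * VV -> X} * WO)) := rmq T s.1 (gmap s.2.1 (V^~ s.1)) s.2.2.
have -> : Ex P (fun om => Ex (prd pX) (fun x => Ex (kap x) (fun w => - ln (rmq T om x w)))) =
    Ex rmlaw (fun s => - ln (q s)).
  rewrite /rmlaw Ex_jn; apply: eq_Ex => om _; rewrite Ex_jn.
  by rewrite -(Ex_gmap (V^~ om)); apply: eq_Ex.
pose GF := fun s : Om * ({ffun I * VV -> X} * WO) => (s.2.1, F s.1).
pose JV := fun s : Om * ({ffun I * VV -> X} * WO) => ((s.2.2, Z s.1), (s.2.1, F s.1)).
pose A (om : Om) (g : {ffun I * VV -> X}) w : R :=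
  Ex P (fun o => ((Z o == Z om) && (F o == F om))%:R * kap (gmap g (V^~ o)) w).
have prGF g om : pr rmlaw GF (g, F om) = prd (@gpmf VV) g * pr P F (F om).
  rewrite /pr /rmlaw Ex_jn -ExZ; apply: eq_Ex => o _; rewrite Ex_jn.
  rewrite {1}/Ex (bigD1 g) //= big1 ?addr0 => [|g' /negbTE ng].
    congr (_ * _); rewrite -[RHS](Ex_cst _ (hkap (gmap g (V^~ o)))).
    by apply: eq_Ex => w _; rewrite /GF -pair_eqE /= /pair_eq /= eqxx.
  rewrite (_ : Ex _ _ = 0) ?mulr0 // -(Ex_cst 0 (hkap (gmap g' (V^~ o)))).
  by apply: eq_Ex => w _; rewrite /GF -pair_eqE /= /pair_eq /= ng.
have prJ w om g : pr rmlaw JV ((w, Z om), (g, F om)) = prd (@gpmf VV) g * A om g w.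
  rewrite /pr /rmlaw Ex_jn /A -ExZ; apply: eq_Ex => o _; rewrite Ex_jn.
  rewrite {1}/Ex (bigD1 g) //= big1 ?addr0 => [|g' /negbTE ng].
    congr (_ * _); rewrite mulrC /Ex (bigD1 w) //= big1 ?addr0 => [|w' /negbTE nw].
      by rewrite /JV -pair_eqE /= /pair_eq /= -!pair_eqE /= /pair_eq /= !eqxx.
    by rewrite /JV -pair_eqE /= /pair_eq /= -!pair_eqE /= /pair_eq /= nw mulr0.
  rewrite (_ : Ex _ _ = 0) ?mulr0 // -(Ex_cst 0 (hkap (gmap g' (V^~ o)))).
  by apply: eq_Ex => w' _; rewrite /JV -pair_eqE /= /pair_eq /= -!pair_eqE /= /pair_eq /= ng andbF.
pose t s := pr rmlaw JV (JV s) / (pr rmlaw GF (GF s) * q s).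
have q0 s : 0 < rmlaw s -> 0 < q s.
  by case: s => om [g w] /rmlaw_gt0[h1 h2 h3 h4]; exact: rmq_gt0.
have t0 s : 0 < rmlaw s -> 0 < t s.
  by move=> h; rewrite divr_gt0 ?mulr_gt0 ?pr_gt0 ?q0.
suff ht : Ex rmlaw t <= 1.
  have := Ex_ln_le hL t0 ht; rewrite -[_ <= cent _ _ _]subr_le0.
  congr (_ <= _); rewrite /cent /ent -!ExB; apply: eq_Ex => s /eqP ps.
  have ps' : 0 < rmlaw s by rewrite lt0r (pmf_ge0 _ hL) andbT; apply/eqP.
  rewrite /t ln_div ?posrE ?mulr_gt0 ?pr_gt0 ?q0 // lnM ?posrE ?pr_gt0 ?q0 // -/JV -/GF; ring.
(* By [kT] agreement outside [T] does not affect the kernel, so the agreeing set is cut down to [T];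
   this confines [rmq] to subsets of [T]. *)
pose H om o w x : R := kap x w * kapC ([set i | V i om == V i o] :&: T) x w / rmq T om x w.
have e1 : Ex rmlaw t = Ex P (fun om => Ex P (fun o => ((Z o == Z om) && (F o == F om))%:R *
     (\sum_w Ex (prd pX) (H om o w)) / pr P F (F om))).
  transitivity (Ex rmlaw (fun s => A s.1 s.2.1 s.2.2 / (pr P F (F s.1) * q s))).
    apply: eq_Ex => -[om [g w]] /eqP ps.
    have /rmlaw_gt0[_ g0 _ _] : 0 < rmlaw (om, (g, w)) by rewrite lt0r (pmf_ge0 _ hL) andbT; apply/eqP.
    by rewrite /t /JV /GF /= prJ prGF -[_ * pr P F _ * _]mulrA -mulf_div divff ?mul1r // gt_eqF.
  rewrite /rmlaw Ex_jn; apply: eq_Ex => om _; rewrite Ex_jn /=.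
  transitivity (Ex (prd (@gpmf VV)) (fun g => \sum_w Ex P (fun o => ((Z o == Z om) && (F o == F om))%:R *
     (kap (gmap g (V^~ om)) w * kap (gmap g (V^~ o)) w / rmq T om (gmap g (V^~ om)) w) / pr P F (F om)))).
    apply: eq_Ex => g _; rewrite {1}/Ex; apply: eq_bigr => w _.
    rewrite /A /q /= -ExZr -ExZ; apply: eq_Ex => o _; rewrite invfM; ring.
  rewrite Ex_sum; transitivity (\sum_w Ex P (fun o => ((Z o == Z om) && (F o == F om))%:R *
      Ex (prd pX) (H om o w) / pr P F (F om))).
    apply: eq_bigr => w _; rewrite Ex_swap; apply: eq_Ex => o _.
    rewrite ExZr ExZ; congr (_ * _ * _).
    rewrite (Ex_gmap2 (V^~ om) (V^~ o) (fun x x' => kap x w * kap x' w / rmq T om x w)).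
    apply: eq_Ex => x _; rewrite ExZr ExZ /H; congr (_ * _ * _); apply: eq_Ex => x' _.
    by apply: kT => i iT; rewrite !ffunE !inE iT andbT.
  by rewrite -Ex_sum; apply: eq_Ex => o _; rewrite -mulr_suml -mulr_sumr.
rewrite e1 -[leRHS](Ex_cst 1 hP); have P0 o : 0 <= P o by case: hP.
apply: ler_Ex => // om pom.
have hX := pmf_prd hpX.
pose Phi C := \sum_w Ex (prd pX) (fun x => kap x w * kapC C x w / rmq T om x w).
have rmq_ge0 x w : 0 <= rmq T om x w.
  by apply: sumr_ge0 => C _; rewrite mulr_ge0 ?kapC_ge0 // divr_ge0 // pr_ge0.
have Phi0 C : 0 <= Phi C.
  apply: sumr_ge0 => w _; apply: Ex_ge0 => [x|x _]; first exact: pmf_ge0.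
  by rewrite divr_ge0 // mulr_ge0 ?kapC_ge0 // pmf_ge0.
pose p3 C o := (vres C V o, Z o, F o).
have h1 o : ((Z o == Z om) && (F o == F om))%:R * (\sum_w Ex (prd pX) (H om o w)) / pr P F (F om) <=
   \sum_(C : {set I} | C \subset T) (p3 C o == p3 C om)%:R * (Phi C / pr P F (F om)).
  have F0 : 0 <= pr P F (F om) by exact: pr_ge0.
  have tt0 C : 0 <= (p3 C o == p3 C om)%:R * (Phi C / pr P F (F om)).
    by rewrite mulr_ge0 ?ler0n // divr_ge0.
  case: (boolP (_ && _)) => [/andP[/eqP zE /eqP fE]|_]; last first.
    by rewrite !mul0r sumr_ge0.
  set C0 := [set i | V i om == V i o] :&: T.
  have pE : p3 C0 o = p3 C0 om.
    rewrite /p3 zE fE; congr (_, _, _).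
    by apply/vresP => i; rewrite !inE => /andP[/eqP -> _].
  rewrite mul1r (bigD1 C0) ?subsetIr //= pE eqxx mul1r lerDl.
  by rewrite sumr_ge0.
apply: (le_trans (ler_Ex P0 (fun o _ => h1 o))); rewrite Ex_sum.
rewrite (_ : \sum_(C : {set I} | C \subset T) _ =
   \sum_w Ex (prd pX) (fun x => kap x w * (rmq T om x w / rmq T om x w))); last first.
  rewrite -Ex_sum (eq_bigr (fun C => \sum_w Ex (prd pX) (fun x => kap x w *
     ((kapC C x w * (pr P (p3 C) (p3 C om) / pr P F (F om))) / rmq T om x w)))); last first.
    move=> C _; rewrite ExZr -/(pr P (p3 C) (p3 C om)); move: (pr P (p3 C) _) => c.
    rewrite /Phi mulr_suml mulr_sumr; apply: eq_bigr => w _.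
    rewrite -ExZr -ExZ; apply: eq_Ex => x _; ring.
  rewrite exchange_big Ex_sum; apply: eq_bigr => w _ /=.
  rewrite -Ex_sum; apply: eq_Ex => x _; rewrite -mulr_sumr; congr (_ * _).
  by rewrite -mulr_suml.
rewrite -Ex_sum; apply: Ex_le1 => // x; rewrite -(pmf_sum1 (hkap x)); apply: ler_sum => w _.
rewrite ler_piMr ?(pmf_ge0 _ (hkap x)) //.
by case: (eqVneq (rmq T om x w) 0) => [->|ne]; [rewrite mul0r ler01|rewrite divff].
Qed.

End RandomMap.

(** * The random-map bound for many independent copies *)

Section RandomMapIid.
Context {R : realType} {I X WO : finType}.
Context (pX : I -> X -> R) (hpX : forall i, pmf (pX i)).
Context (kap : {ffun I -> X} -> WO -> R) (hkap : forall x, pmf (kap x)).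
Context {Om VV : finType} {ZT FT : eqType}.
Context (P : Om -> R) (hP : pmf P) (V : I -> Om -> VV) (Z : Om -> ZT) (F : Om -> FT).

Definition blockX (J : finType) (i : I) : {ffun J -> X} -> R := prd (fun _ : J => pX i).

Definition blockK (J : finType) (x : {ffun I -> {ffun J -> X}}) : {ffun J -> WO} -> R :=
  prd (fun s => kap [ffun i => x i s]).

Definition letterlaw : {ffun I -> X} * WO -> R := jn (prd pX) kap.

Lemma pmf_letterlaw : pmf letterlaw.
Proof. by apply: pmf_jn => //; exact: pmf_prd. Qed.

Lemma pmf_blockX J i : pmf (@blockX J i). Proof. exact: pmf_prd. Qed.
Lemma pmf_blockK J x : pmf (@blockK J x). Proof. exact: pmf_prd. Qed.

Lemma kapC_block (J : finType) C (x : {ffun I -> {ffun J -> X}}) (w : {ffun J -> WO}) :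
  kapC (@blockX J) (@blockK J) C x w = \prod_s kapC pX kap C [ffun i => x i s] (w s).
Proof.
rewrite /kapC /blockX Ex_prd_transpose.
rewrite -(Ex_prd_prod (fun _ : J => prd pX)
  (fun s x' => kap (merge (mem C) [ffun i => x i s] x') (w s))).
apply: eq_Ex => y _; apply: eq_bigr => s _; congr (kap _ _).
by apply/ffunP => i; rewrite !ffunE /=; case: ifP => _; rewrite ?ffunE.
Qed.

Lemma Ex_block (J : finType) Phi :
  Ex (prd (@blockX J)) (fun x => Ex (@blockK J x) (Phi x)) =
  Ex (prd (fun _ : J => letterlaw)) (fun y => Phi [ffun i => [ffun s => (y s).1 i]] [ffun s => (y s).2]).
Proof.
rewrite /blockX Ex_prd_transpose.
transitivity (Ex (prd (fun _ : J => prd pX)) (fun x => Ex (prd (fun s => kap (x s)))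
  (fun w => Phi [ffun i => [ffun s => x s i]] w))).
  apply: eq_Ex => y _; rewrite /blockK /Ex; apply: eq_bigr => w _; congr (_ * _).
  apply: eq_bigr => s _; congr (kap _ _).
  by apply/ffunP => i; rewrite !ffunE.
rewrite (Ex_prd_zip (fun _ : J => prd pX) (fun _ : J => kap)
  (fun x w => Phi [ffun i => [ffun s => x s i]] w)).
apply: eq_Ex => y _; congr Phi.
by apply/ffunP => i; apply/ffunP => s; rewrite !ffunE.
Qed.

Definition NV (N : nat) (i : I) (om : {ffun 'I_N -> Om}) : {ffun 'I_N -> VV} :=
  [ffun c => V i (om c)].
Definition NF (N : nat) (T : eqType) (A : Om -> T) (om : {ffun 'I_N -> Om}) : {ffun 'I_N -> T} :=
  [ffun c => A (om c)].

Definition Nlaw N : {ffun 'I_N -> Om} -> R := prd (fun _ => P).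
Lemma pmf_Nlaw N : pmf (@Nlaw N). Proof. exact: pmf_prd. Qed.

Lemma pr_Ncopies N C om :
  pr (@Nlaw N) (fun o => (vres C (@NV N) o, NF Z o, NF F o)) (vres C (@NV N) om, NF Z om, NF F om) =
  \prod_c pr P (fun o => (vres C V o, Z o, F o)) (vres C V (om c), Z (om c), F (om c)).
Proof.
set p3 := fun o => (vres C V o, Z o, F o).
have := pr_prd (fun _ : 'I_N => P) (fun _ => p3) [ffun c => p3 (om c)].
under [X in _ = X -> _]eq_bigr do rewrite ffunE; move=> <-.
apply: eq_Ex => f _; congr (nat_of_bool _)%:R; apply/eqP/eqP => [[/vresP h1 /ffunP h2 /ffunP h3]|/ffunP h].
  apply/ffunP => c; rewrite !ffunE /p3; have := h2 c; have := h3 c; rewrite !ffunE => -> ->.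
  congr (_, _, _); apply/vresP => i iC; have := h1 i iC.
  by move/ffunP => /(_ c); rewrite !ffunE.
congr (_, _, _).
- apply/vresP => i iC; apply/ffunP => c; rewrite !ffunE.
  by have := h c; rewrite !ffunE => -[/vresP h1 _ _]; exact: h1.
- by apply/ffunP => c; rewrite !ffunE; have := h c; rewrite !ffunE => -[].
- by apply/ffunP => c; rewrite !ffunE; have := h c; rewrite !ffunE => -[].
Qed.

Lemma pr_Ncopies1 N (T : eqType) (A : Om -> T) om :
  pr (@Nlaw N) (NF A) (NF A om) = \prod_c pr P A (A (om c)).
Proof.
by rewrite [LHS](pr_prd (fun _ : 'I_N => P) (fun _ => A)); apply: eq_bigr => c _; rewrite ffunE.
Qed.

(** With [kC], a one-letter factor of the term of [rmq] at [C]; their negative logarithms have as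
    means the two terms in the hypothesis of [random_map_iid]. *)
Definition rC C o := pr P (fun o => (vres C V o, Z o, F o)) (vres C V o, Z o, F o) / pr P F (F o).
Definition kC C (y : {ffun I -> X} * WO) := kapC pX kap C y.1 y.2.

Lemma rmq_block (J : finType) N (T : {set I}) om (y : {ffun J -> {ffun I -> X} * WO}) :
  rmq (@blockX J) (@blockK J) (@Nlaw N) (@NV N) (NF Z) (NF F) T om
    [ffun i => [ffun s => (y s).1 i]] [ffun s => (y s).2] =
  \sum_(C : {set I} | C \subset T) (\prod_s kC C (y s)) * \prod_c rC C (om c).
Proof.
apply: eq_bigr => C _; congr (_ * _); last by rewrite pr_Ncopies pr_Ncopies1 -prodf_div.
rewrite kapC_block; apply: eq_bigr => s _; rewrite /kC ffunE; congr (kapC _ _ _ _ _).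
by apply/ffunP => i; rewrite !ffunE.
Qed.

Lemma Ex_ln_rC C : Ex P (fun o => - ln (rC C o)) = cent P (fun o => (vres C V o, Z o)) F.
Proof.
rewrite /cent /ent -ExB; apply: eq_Ex => o /eqP po.
have po' : 0 < P o by rewrite lt0r (pmf_ge0 _ hP) andbT; apply/eqP.
by rewrite /rC ln_div ?posrE ?pr_gt0 //; ring.
Qed.

(** For N copies every term of [rmq] is at most exp(-N m) up to fluctuations, and the number of
    terms does not depend on N. Fluctuations enter only through their means, so no typical sets
    occur. *)
Lemma random_map_iid (T : {set I}) (n : nat) (m d : R) : 0 < d ->
  (forall (x x' : {ffun I -> X}) w, {in T, x =1 x'} -> kap x w = kap x' w) ->
  (forall C : {set I}, C \subset T ->
     m <= cent P (fun o => (vres C V o, Z o)) F + n%:R * Ex letterlaw (fun y => - ln (kC C y))) ->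
  exists N0 : nat, forall N : nat, (N0 <= N)%N -> forall J : finType, #|J| = (N * n)%N ->
  N%:R * (m - d) <=
  cent (rmlaw (@blockX J) (@blockK J) (@Nlaw N) (@NV N))
    (fun s => (s.2.2, NF Z s.1)) (fun s => (s.2.1, NF F s.1)).
Proof.
move=> d0 kT hm.
pose c : R := #|{: {set I}}|%:R.
have c0 : 0 < c by rewrite ltr0n; apply/card_gt0P; exists set0.
(* Over the c sets, the fluctuations of N message factors and N n output factors cost c e (N + N n)
   = N d / 4, and the number of terms costs ln c <= N d / 2. *)
pose e := d / (4 * c * (1 + n%:R)).
have n0 : 0 < 1 + n%:R :> R by rewrite ltr_pwDl // ler0n.
have e0 : 0 < e by rewrite divr_gt0 // !mulr_gt0.
pose v : R := \sum_(C : {set I}) (var P (fun o => - ln (rC C o)) + var letterlaw (fun y => - ln (kC C y))).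
have hL := pmf_letterlaw.
have vP C : var P (fun o => - ln (rC C o)) <= v.
  rewrite /v (bigD1 C) //= -addrA lerDl addr_ge0 ?var_ge0 // sumr_ge0 // => C' _.
  by rewrite addr_ge0 // var_ge0.
have vL C : var letterlaw (fun y => - ln (kC C y)) <= v.
  rewrite /v (bigD1 C) //= addrAC lerDr addr_ge0 ?var_ge0 // sumr_ge0 // => C' _.
  by rewrite addr_ge0 // var_ge0.
have v0 : 0 <= v by apply: le_trans (vP set0); exact: var_ge0.
exists (Num.bound (v / e ^+ 2) + Num.bound (2 * ln c / d))%N.+1 => N hN J cJ.
have Npos : (0 < N)%N by apply: leq_trans hN.
have hN1 : v <= e ^+ 2 * N%:R.
  rewrite mulrC -ler_pdivrMr ?exprn_gt0 //.
  apply: (le_trans (ltW (archi_boundP _))); first by rewrite divr_ge0 // sqr_ge0.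
  by rewrite ler_nat (leq_trans _ hN) // leqW // leq_addr.
have hN2 : ln c <= d / 2 * N%:R.
  have [lc|lc] := ltP (ln c) 0.
    by apply: le_trans (ltW lc) _; rewrite mulr_ge0 ?ler0n // divr_ge0 // ltW.
  rewrite mulrC -ler_pdivrMr ?divr_gt0 // invf_div mulrA (mulrC _ 2).
  apply: (le_trans (ltW (archi_boundP _))); first by rewrite divr_ge0 ?mulr_ge0 // ltW.
  by rewrite ler_nat (leq_trans _ hN) // leqW // leq_addl.
have hJ : (0 < #|J|)%N -> v <= e ^+ 2 * #|J|%:R.
  rewrite cJ muln_gt0 => /andP[_ n1]; apply: (le_trans hN1).
  by rewrite ler_wpM2l ?sqr_ge0 // ler_nat leq_pmulr.
have hX := @pmf_blockX J; have hK := @pmf_blockK J; have hN' := pmf_Nlaw N.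
apply: le_trans (random_map_oneshot hX hK hN' _ _ _ (T := T) _); last first.
  move=> x x' w h; apply: eq_bigr => s _; apply: kT => i iT.
  by rewrite !ffunE h.
have e1 : Ex (@Nlaw N) (fun om => Ex (prd (@blockX J)) (fun x => Ex (@blockK J x) (fun w =>
   - ln (rmq (@blockX J) (@blockK J) (@Nlaw N) (@NV N) (NF Z) (NF F) T om x w)))) =
   Ex (@Nlaw N) (fun om => Ex (prd (fun _ : J => letterlaw)) (fun y =>
   - ln (\sum_(C : {set I} | C \subset T) (\prod_s kC C (y s)) * \prod_c rC C (om c)))).
  apply: eq_Ex => om _; rewrite Ex_block; apply: eq_Ex => y _.
  by rewrite rmq_block.
rewrite e1.
pose aE C := Ex P (fun o => - ln (rC C o)).
pose bE C := Ex letterlaw (fun y => - ln (kC C y)).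
pose D1 C (om : {ffun 'I_N -> Om}) : R := `|\sum_c - ln (rC C (om c)) - \sum_(c < N) aE C|.
pose D2 C (y : {ffun J -> {ffun I -> X} * WO}) : R := `|\sum_s - ln (kC C (y s)) - \sum_(s : J) bE C|.
have hPl := pmf_prd (fun _ : J => hL).
have step om y : 0 < Nlaw om -> 0 < prd (fun _ : J => letterlaw) y ->
  N%:R * m - ln c - (\sum_C D1 C om + \sum_C D2 C y) <=
  - ln (\sum_(C : {set I} | C \subset T) (\prod_s kC C (y s)) * \prod_c rC C (om c)).
  move=> pom py.
  have r0 C c' : 0 < rC C (om c').
    by have pc := prd_gt0 c' (fun _ => hP) pom; rewrite /rC divr_gt0 // pr_gt0.
  have k0 C s : 0 < kC C (y s).
    have := prd_gt0 s (fun _ => hL) py; rewrite /letterlaw /jn => pk.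
    have px : 0 < prd pX (y s).1.
      have := pmf_ge0 (y s).1 (pmf_prd hpX); rewrite le_eqVlt => /orP[/eqP ez|//].
      by move: pk; rewrite -ez mul0r ltxx.
    by apply: kapC_gt0 => //; rewrite pmulr_rgt0 // in pk.
  pose D := \sum_C D1 C om + \sum_C D2 C y.
  have hd (a b : R) : b - `|a - b| <= a by rewrite distrC lerBlDr -lerBlDl ler_norm.
  have term (C : {set I}) : C \subset T -> (\prod_s kC C (y s)) * \prod_c rC C (om c) <= expR (- (N%:R * m - D)).
    move=> CT; have h1 : 0 < \prod_s kC C (y s) by apply: prodr_gt0.
    have h2 : 0 < \prod_c rC C (om c) by apply: prodr_gt0.
    rewrite -[leLHS]lnK ?posrE ?mulr_gt0 // ler_expR lnM ?posrE // !ln_prod //.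
    have hd1 : N%:R * aE C - D1 C om <= - \sum_c ln (rC C (om c)).
      have := hd (\sum_c - ln (rC C (om c))) (\sum_(c < N) aE C).
      by rewrite [X in X - _]sumr_const card_ord -[aE C *+ _]mulr_natl /D1 !sumrN.
    have hd2 : #|J|%:R * bE C - D2 C y <= - \sum_s ln (kC C (y s)).
      have := hd (\sum_s - ln (kC C (y s))) (\sum_(s : J) bE C).
      by rewrite [X in X - _]sumr_const -[bE C *+ _]mulr_natl /D2 !sumrN.
    have hD1 : D1 C om + D2 C y <= D.
      rewrite /D (bigD1 C) //= [X in _ <= _ + X](bigD1 C) //=.
      by apply: lerD; rewrite lerDl sumr_ge0 // => C' _; exact: normr_ge0.
    have := hm C CT; rewrite -Ex_ln_rC -/(aE C) -/(bE C) => hmc.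
    have : N%:R * m <= N%:R * aE C + #|J|%:R * bE C.
      by rewrite cJ natrM -mulrA -mulrDr ler_wpM2l.
    lra.
  set S := \sum_(C : {set I} | C \subset T) _; have S0 : 0 < S.
    rewrite /S (bigD1 set0) ?sub0set //= ltr_pwDl //.
      by rewrite mulr_gt0 // prodr_gt0.
    by apply: sumr_ge0 => C _; apply: mulr_ge0; apply: prodr_ge0 => i _; exact: ltW.
  have hS : S <= c * expR (- (N%:R * m - D)).
    apply: (le_trans (ler_sum _ term)).
    rewrite sumr_const /c [_%:R * expR _]mulr_natl ler_wpMn2l ?expR_ge0 //.
    exact: max_card.
  have : ln S <= ln c - (N%:R * m - D).
    rewrite -[X in _ - X]opprK opprK -[X in _ + X]expRK -lnM ?posrE ?expR_gt0 //.
    by rewrite ler_ln ?posrE // mulr_gt0 // expR_gt0.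
  rewrite /D; lra.
have P1 : Ex (@Nlaw N) (fun om => \sum_C D1 C om) <= c * (e * N%:R).
  rewrite Ex_sum /c mulr_natl -sumr_const; apply: ler_sum => C _.
  have := lln_L1 (p := fun _ : 'I_N => P) (g := fun _ o => - ln (rC C o)) (fun _ => hP) (fun _ => vP C) e0.
  by rewrite card_ord => /(_ (fun _ => hN1)).
have P2 : Ex (prd (fun _ : J => letterlaw)) (fun y => \sum_C D2 C y) <= c * (e * #|J|%:R).
  rewrite Ex_sum /c mulr_natl -sumr_const; apply: ler_sum => C _.
  exact: (lln_L1 (p := fun _ : J => letterlaw) (g := fun _ o => - ln (kC C o)) (fun _ => hL) (fun _ => vL C) e0 hJ).
have ge0 (A : finType) (p : A -> R) : pmf p -> forall a, 0 <= p a by case.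
apply: (@le_trans _ _ (Ex (@Nlaw N) (fun om => Ex (prd (fun _ : J => letterlaw)) (fun y =>
  N%:R * m - ln c - (\sum_C D1 C om + \sum_C D2 C y))))); last first.
  apply: ler_Ex => [|om pom]; first exact: ge0.
  by apply: ler_Ex => [|y py]; [exact: ge0|exact: step].
have -> : Ex (@Nlaw N) (fun om => Ex (prd (fun _ : J => letterlaw)) (fun y =>
  N%:R * m - ln c - (\sum_C D1 C om + \sum_C D2 C y))) =
  N%:R * m - ln c - (Ex (@Nlaw N) (fun om => \sum_C D1 C om) +
    Ex (prd (fun _ : J => letterlaw)) (fun y => \sum_C D2 C y)).
  rewrite -[X in _ = _ - (_ + X)](Ex_cst _ hN') -[X in _ = X - _](Ex_cst _ hN') -ExD -ExB.
  apply: eq_Ex => om _; rewrite ExB Ex_cst // ExD Ex_cst //.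
have : c * (e * N%:R) + c * (e * #|J|%:R) = d / 4 * N%:R.
  by rewrite cJ natrM /e; field; rewrite !gt_eqF.
have : 0 <= d * N%:R by rewrite mulr_ge0 // ltW.
lra.
Qed.

End RandomMapIid.

(** * Channel uses with feedback *)

Section Run.
Context {R : realType} {In : Type} {O : finType} (W : In -> O -> R) (hW : forall x, pmf (W x)).

(* expectation of [phi] over the outputs of [T] channel uses driven by the feedback strategy [s] *)
Fixpoint run (T : nat) (s : seq O -> In) (phi : seq O -> R) : R :=
  if T is T'.+1 then
    Ex (W (s [::])) (fun o => run T' (fun h => s (o :: h)) (fun h => phi (o :: h)))
  else phi [::].

Lemma eq_run T s s' phi phi' :
  (forall h, (size h < T)%N -> s h = s' h) -> (forall h, size h = T -> phi h = phi' h) ->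
  run T s phi = run T s' phi'.
Proof.
elim: T s s' phi phi' => [|T IH] s s' phi phi' hs hp /=; first exact: hp.
rewrite (hs [::]) //; apply: eq_Ex => o _; apply: IH => h hh; first exact: hs.
by apply: hp => /=; rewrite hh.
Qed.

Lemma run_add t T s phi :
  run (t + T) s phi = run t s (fun h => run T (fun h' => s (h ++ h')) (fun h' => phi (h ++ h'))).
Proof.
elim: t s phi => [|t IH] s phi //=.
by apply: eq_Ex => o _; rewrite IH.
Qed.

Lemma run_cst T s c : run T s (fun=> c) = c.
Proof. by elim: T s => [|T IH] s //=; under eq_Ex do rewrite IH; rewrite Ex_cst. Qed.

Lemma ler_run T s phi phi' : (forall h, size h = T -> phi h <= phi' h) ->
  run T s phi <= run T s phi'.
Proof.
elim: T s phi phi' => [|T IH] s phi phi' h /=; first exact: h.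
apply: ler_Ex => [o|o _]; first exact: pmf_ge0.
by apply: IH => l hl; apply: h; rewrite /= hl.
Qed.

Lemma run_Ex (A : finType) (p : A -> R) T s phi :
  Ex p (fun a => run T s (phi a)) = run T s (fun h => Ex p (fun a => phi a h)).
Proof.
elim: T s phi => [|T IH] s phi //=.
by rewrite Ex_swap; apply: eq_Ex => o _; rewrite IH.
Qed.

Lemma runB T s phi c : run T s (fun h => c - phi h) = c - run T s phi.
Proof.
elim: T s phi => [|T IH] s phi //=.
by under eq_Ex do rewrite IH; rewrite ExB Ex_cst.
Qed.

Fixpoint lik (s : seq O -> In) (os : seq O) : R :=
  if os is o :: os' then W (s [::]) o * lik (fun h => s (o :: h)) os' else 1.

Lemma lik_ge0 s os : 0 <= lik s os.
Proof. by elim: os s => [|o os IH] s //=; rewrite mulr_ge0 // pmf_ge0. Qed.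

(** The recursive form of [run] suits inductions on time; this form makes it an expectation under a
    law, to which entropies apply. *)
Lemma run_lik T s phi : run T s phi = Ex (fun os : T.-tuple O => lik s os) (fun os => phi os).
Proof.
elim: T s phi => [|T IH] s phi /=.
  rewrite /Ex (big_pred1 [tuple]) => [|os]; first by rewrite /= mul1r.
  by rewrite (tuple0 os) /= ; apply/esym/eqP.
pose f (w : O * T.-tuple O) := [tuple of w.1 :: w.2].
rewrite [RHS]/Ex (reindex f) /=; last first.
  exists (fun os : T.+1.-tuple O => (thead os, [tuple of behead os])) => [[o os] _|os _].
    by congr (_, _); apply: val_inj.
  by rewrite /f /= -tuple_eta.
rewrite -(pair_bigA _ (fun o (os : T.-tuple O) => W (s [::]) o * lik (fun h => s (o :: h)) os * phi (o :: os))) /=.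
apply: eq_bigr => o _; rewrite IH mulr_sumr.
by apply: eq_bigr => os _; rewrite mulrA.
Qed.

Lemma pmf_lik T s : pmf (fun os : T.-tuple O => lik s os).
Proof.
split=> [os|]; first exact: lik_ge0.
by rewrite -[RHS](run_cst T s 1) run_lik; apply: eq_bigr => os _; rewrite mulr1.
Qed.

End Run.

Section PrdRec.
Context {R : realType} {A : finType}.

Definition fcons (N : nat) (a : A) (f : {ffun 'I_N -> A}) : {ffun 'I_N.+1 -> A} :=
  [ffun c => if unlift ord0 c is Some c' then f c' else a].

Lemma fcons0 N a (f : {ffun 'I_N -> A}) : fcons a f ord0 = a.
Proof. by rewrite ffunE unlift_none. Qed.

Lemma fconsS N a (f : {ffun 'I_N -> A}) c : fcons a f (lift ord0 c) = f c.
Proof. by rewrite ffunE liftK. Qed.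

Lemma Ex_prd_recl N (p : 'I_N.+1 -> A -> R) F :
  Ex (prd p) F = Ex (p ord0) (fun a => Ex (prd (fun c => p (lift ord0 c))) (fun f => F (fcons a f))).
Proof.
rewrite [LHS]/Ex (reindex (fun w : A * {ffun 'I_N -> A} => fcons w.1 w.2)) /=; last first.
  exists (fun f : {ffun 'I_N.+1 -> A} => (f ord0, [ffun c => f (lift ord0 c)])) => [[a f] _|f _].
    by rewrite fcons0; congr (_, _); apply/ffunP => c; rewrite ffunE fconsS.
  apply/ffunP => c; rewrite ffunE /=; case: unliftP => [c' ->|->] //.
  by rewrite ffunE.
rewrite -(pair_bigA _ (fun a f => prd p (fcons a f) * F (fcons a f))) /=.
apply: eq_bigr => a _; rewrite mulr_sumr; apply: eq_bigr => f _.
rewrite mulrA; congr (_ * _); rewrite /prd big_ord_recl fcons0; congr (_ * _).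
by apply: eq_bigr => c _; rewrite fconsS.
Qed.

Lemma Ex_prd_nil (p : 'I_0 -> A -> R) F (f0 : {ffun 'I_0 -> A}) : Ex (prd p) F = F f0.
Proof.
have h (f : {ffun 'I_0 -> A}) : f = f0 by apply/ffunP => -[].
rewrite /Ex (big_pred1 f0) => [|f]; first by rewrite /prd big_ord0 mul1r.
by rewrite (h f) /= eqxx.
Qed.

Definition flist (N : nat) (f : {ffun 'I_N -> A}) : seq A := [seq f c | c <- enum 'I_N].

Lemma flist_cons N a (f : {ffun 'I_N -> A}) : flist (fcons a f) = a :: flist f.
Proof.
rewrite /flist enum_ordSl /= fcons0 -map_comp; congr (_ :: _).
by apply: eq_map => c /=; rewrite fconsS.
Qed.

Lemma flist_nil (f : {ffun 'I_0 -> A}) : flist f = [::].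
Proof. by rewrite /flist (size0nil (size_enum_ord 0)). Qed.

Lemma size_flist N (f : {ffun 'I_N -> A}) : size (flist f) = N.
Proof. by rewrite size_map size_enum_ord. Qed.

Lemma nth_flist N (f : {ffun 'I_N -> A}) a0 (c : 'I_N) : nth a0 (flist f) c = f c.
Proof. by rewrite (nth_map c) ?size_enum_ord ?ltn_ord // nth_ord_enum. Qed.

End PrdRec.

Section OpenLoop.
Context {R : realType} {In : Type} {O : finType} (W : In -> O -> R) (hW : forall x, pmf (W x)).

Lemma run_open N (x : 'I_N -> In) (s : seq O -> In) phi :
  (forall h (c : 'I_N), size h = c -> s h = x c) ->
  run W N s phi = Ex (prd (fun c => W (x c))) (fun o => phi (flist o)).
Proof.
elim: N x s phi => [|N IH] x s phi hs /=.
  have f0 : {ffun 'I_0 -> O} by apply: finfun => -[].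
  by rewrite (Ex_prd_nil _ _ f0) flist_nil.
rewrite Ex_prd_recl (hs [::] ord0) //; apply: eq_Ex => o _.
rewrite (IH (fun c => x (lift ord0 c))) => [|h c hc]; last by rewrite (hs _ (lift ord0 c)) //= hc.
by apply: eq_Ex => f _; rewrite flist_cons.
Qed.

End OpenLoop.

(** * Nested compress-and-forward *)

Lemma take_drop_flatten (A : Type) (t : nat) (l : seq (seq A)) (r : seq A) c :
  all (fun x => size x == t) l -> (c < size l)%N ->
  take t (drop (c * t) (flatten l ++ r)) = nth [::] l c.
Proof.
elim: l c => //= x l IH [|c] /andP[/eqP sx sl] hc.
  by rewrite mul0n drop0 -catA take_cat sx ltnn subnn take0 cats0.
rewrite mulSn -catA drop_cat sx ltnNge leq_addr /= addKn.
exact: IH.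
Qed.

Lemma size_flatten_const (A : Type) (t : nat) (l : seq (seq A)) :
  all (fun x => size x == t) l -> size (flatten l) = (size l * t)%N.
Proof. by elim: l => //= x l IH /andP[/eqP sx /IH e]; rewrite size_cat sx e mulSn. Qed.

Section Copies.
Context {R : realType} {In : Type} {O : finType} (W : In -> O -> R).
Context (t : nat) {Se : finType} (nu : Se -> R) (strat : Se -> seq O -> In).

Definition runlaw : Se * t.-tuple O -> R := jn nu (fun f (os : t.-tuple O) => lik W (strat f) os).

Definition chunks N (om : {ffun 'I_N -> Se * t.-tuple O}) : seq (seq O) :=
  [seq tval (om c).2 | c <- enum 'I_N].

Lemma chunks_cons N w (om : {ffun 'I_N -> Se * t.-tuple O}) :
  chunks (fcons w om) = tval w.2 :: chunks om.
Proof.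
rewrite /chunks enum_ordSl /= fcons0 -map_comp; congr (_ :: _).
by apply: eq_map => c /=; rewrite fconsS.
Qed.

Lemma chunks_size N (om : {ffun 'I_N -> Se * t.-tuple O}) :
  all (fun x => size x == t) (chunks om).
Proof. by apply/allP => x /mapP[c _ ->]; rewrite size_tuple. Qed.

Lemma size_chunks N (om : {ffun 'I_N -> Se * t.-tuple O}) : size (chunks om) = N.
Proof. by rewrite size_map size_enum_ord. Qed.

Lemma nth_chunks N (om : {ffun 'I_N -> Se * t.-tuple O}) (c : 'I_N) :
  nth [::] (chunks om) c = (om c).2.
Proof. by rewrite (nth_map c) ?size_enum_ord ?ltn_ord // nth_ord_enum. Qed.

(** In the window of copy c the strategy sees only the history since the start of that window, so
    the successive runs are independent. *)
Lemma run_copies N (s : {ffun 'I_N -> Se} -> seq O -> In) Phi :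
  (forall fl (c : 'I_N) h, (c * t <= size h < c.+1 * t)%N -> s fl h = strat (fl c) (drop (c * t) h)) ->
  Ex (prd (fun _ : 'I_N => nu)) (fun fl => run W (N * t) (s fl) (Phi fl)) =
  Ex (prd (fun _ : 'I_N => runlaw)) (fun om => Phi [ffun c => (om c).1] (flatten (chunks om))).
Proof.
elim: N s Phi => [|N IH] s Phi hs.
  have f0 : {ffun 'I_0 -> Se} by apply: finfun => -[].
  have g0 : {ffun 'I_0 -> Se * t.-tuple O} by apply: finfun => -[].
  rewrite (Ex_prd_nil _ _ f0) (Ex_prd_nil _ _ g0) /=.
  rewrite (_ : [ffun c => (g0 c).1] = f0); last by apply/ffunP => -[].
  by rewrite /chunks (size0nil (size_enum_ord 0)).
rewrite !Ex_prd_recl Ex_jn; apply: eq_Ex => f0 _.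
transitivity (Ex (prd (fun _ : 'I_N => nu)) (fun fl => run W t (strat f0) (fun h =>
    run W (N * t) (fun h' => s (fcons f0 fl) (h ++ h')) (fun h' => Phi (fcons f0 fl) (h ++ h'))))).
  apply: eq_Ex => fl _; rewrite mulSn run_add; apply: eq_run => // h hh.
  by rewrite (hs _ ord0) ?fcons0 ?mul0n ?drop0 // mul1n hh.
rewrite run_Ex run_lik; apply: eq_Ex => os _.
rewrite (IH (fun fl h' => s (fcons f0 fl) (os ++ h')) (fun fl h' => Phi (fcons f0 fl) (os ++ h'))).
  apply: eq_Ex => om _; rewrite chunks_cons /=; congr Phi.
  by apply/ffunP => c; rewrite !ffunE; case: unliftP => [c' _|_] //; rewrite ffunE.
move=> fl c h hc; rewrite (hs _ (lift ord0 c)); last first.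
  by rewrite size_cat size_tuple /= /bump /= add1n mulSn leq_add2l [X in (_ < X)%N]mulSn ltn_add2l.
rewrite fconsS /= /bump /= add1n mulSn drop_cat size_tuple ltnNge leq_addr /=.
by rewrite addKn.
Qed.

End Copies.

(** * The recursion from one level to the next *)

Section CFNet.
Context {R : realType} {I U O1 Ob Yh : finType}.
Context (p : I -> U -> R) (hp : forall i, pmf (p i)).
Context (kp : {ffun I -> U} -> O1 -> R) (hkp : forall u, pmf (kp u)).
Context (obs : I -> O1 -> Ob) (yq : I -> U -> Ob -> Yh) (u0 : U) (ob0 : Ob).

Definition A1 : finType := ({ffun I -> U} * O1)%type.

(* letter kernel when the inputs in [S] are prescribed and the others are fresh *)
Definition kc (S : {set I}) (x : {ffun I -> U}) (a : A1) : R :=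
  pr (prd p) (fun u' => merge (mem S) x u') a.1 * kp a.1 a.2.

Lemma Ex_kc S x F : Ex (kc S x) F =
  Ex (prd p) (fun u' => Ex (kp (merge (mem S) x u')) (fun o => F (merge (mem S) x u', o))).
Proof. by rewrite [LHS](Ex_jn (pr (prd p) (merge (mem S) x)) kp) Ex_push. Qed.

Lemma pmf_kc S x : pmf (kc S x).
Proof. by apply: (pmf_jn (k := kp)) => //; apply/pmf_push/pmf_prd. Qed.

(** The field [lfin] computes, from the seed and the observations of a whole run, the data that the
    node must convey at the next level. *)
Record level := Level {
  lt : nat; lSd : finType; lnu : I -> lSd -> R; lsig : I -> lSd -> seq Ob -> U;
  lVV : finType; lfin : I -> lSd -> seq Ob -> lVV }.

Context (NM : {set I}).

Definition lhist (i : I) (h : seq A1) : seq Ob := [seq obs i a.2 | a <- h].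

Definition lstrat (L : level) (f : {ffun I -> lSd L}) (h : seq A1) : {ffun I -> U} :=
  [ffun i => lsig i (f i) (lhist i h)].

Definition llaw (L : level) := runlaw (kc NM) (t := lt L) (prd (@lnu L)) (@lstrat L).

Arguments llaw L _ : clear implicits.

Definition lOm (L : level) : finType := ({ffun I -> lSd L} * (lt L).-tuple A1)%type.

Definition lV (L : level) (i : I) (w : lOm L) : lVV L := lfin i (w.1 i) (lhist i w.2).

Definition level0 : level :=
  @Level 0 unit (fun _ _ => 1) (fun _ _ _ => u0) unit (fun _ _ _ => tt).

Section Next.
Context (L : level) (N n : nat).
Let t := lt L.
Let J := 'I_(N * n).

Definition nxSd : finType := ({ffun 'I_N -> lSd L} * {ffun {ffun 'I_N -> lVV L} -> {ffun J -> U}})%type.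

Definition nxnu (i : I) : nxSd -> R :=
  jn (prd (fun _ => @lnu L i)) (fun _ => prd (fun _ => blockX p (J := J) i)).

Definition nxx (i : I) (f : nxSd) (h : seq Ob) : {ffun J -> U} :=
  f.2 [ffun c : 'I_N => lfin i (f.1 c) (take t (drop (c * t) h))].

Definition nxsig (i : I) (f : nxSd) (h : seq Ob) : U :=
  if (size h < N * t)%N then
    (if insub (size h %/ t)%N is Some c then lsig i (f.1 c) (drop (c * t) h) else u0)
  else oapp (nxx i f h) u0 (insub (size h - N * t)%N).

(** Only the last block is kept, together with its inputs. The data of the N copies has been handed
    on through these inputs and is not conveyed again, so a message has one letter per use of the
    last block. *)
Definition nxfin (i : I) (f : nxSd) (h : seq Ob) : {ffun J -> U * Yh} :=
  [ffun s => (nxx i f h s, yq i (nxx i f h s) (nth ob0 h (N * t + s)))].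

Definition next : level := @Level (N * t + N * n) nxSd nxnu nxsig {ffun J -> U * Yh} nxfin.

Definition nxlaw := rmlaw (blockX p (J := J)) (blockK (kc NM) (J := J)) (@Nlaw R _ (llaw L) N)
  (NV (@lV L) (N := N)).

Definition nxOm : finType :=
  ({ffun 'I_N -> lOm L} * ({ffun I * {ffun 'I_N -> lVV L} -> {ffun J -> U}} * {ffun J -> A1}))%type.

Definition nxseed (w : nxOm) : {ffun I -> nxSd} :=
  [ffun i => ([ffun c => (w.1 c).1 i], [ffun v => w.2.1 (i, v)])].

Definition nxhist (w : nxOm) : seq A1 := flatten (chunks w.1) ++ flist w.2.2.

Lemma nxxE i (f : nxSd) (om : {ffun 'I_N -> lOm L}) hb :
  f.1 = [ffun c => (om c).1 i] ->
  nxx i f (lhist i (flatten (chunks om) ++ hb)) = f.2 (NV (@lV L) i om).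
Proof.
move=> e; congr (f.2 _); apply/ffunP => c; rewrite !ffunE e ffunE /lV; congr (lfin _ _ _).
rewrite /lhist -map_drop -map_take take_drop_flatten ?chunks_size ?size_chunks //.
by rewrite nth_chunks.
Qed.

(** The first N t uses are independent runs of [L]. Given the table and their outcome, the last N n
    uses are open loop, which is the situation of the random-map law. *)
Lemma next_law Phi : Ex (llaw next) (fun w => Phi w.1 (tval w.2)) =
  Ex nxlaw (fun w => Phi (nxseed w) (nxhist w)).
Proof.
rewrite /llaw /runlaw Ex_jn.
transitivity (Ex (prd nxnu) (fun f => run (kc NM) (N * t + N * n) (lstrat (L := next) f) (Phi f))).
  by apply: eq_Ex => f _; rewrite run_lik.
pose G (f : {ffun I -> nxSd}) := run (kc NM) (N * t + N * n) (lstrat (L := next) f) (Phi f).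
pose mk (y : {ffun 'I_N -> {ffun I -> lSd L}}) (g : {ffun I * {ffun 'I_N -> lVV L} -> {ffun J -> U}})
  : {ffun I -> nxSd} := [ffun i => ([ffun c => y c i], [ffun v => g (i, v)])].
transitivity (Ex (prd (@gpmf R _ _ (blockX p (J := J)) {ffun 'I_N -> lVV L})) (fun g =>
    Ex (prd (fun _ : 'I_N => prd (@lnu L))) (fun y => G (mk y g)))).
  have := Ex_prd_zip (fun i => prd (fun _ : 'I_N => @lnu L i))
    (fun i _ => prd (fun _ : {ffun 'I_N -> lVV L} => blockX p (J := J) i))
    (fun x g => G [ffun i => (x i, g i)]).
  rewrite -[X in _ = X -> _](_ : Ex (prd nxnu) G = _); last first.
    by apply: eq_Ex => f _; congr G; apply/ffunP => i; rewrite !ffunE; case: (f i).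
  move=> <-; rewrite Ex_prd_transpose Ex_swap.
  rewrite (Ex_curry (fun i _ => blockX p (J := J) i)).
  apply: eq_Ex => g _; apply: eq_Ex => y _; congr G; apply/ffunP => i; rewrite !ffunE.
  by congr (_, _).
rewrite /nxlaw /rmlaw Ex_jn /=.
under [RHS]eq_Ex do rewrite Ex_jn.
rewrite [RHS]Ex_swap; apply: eq_Ex => g _.
pose Psi y H := run (kc NM) (N * n) (fun hb => lstrat (L := next) (mk y g) (H ++ hb))
  (fun hb => Phi (mk y g) (H ++ hb)).
transitivity (Ex (prd (fun _ : 'I_N => prd (@lnu L))) (fun y =>
   run (kc NM) (N * t) (lstrat (L := next) (mk y g)) (Psi y))).
  by apply: eq_Ex => y _; rewrite /G run_add.
rewrite (@run_copies _ _ _ (kc NM) t _ _ (@lstrat L)); last first.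
  move=> fl c h /andP[h1 h2]; apply/ffunP => i; rewrite !ffunE /= /nxsig size_map.
  have t0 : (0 < t)%N by case: (t) h1 h2 => // ; rewrite !muln0.
  rewrite (leq_trans h2) ?leq_mul2r ?ltn_ord ?orbT //.
  have -> : (size h %/ t)%N = c.
    by apply/eqP; rewrite eqn_leq leq_divRL // h1 andbT -ltnS ltn_divLR.
  by rewrite valK /= ffunE /lhist map_drop.
apply: eq_Ex => om _; rewrite /Psi.
rewrite (@run_open _ _ _ (kc NM) _ (fun s : J => [ffun i => gmap g (fun i => NV (@lV L) i om) i s])).
  apply: eq_Ex => o _; congr (Phi _ _); apply/ffunP => i; rewrite !ffunE.
  apply: (congr2 pair); last by [].
  by apply/ffunP => c; rewrite !ffunE.
move=> h c hc; apply/ffunP => i; rewrite !ffunE /= ?ffunE /nxsig.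
rewrite size_map size_cat (size_flatten_const (chunks_size om)) size_chunks ltnNge leq_addr /=.
rewrite addKn hc valK /= nxxE /= ?ffunE //.
by apply/ffunP => c'; rewrite !ffunE.
Qed.

Lemma lV_next i w : lfin (l := next) i (nxseed w i) (lhist i (nxhist w)) =
  [ffun s => (gmap w.2.1 (fun i => NV (@lV L) i w.1) i s,
              yq i (gmap w.2.1 (fun i => NV (@lV L) i w.1) i s) (obs i (w.2.2 s).2))].
Proof.
apply/ffunP => s; rewrite !ffunE /= nxxE /= ?ffunE //.
rewrite /lhist map_cat nth_cat size_map (size_flatten_const (chunks_size _)) size_chunks.
rewrite ltnNge leq_addr /= addKn (nth_map (w.2.2 s)) ?size_flist ?ltn_ord //.
by rewrite nth_flist.
Qed.

End Next.
End CFNet.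

(** * Conditional output laws given part of the inputs *)

Section KapC.
Context {R : realType} {I X WO : finType}.
Context (pX : I -> X -> R) (hpX : forall i, pmf (pX i)).
Context (kap : {ffun I -> X} -> WO -> R) (hkap : forall x, pmf (kap x)).

Lemma Ex_kapC T x F : Ex (kapC pX kap T x) F =
  Ex (prd pX) (fun x' => Ex (kap (merge (mem T) x x')) F).
Proof.
rewrite /kapC {1}/Ex; under eq_bigr do rewrite -ExZr.
by rewrite -Ex_sum.
Qed.

Lemma pmf_kapC T x : pmf (kapC pX kap T x).
Proof.
have hX := pmf_prd hpX.
split=> [w|]; first exact: kapC_ge0.
transitivity (Ex (kapC pX kap T x) (fun=> 1)).
  by apply: eq_bigr => w _; rewrite mulr1.
by rewrite Ex_kapC -[RHS](Ex_cst 1 hX); apply: eq_Ex => x' _; rewrite Ex_cst.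
Qed.

Lemma merge_eq (C : {set I}) (x x0 x' : {ffun I -> X}) : {in C, x =1 x0} ->
  merge (mem C) x x' = merge (mem C) x0 x'.
Proof. by move=> h; apply/ffunP => i; rewrite !ffunE; case: ifP => // iC; exact: h. Qed.

Lemma kapC_eq (C : {set I}) (x x0 : {ffun I -> X}) w : {in C, x =1 x0} -> kapC pX kap C x w = kapC pX kap C x0 w.
Proof. by move=> h; apply: eq_Ex => x' _; rewrite (merge_eq _ h). Qed.

Definition xres (C : {set I}) (x : {ffun I -> X}) : {ffun I -> option X} :=
  [ffun i => if i \in C then Some (x i) else None].

Lemma xresP C x x' : xres C x = xres C x' <-> {in C, x =1 x'}.
Proof.
split=> [/ffunP h i iC|h]; first by have := h i; rewrite !ffunE iC => -[].
by apply/ffunP => i; rewrite !ffunE; case: ifP => // /h ->.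
Qed.

(** Resampling independent inputs outside [C] is conditioning on those in [C], so [kapC] is a kernel
    in the sense of [cent_kernel]. *)
Lemma kapC_cent C :
  Ex (letterlaw pX kap) (fun y => - ln (kapC pX kap C y.1 y.2)) =
  cent (letterlaw pX kap) (fun y => y.2) (fun y => xres C y.1).
Proof.
have hL := pmf_letterlaw hpX hkap.
rewrite (@cent_kernel _ _ _ hL _ _ _ _ (fun y => kapC pX kap C y.1 y.2)) // => -[x0 w0] _ /=.
have e1 : pr (letterlaw pX kap) (fun y => xres C y.1) (xres C x0) =
    Ex (prd pX) (fun x => (xres C x == xres C x0)%:R).
  by rewrite /pr Ex_jn; apply: eq_Ex => x _; rewrite /= Ex_cst.
have e2 : pr (letterlaw pX kap) (fun y => (y.2, xres C y.1)) (w0, xres C x0) =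
    Ex (prd pX) (fun x => (xres C x == xres C x0)%:R * kap x w0).
  rewrite /pr Ex_jn; apply: eq_Ex => x _; rewrite mulrC {1}/Ex (bigD1 w0) //= big1 ?addr0 => [|w nw].
    by rewrite -pair_eqE /= /pair_eq /= eqxx.
  by rewrite -pair_eqE /= /pair_eq /= (negbTE nw) mulr0.
rewrite e1 e2 -(Ex_merge (mem C) _ hpX) -ExZr; apply: eq_Ex => x _.
rewrite -ExZ; apply: eq_Ex => x' _.
have -> : xres C (merge (mem C) x x') = xres C x.
  by apply/xresP => i iC; rewrite ffunE /= iC.
by case: eqP => [/xresP h|_]; rewrite ?mul0r // !mul1r (merge_eq _ h).
Qed.

End KapC.

(** * Entropy bounds for one level of the recursion *)

Section NextBounds.
Context {R : realType} {I U O1 Ob Yh ZT : finType}.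
Local Notation A1' := (@A1 I U O1).
Local Notation lOm' L := (@lOm R I U O1 Ob L).
Local Notation nxOm' L N n := (@nxOm R I U O1 Ob L N n).
Local Notation level := (@level R I U Ob).
Context (p : I -> U -> R) (hp : forall i, pmf (p i)).
Context (kp : {ffun I -> U} -> O1 -> R) (hkp : forall u, pmf (kp u)).
Context (obs : I -> O1 -> Ob) (yq : I -> U -> Ob -> Yh) (u0 : U) (ob0 : Ob).
Context (NM : {set I}).

Definition Alaw : A1' -> R := jn (prd p) kp.
Lemma pmf_Alaw : pmf Alaw. Proof. by apply: pmf_jn => //; exact: pmf_prd. Qed.

Definition av (i : I) (a : A1') : U * Yh := (a.1 i, yq i (a.1 i) (obs i a.2)).

Context (z : A1' -> ZT) (T : {set I}) (TN : T \subset NM).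

Definition Wf (C : {set I}) (a : A1') : {ffun I -> option (U * Yh)} * ZT := (vres C av a, z a).

Local Notation kcN := (kc p kp NM).
Local Notation llaw L := (@llaw R I U O1 Ob p kp obs NM L).

(** A decoder that relies on the relays in [T] is given the tables of these relays only; the other
    relays act as noise. *)
Definition lseed (L : level) (w : lOm' L) := vres T (fun i (w : lOm' L) => w.1 i) w.
Definition lvz (L : level) (C : {set I}) (w : lOm' L) := (vres C (@lV R I U O1 Ob obs L) w, [seq z a | a <- w.2]).

Lemma pmf_llaw (L : level) : (forall i, pmf (@lnu R I U Ob L i)) -> pmf (llaw L).
Proof.
move=> h; apply: pmf_jn; first exact: pmf_prd.
by move=> f; apply: pmf_lik => x; exact: pmf_kc.
Qed.

Context (L : level) (hL : forall i, pmf (@lnu R I U Ob L i)).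

Section N.
Context (N n : nat).
Let J := 'I_(N * n).
Let L' : level := next p yq u0 ob0 L N n.
Let XL := @nxlaw R I U O1 Ob p kp obs NM L N n.
Let G := {ffun I * {ffun 'I_N -> lVV L} -> {ffun J -> U}}.
Let NVL := NV (@lV R I U O1 Ob obs L) (N := N).

Lemma pmf_nxlaw : pmf XL.
Proof.
apply: pmf_rmlaw; [exact: pmf_blockX| |exact/pmf_Nlaw/pmf_llaw].
by apply: pmf_blockK => x; exact: pmf_kc.
Qed.

Lemma pmf_nxnu i : pmf (@lnu R I U Ob L' i).
Proof.
apply: pmf_jn => [|_]; first exact: pmf_prd.
by apply: pmf_prd => _; exact: pmf_blockX.
Qed.

Definition gres (g : G) : {ffun I -> option {ffun {ffun 'I_N -> lVV L} -> {ffun J -> U}}} :=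
  vres T (fun i (g : G) => [ffun v => g (i, v)]) g.

Lemma kc_supp S x (a : A1') : 0 < kc p kp S x a -> {in S, a.1 =1 x}.
Proof.
move=> h i iS; have h1 : 0 < pr (prd p) (fun u' => merge (mem S) x u') a.1.
  rewrite lt0r pr_ge0 ?andbT; last exact: pmf_prd.
  by apply/eqP => e; move: h; rewrite /kc e mul0r ltxx.
have [u [_ <-]] := pr_gt0_ex (pmf_prd hp) h1.
by rewrite ffunE /= iS.
Qed.

Lemma nx_supp (w : nxOm' L N n) : 0 < XL w ->
  forall (s : J) i, i \in NM -> (w.2.2 s).1 i = gmap w.2.1 (fun i => NVL i w.1) i s.
Proof.
case: w => om [g a] /(rmlaw_gt0 (pmf_blockX hp J) (pmf_Nlaw (pmf_llaw hL) N)) [_ _ _ h4] s i iN.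
have := prd_gt0 s (fun s => pmf_kc hp hkp NM _) h4.
by move=> /kc_supp /(_ i iN) /=; rewrite ffunE.
Qed.

Definition cA C (w : nxOm' L N n) := ([ffun s => Wf C (w.2.2 s)], NF (fun w : lOm' L => [seq z a | a <- w.2]) w.1).
Definition cB (w : nxOm' L N n) := (gres w.2.1, NF (@lseed L) w.1).

(** Almost surely the inputs recorded in the last block are the table entries, for relays in [NM].
    Hence the final values in [C] with the outputs on one side, and the block letters with the
    outputs of the N copies on the other, determine each other. *)
Lemma next_cent (C : {set I}) : C \subset T ->
  cent (llaw L') (lvz C) (@lseed L') = cent XL (cA C) cB.
Proof.
move=> CT.
pose fA (f : {ffun I -> lSd L'}) (h : seq (A1')) :=
  (vres C (fun i (_ : unit) => lfin i (f i) (lhist obs i h)) tt, [seq z a | a <- h]).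
pose fB (f : {ffun I -> lSd L'}) := vres T (fun i (_ : unit) => f i) tt.
transitivity (cent XL (fun w => fA (nxseed w) (nxhist w)) (fun w => fB (nxseed w))).
  apply: samelaw_cent => phi.
  have e := @next_law R I U O1 Ob Yh p kp obs yq u0 ob0 NM L N n (fun f h => phi (fA f h, fB f)).
  refine (etrans _ e); apply: eq_Ex => w _; congr phi.
have hX := pmf_nxlaw.
have zE (w : nxOm' L N n) : [seq z a | a <- nxhist w] =
    flatten [seq [seq z a | a <- x] | x <- chunks w.1] ++ [seq z a | a <- flist w.2.2].
  by rewrite /nxhist map_cat map_flatten.
have zsz (w w' : nxOm' L N n) : size (flatten [seq [seq z a | a <- x] | x <- chunks w.1]) =
    size (flatten [seq [seq z a | a <- x] | x <- chunks w'.1]).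
  by rewrite -!map_flatten !size_map !(size_flatten_const (chunks_size _)) !size_chunks.
have zchunk (w : nxOm' L N n) c : [seq z a | a <- (w.1 c).2] =
    take (lt L) (drop (c * lt L) [seq z a | a <- nxhist w]).
  rewrite -map_drop -map_take /nxhist take_drop_flatten ?chunks_size ?size_chunks //.
  by rewrite nth_chunks.
have zblk (w w' : nxOm' L N n) s : [seq z a | a <- flist w.2.2] = [seq z a | a <- flist w'.2.2] ->
    z (w.2.2 s) = z (w'.2.2 s).
  by rewrite /flist -map_comp -[in RHS]map_comp => /eq_in_map /(_ s (mem_enum _ s)).
have eV i (w : nxOm' L N n) : nxfin yq ob0 i (nxseed w i) (lhist obs i (nxhist w)) =
    [ffun s => (gmap w.2.1 (fun i => NVL i w.1) i s,
              yq i (gmap w.2.1 (fun i => NVL i w.1) i s) (obs i (w.2.2 s).2))].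
  exact: (@lV_next R I U O1 Ob Yh p obs yq u0 ob0 L N n).
have sp (w : nxOm' L N n) (s : J) i : 0 < XL w -> i \in C -> (w.2.2 s).1 i = w.2.1 (i, NVL i w.1) s.
  by move=> pw iC; rewrite (nx_supp pw) ?(subsetP TN _ (subsetP CT _ iC)) // ffunE.
apply: cent_eq => // w w' pw pw'.
- rewrite /fB /cB /gres /lseed => /vresP h; congr (_, _).
    apply/vresP => i iT; have := h i iT; rewrite !ffunE => -[_ /ffunP e].
    by apply/ffunP => v; have := e v; rewrite !ffunE.
  apply/ffunP => c; rewrite !ffunE; apply/vresP => i iT; have := h i iT; rewrite !ffunE.
  by move=> [/ffunP /(_ c)]; rewrite !ffunE.
- rewrite /fB /cB /gres /lseed => -[/vresP h1 /ffunP h2]; apply/vresP => i iT; rewrite !ffunE; congr (_, _).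
    apply/ffunP => c; rewrite !ffunE; have := h2 c; rewrite !ffunE => /vresP; exact.
  by have := h1 i iT.
- rewrite /fA /cA /Wf => -[/vresP h1 h2 _]; congr (_, _).
    apply/ffunP => s; rewrite !ffunE; congr (_, _).
      apply/vresP => i iC; have := h1 i iC; rewrite /= !eV => /ffunP /(_ s).
      by rewrite !ffunE /av !sp.
    apply: zblk; move: h2; rewrite !zE => /eqP; rewrite eqseq_cat ?zsz // => /andP[_ /eqP].
    by [].
  apply/ffunP => c; rewrite !ffunE.
  by move: h2; rewrite !zchunk => ->.
rewrite /fA /cA /Wf => -[/ffunP h1 /ffunP h2 _ _]; congr (_, _).
  apply/vresP => i iC; rewrite /= !eV; apply/ffunP => s; have := h1 s.
  rewrite !ffunE => -[/vresP /(_ i iC)].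
  by rewrite /av !sp.
rewrite !zE; congr (_ ++ _).
  rewrite /chunks -map_comp -[in RHS]map_comp; congr flatten; apply: eq_map => c /=.
  by have := h2 c; rewrite !ffunE.
rewrite /flist -map_comp -[in RHS]map_comp; apply: eq_map => s /=.
by have := h1 s; rewrite !ffunE => -[].
Qed.

Definition pushK (C : {set I}) (x : {ffun I -> U}) := pr (kapC p kcN T x) (Wf C).

Lemma pmf_pushK C x : pmf (pushK C x).
Proof. by apply/pmf_push/pmf_kapC => // y; exact: pmf_kc. Qed.

(* Relays outside [T] have fresh independent inputs once their random maps are averaged out. *)
Lemma Ex_marg C (v : I -> {ffun 'I_N -> lVV L}) phi :
  Ex (prd (@gpmf R _ _ (blockX p (J := J)) {ffun 'I_N -> lVV L})) (fun g =>
    Ex (blockK kcN (J := J) (gmap g v)) (fun a => phi (gres g) [ffun s => Wf C (a s)])) =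
  Ex (prd (@gpmf R _ _ (blockX p (J := J)) {ffun 'I_N -> lVV L})) (fun g =>
    Ex (blockK (pushK C) (J := J) (gmap g v)) (phi (gres g))).
Proof.
have hX := pmf_blockX hp J.
rewrite -(Ex_merge (fun k => k.1 \in T) _ (@hgpmf R I _ _ hX _)); apply: eq_Ex => g _.
rewrite /blockK /pushK Ex_prd_push.
transitivity (Ex (kapC (blockX p (J := J)) (blockK kcN (J := J)) T (gmap g v))
   (fun f => phi (gres g) [ffun s => Wf C (f s)])); last first.
  by apply: eq_bigr => f _; rewrite kapC_block.
rewrite Ex_kapC -(Ex_gmap hX v); apply: eq_Ex => g' _.
have -> : gres (merge (fun k => k.1 \in T) g g') = gres g.
  by apply/vresP => i iT; apply/ffunP => w; rewrite !ffunE /= iT.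
have -> // : gmap (merge (fun k => k.1 \in T) g g') v = merge (mem T) (gmap g v) (gmap g' v).
by apply/ffunP => i; rewrite !ffunE /=; case: ifP.
Qed.

Lemma next_marg C : cent XL (cA C) cB =
  cent (rmlaw (blockX p (J := J)) (blockK (pushK C) (J := J)) (@Nlaw R _ (llaw L) N) NVL)
    (fun s => (s.2.2, NF (fun w : lOm' L => [seq z a | a <- w.2]) s.1))
    (fun s => (gres s.2.1, NF (@lseed L) s.1)).
Proof.
apply: samelaw_cent => phi; rewrite /XL /nxlaw /rmlaw !Ex_jn; apply: eq_Ex => om _; rewrite !Ex_jn.
exact: (Ex_marg C (fun i => NVL i om)
  (fun r w => phi (w, NF (fun w : lOm' L => [seq z a | a <- w.2]) om, (r, NF (@lseed L) om)))).
Qed.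

Definition aU (i : I) (a : A1') : U := a.1 i.

Lemma Ex_kc_avg (F : A1' -> R) : Ex (prd p) (fun x => Ex (kcN x) F) = Ex Alaw F.
Proof.
rewrite /Alaw Ex_jn -[RHS](Ex_merge (mem NM) _ hp); apply: eq_Ex => x _.
by rewrite Ex_kc.
Qed.

Lemma blockX_avg (F : {ffun J -> A1'} -> R) :
  Ex (prd (blockX p (J := J))) (fun x => Ex (blockK kcN (J := J) x) F) = Ex (prd (fun _ : J => Alaw)) F.
Proof.
rewrite (Ex_block p kcN (fun _ => F)) -(Ex_prd_push (fun _ : J => letterlaw p kcN) (fun _ => snd)).
apply: eq_bigr => f _; congr (_ * _); apply: eq_bigr => s _.
rewrite /pr Ex_jn /= Ex_kc_avg /Ex (bigD1 (f s)) //= eqxx mulr1 big1 ?addr0 // => a /negbTE na.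
by rewrite na mulr0.
Qed.

(** Only the chain rule is used: the data of the N copies is counted first, then the last block
    given its inputs, which the seeds and that data determine. *)
Lemma next_upper (e : R) :
  cent (llaw L) (lvz T) (@lseed L) <= e ->
  cent (llaw L') (lvz T) (@lseed L') <= N%:R * e + (N * n)%:R * cent Alaw (Wf T) (vres T aU).
Proof.
move=> he; rewrite next_cent //; have hX := pmf_nxlaw; have hP := pmf_llaw hL.
pose VZ (w : nxOm' L N n) := NF (lvz T) w.1.
pose Wb (w : nxOm' L N n) := [ffun s => Wf T (w.2.2 s)].
pose Xb (w : nxOm' L N n) := [ffun s => vres T aU (w.2.2 s)].
have h1 : cent XL (cA T) cB <= cent XL (fun w => (VZ w, Wb w)) cB.
  apply: cent_arg => // w w' _ _ [/ffunP h /ffunP h' _ _]; rewrite /cA; congr (_, _).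
    by apply/ffunP; exact: h'.
  by apply/ffunP => c; have := h c; rewrite !ffunE => -[].
apply: (le_trans h1); rewrite cent_chain //; apply: lerD.
  apply: (@le_trans _ _ (cent XL VZ (fun w => NF (@lseed L) w.1))).
    by apply: cent_cond => // w w' _ _ [].
  apply: (@le_trans _ _ (cent (@Nlaw R _ (llaw L) N) (NF (lvz T)) (NF (@lseed L)))).
    rewrite le_eqVlt; apply/orP; left; apply/eqP; apply: samelaw_cent => phi.
    rewrite /XL /nxlaw /rmlaw Ex_jn; apply: eq_Ex => om _ /=.
    refine (Ex_cst (phi (NF (lvz T) om, NF (@lseed L) om)) _).
    apply: pmf_jn => [|g]; first exact/pmf_prd/hgpmf/pmf_blockX.
    by apply: pmf_blockK => x; exact: pmf_kc.
  by rewrite /NF cent_prd // card_ord ler_wpM2l // ler0n.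
apply: (@le_trans _ _ (cent XL Wb Xb)).
  apply: cent_cond => // w w' pw pw' [/ffunP h [/vresP h' _]].
  apply/ffunP => s; rewrite !ffunE; apply/vresP => i iT; rewrite /aU.
  rewrite !(nx_supp _ s (subsetP TN _ iT)) // !ffunE.
  have -> : NVL i w.1 = NVL i w'.1.
    apply/ffunP => c; have := h c; rewrite !ffunE => -[/vresP h2 _]; exact: h2.
  by have /ffunP /(_ (NVL i w'.1)) := h' i iT; rewrite !ffunE => ->.
rewrite le_eqVlt; apply/orP; left; apply/eqP.
rewrite -[X in X%:R](card_ord (N * n)) -cent_prd; last exact: pmf_Alaw.
apply: samelaw_cent => phi; rewrite -blockX_avg /XL /nxlaw /rmlaw Ex_jn.
rewrite -[RHS](Ex_cst _ (pmf_Nlaw hP N)); apply: eq_Ex => om _; rewrite Ex_jn.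
by rewrite -(Ex_gmap (pmf_blockX hp J) (fun i => NVL i om)).
Qed.

End N.

Lemma letter_cent (C C0 : {set I}) : C0 \subset T ->
  Ex (letterlaw p (pushK C)) (fun y => - ln (kapC p (pushK C) C0 y.1 y.2)) =
  cent Alaw (Wf C) (vres C0 aU).
Proof.
move=> C0T; rewrite kapC_cent //; last by move=> x; exact: pmf_pushK.
apply: samelaw_cent => phi; rewrite Ex_jn.
transitivity (Ex (prd p) (fun x => Ex (kapC p kcN T x) (fun a => phi (Wf C a, xres C0 x)))).
  by apply: eq_Ex => x _; rewrite /pushK Ex_push.
transitivity (Ex (prd p) (fun x => Ex (kcN x) (fun a => phi (Wf C a, xres C0 x)))).
  rewrite -[RHS](Ex_merge (mem T) _ hp); apply: eq_Ex => x _; rewrite Ex_kapC.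
  apply: eq_Ex => x' _; apply: eq_Ex => a _; congr (phi (_, _)).
  by apply/xresP => i iC; rewrite ffunE /= (subsetP C0T).
rewrite -Ex_kc_avg; apply: eq_Ex => x _; apply: eq_Ex => a ha; congr (phi (_, _)).
have ha' : 0 < kcN x a by rewrite lt0r ha pmf_ge0 //; exact: pmf_kc.
apply/ffunP => i; rewrite !ffunE; case: ifP => // iC; congr Some; rewrite /aU.
by rewrite (kc_supp ha') // (subsetP TN) // (subsetP C0T).
Qed.

(** [random_map_iid] is applied to the output kernel [pushK C]: inputs outside [T] are averaged out,
    and the new data of the relays in [C] is counted as part of the output. *)
Lemma next_lower (n : nat) (C : {set I}) (m d : R) : C \subset T -> 0 < d ->
  (forall C0 : {set I}, C0 \subset T ->
    m <= cent (llaw L) (lvz C0) (@lseed L) + n%:R * cent Alaw (Wf C) (vres C0 aU)) ->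
  exists N0 : nat, forall N : nat, (N0 <= N)%N ->
  N%:R * (m - d) <= cent (llaw (next p yq u0 ob0 L N n)) (lvz C) (@lseed (next p yq u0 ob0 L N n)).
Proof.
move=> CT d0 hm.
have [||N0 h] := @random_map_iid R I U _ p hp (pushK C) (pmf_pushK C) _ _ _ _ (llaw L) (pmf_llaw hL)
  (@lV R I U O1 Ob obs L) (fun w : lOm' L => [seq z a | a <- w.2]) (@lseed L) T n m d d0.
- by move=> x x' w hx; apply: eq_bigr => a _; rewrite (kapC_eq _ _ a hx).
- by move=> C0 C0T; apply: (le_trans (hm C0 C0T)); rewrite lerD2l ler_wpM2l ?ler0n // letter_cent.
exists N0 => N hN; rewrite next_cent // next_marg.
apply: (le_trans (h N hN 'I_(N * n) (card_ord _))).
apply: cent_cond; last by move=> w w' _ _ [-> ->].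
apply: pmf_rmlaw; [exact: pmf_blockX| |exact/pmf_Nlaw/pmf_llaw].
by apply: pmf_blockK => x; exact: pmf_pushK.
Qed.

End NextBounds.

Lemma eventually_fin (F : finType) (Q : F -> nat -> Prop) :
  (forall x, exists N0 : nat, forall N : nat, (N0 <= N)%N -> Q x N) ->
  exists N0 : nat, forall N : nat, (N0 <= N)%N -> forall x, Q x N.
Proof.
move=> h.
have [N0 hN] : exists N0 : nat, forall N : nat, (N0 <= N)%N -> forall x, x \in enum F -> Q x N.
  elim: (enum F) => [|a s [N1 h1]]; first by exists 0%N.
  have [N2 h2] := h a; exists (maxn N1 N2) => N; rewrite geq_max => /andP[l1 l2] x.
  by rewrite in_cons => /orP[/eqP ->|xs]; [exact: h2|exact: h1].
by exists N0 => N lN x; apply: hN => //; rewrite mem_enum.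
Qed.

(** * Iterating the levels *)

Section Levels.
Context {R : realType} {I U O1 Ob Yh ZT K : finType}.
Context (p : I -> U -> R) (hp : forall i, pmf (p i)).
Context (kp : {ffun I -> U} -> O1 -> R) (hkp : forall u, pmf (kp u)).
Context (obs : I -> O1 -> Ob) (yq : I -> U -> Ob -> Yh) (u0 : U) (ob0 : Ob).
Context (NM : {set I}) (T : K -> {set I}) (TN : forall k, T k \subset NM).
Context (zlo zup : K -> @A1 I U O1 -> ZT) (m phi : K -> R).

Local Notation Al := (Alaw p kp).
Local Notation h C := (ent Al (vres C (@aU I U O1))).
Context (Hlo : forall k (C : {set I}), C \subset T k -> m k + h C <= ent Al (Wf obs yq (zlo k) C)).
Context (Hup : forall k, cent Al (Wf obs yq (zup k) (T k)) (vres (T k) (@aU I U O1)) <= phi k).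

Local Notation level := (@level R I U Ob).
Local Notation llaw L := (@llaw R I U O1 Ob p kp obs NM L).

(** The correction h(C) - h(T k) makes the bound reproduce itself. If C0 is the agreeing set of the
    new table, the old bound brings h(C0) - h(T k) and the new letters bring m + h(C) - h(C0), so C0
    cancels. In the upper bound the levels simply add up. *)
Lemma levels (d : R) (b : nat) : 0 < d ->
  exists (L : level) (n : nat), [/\ (0 < n)%N, lt L = (b * n)%N, forall i, pmf (@lnu R I U Ob L i) &
  forall k, (forall C : {set I}, C \subset T k ->
     n%:R * (b%:R * (m k - d) + h C - h (T k)) <= cent (llaw L) (lvz obs (zlo k) C) (@lseed R I U O1 Ob (T k) _)) /\
     cent (llaw L) (lvz obs (zup k) (T k)) (@lseed R I U O1 Ob (T k) _) <= (n * b)%:R * phi k].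
Proof.
move=> d0; have hA := pmf_Alaw hp hkp.
elim: b => [|b [L [n [n0 tL hL IH]]]].
  (* For the empty run the lower bound reads h(C) - h(T k) <= 0, which is monotonicity of entropy.
     The factor n is 1 because it has to be positive. *)
  exists (level0 u0), 1%N; split=> //.
    move=> i; split=> [a|]; first exact: ler01.
    by rewrite (big_pred1 tt) // => -[].
  have hl : pmf (llaw (level0 u0)).
    apply: pmf_llaw => // i; split=> [a|]; first exact: ler01.
    by rewrite (big_pred1 tt) // => -[].
  have tup (w w' : @lOm R I U O1 Ob (level0 u0)) : w = w'.
    case: w w' => [f o] [f' o']; congr (_, _); last by rewrite (tuple0 o) (tuple0 o').
    by apply/ffunP => i; case: (f i) (f' i) => -[].
  move=> k; split=> [C CT|]; last first.
    by rewrite muln0 mul0r cent_det // => w w' _ _ _; rewrite (tup w w').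
  rewrite mul0r add0r mul1r; apply: le_trans (cent_ge0 hl _ _).
  rewrite subr_le0; apply: ent_det => // a a' _ _ /vresP e.
  by apply/vresP => i iC; apply: e; exact: (subsetP CT).
pose Q (x : K * {set I}) (N : nat) := x.2 \subset T x.1 ->
  N%:R * (n%:R * (b%:R * (m x.1 - d) - h (T x.1)) + n%:R * (m x.1 + h x.2) - n%:R * d) <=
  cent (llaw (next p yq u0 ob0 L N n)) (lvz obs (zlo x.1) x.2) (@lseed R I U O1 Ob (T x.1) _).
have [|N0 hN] := eventually_fin (Q := Q).
  move=> [k C]; rewrite /Q /=; case: (boolP (C \subset T k)) => [CT|_]; last by exists 0%N.
  have nd : 0 < n%:R * d by rewrite mulr_gt0 // ltr0n.
  have [|N0 hN] := @next_lower R I U O1 Ob Yh ZT p hp kp hkp obs yq u0 ob0 NM (zlo k) (T k) (TN k)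
    L hL n C (n%:R * (b%:R * (m k - d) - h (T k)) + n%:R * (m k + h C)) (n%:R * d) CT nd.
    move=> C0 C0T; have [h1 _] := IH k; have := h1 C0 C0T.
    have : n%:R * (m k + h C - h C0) <= n%:R * cent Al (Wf obs yq (zlo k) C) (vres C0 (@aU I U O1)).
      rewrite ler_wpM2l ?ler0n // /cent lerD2r; apply: (le_trans (Hlo CT)).
      by apply: ent_det => // a a' _ _ e; exact: (congr1 fst e).
    lra.
  by exists N0 => N lN _; exact: hN.
pose N := maxn N0 1.
have N1 : (0 < N)%N by rewrite leq_maxr.
exists (next p yq u0 ob0 L N n), (N * n)%N; split.
- by rewrite muln_gt0 N1.
- by rewrite /= tL; nia.
- by move=> i; apply: pmf_nxnu.
move=> k; split=> [C CT|].
  have := hN N (leq_maxl _ _) (k, C) CT; rewrite /=; apply: le_trans.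
  rewrite natrM -[X in X <= _]mulrA ler_wpM2l ?ler0n // -natr1; lra.
have [_ h2] := IH k.
apply: (le_trans (next_upper hp hkp yq u0 ob0 (TN k) hL N n h2)).
have := Hup k; rewrite -(ler_pM2l (x := (N * n)%:R)) ?ltr0n ?muln_gt0 ?N1 // => h3.
apply: (le_trans (lerD (lexx _) h3)); rewrite !natrM -natr1 le_eqVlt; apply/orP; left; apply/eqP; ring.
Qed.

Lemma levels_gap (e : R) : 0 < e ->
  exists (L : level), [/\ (0 < lt L)%N, forall i, pmf (@lnu R I U Ob L i) &
  forall k, (lt L)%:R * (m k - phi k - e) <=
    cent (llaw L) (fun w => [seq zlo k a | a <- w.2]) (@lseed R I U O1 Ob (T k) _) -
    cent (llaw L) (fun w => [seq zup k a | a <- w.2]) (@lseed R I U O1 Ob (T k) _)].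
Proof.
move=> e0; have hA := pmf_Alaw hp hkp.
have e2 : 0 < e / 2 by rewrite divr_gt0.
(* The single boundary term h(T k) is spread over b levels. Half of [e] pays for it, the other half
   is the loss [d] allowed in each level. *)
pose b := (Num.bound (\sum_k h (T k) / (e / 2))).+1.
have hb k : h (T k) <= b%:R * (e / 2).
  rewrite -ler_pdivrMr //; apply: (@le_trans _ _ (\sum_k h (T k) / (e / 2))).
    rewrite (bigD1 k) //= lerDl sumr_ge0 // => k' _.
    by rewrite divr_ge0 ?(ltW e2) // ent_ge0.
  rewrite /b; apply: ltW; apply: (lt_le_trans (archi_boundP _)); last by rewrite ler_nat.
  by apply: sumr_ge0 => k' _; rewrite divr_ge0 ?(ltW e2) // ent_ge0.
have [L [n [n0 tL hL H]]] := levels b e2.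
exists L; split=> // [|k]; first by rewrite tL muln_gt0.
have hl := pmf_llaw hp hkp obs NM hL.
have [h1 h2] := H k; have := h1 set0 (sub0set _).
have E0 : cent (llaw L) (lvz obs (zlo k) set0) (@lseed R I U O1 Ob (T k) _) <=
          cent (llaw L) (fun w => [seq zlo k a | a <- w.2]) (@lseed R I U O1 Ob (T k) _).
  apply: cent_arg => // w w' _ _ [ez _]; rewrite /lvz ez; congr (_, _).
  by apply/vresP => i; rewrite inE.
have E1 : cent (llaw L) (fun w => [seq zup k a | a <- w.2]) (@lseed R I U O1 Ob (T k) _) <=
          cent (llaw L) (lvz obs (zup k) (T k)) (@lseed R I U O1 Ob (T k) _).
  by apply: cent_arg => // w w' _ _ [_ ->].
have h0 : 0 <= h set0 by exact: ent_ge0.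
have n0' : 0 < n%:R :> R by rewrite ltr0n.
have := hb k; rewrite -(ler_pM2l n0') => h3.
have h4 : 0 <= n%:R * h set0 by rewrite mulr_ge0 // ltW.
have tR : (lt L)%:R = b%:R * n%:R :> R by rewrite tL natrM.
rewrite tR; move: h2; rewrite !natrM; lra.
Qed.

End Levels.

(** * Sliding-window decode-and-forward *)

Section Couple.
Context {R : realType} {In In' : Type} {O : finType}.
Context (W : In -> O -> R) (W' : In' -> O -> R).
Context (hW : forall x, pmf (W x)) (hW' : forall x, pmf (W' x)).

Lemma lik_eq (s : seq O -> In) (s' : seq O -> In') os :
  (forall b, (b < size os)%N -> W (s (take b os)) =1 W' (s' (take b os))) ->
  lik W s os = lik W' s' os.
Proof.
elim: os s s' => //= o os IH s s' h; congr (_ * _); first exact: (h 0%N).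
by apply: IH => b hb; exact: (h b.+1).
Qed.

(** Outcome sequences in [G] have the same likelihood in both runs, so [G], and therefore its
    complement, has the same probability in both. *)
Lemma run_couple T (s : seq O -> In) (s' : seq O -> In') (G : seq O -> bool) (phi : seq O -> R) :
  (forall h, size h = T -> G h ->
     forall b, (b < T)%N -> W (s (take b h)) =1 W' (s' (take b h))) ->
  (forall h, size h = T -> phi h <= (~~ G h)%:R) ->
  run W T s phi <= run W' T s' (fun h => (~~ G h)%:R).
Proof.
move=> h1 h2; apply: (le_trans (ler_run hW s h2)).
have e (X : Type) (V : X -> O -> R) (hV : forall x, pmf (V x)) (r : seq O -> X) :
    run V T r (fun h => (~~ G h)%:R) = 1 - run V T r (fun h => (G h)%:R).
  rewrite -runB //; apply: eq_run => // h _.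
  by case: (G h); rewrite ?subrr ?subr0.
rewrite !e // lerD2l lerN2 !run_lik le_eqVlt; apply/orP; left; apply/eqP.
apply: eq_bigr => os _; case: (boolP (G os)) => [g|_]; last by rewrite !mulr0.
congr (_ * _); apply/esym/lik_eq => b hb.
by apply: h1; rewrite ?size_tuple //; rewrite size_tuple in hb.
Qed.

End Couple.

Section PublicCoinCode.
Context {R : realType} {I XX O Ob : finType}.

(* [T] uses of the network, public randomness, maximal error at most [eps] *)
Definition pccode (W : {ffun I -> XX} -> O -> R) (obs : I -> O -> Ob) (src dst : I)
    (Msg : finType) (T : nat) (eps : R) : Prop :=
  exists (Sd : finType) (nu : Sd -> R) (st : Sd -> I -> Msg -> seq Ob -> XX) (dec : Sd -> seq Ob -> Msg),
  [/\ pmf nu,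
      forall f i m m' h, i != src -> st f i m h = st f i m' h
    & forall m, Ex nu (fun f => run W T (fun h => [ffun i => st f i m (map (obs i) h)])
                          (fun h => (dec f (map (obs dst) h) != m)%:R)) <= eps].

End PublicCoinCode.

(** * Codebooks, tests and error events of sliding-window decoding *)

Section DecodeForward.
Context {R : realType} {I UL O Ob : finType} (K : nat) (pi : 'I_K.+1 -> I) (pinj : injective pi).
Context (pL : 'I_K -> UL -> R) (hpL : forall j, pmf (pL j)).
Context (Wu : {ffun 'I_K -> UL} -> O -> R) (hWu : forall u, pmf (Wu u)).
Context (W : {ffun I -> {ffun 'I_K -> UL}} -> O -> R) (hW : forall a, pmf (W a)).
Context (obs : I -> O -> Ob).
Context (hcoh : forall (a : {ffun I -> {ffun 'I_K -> UL}}) (u : {ffun 'I_K -> UL}),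
  (forall j j' : 'I_K, (j <= j')%N -> a (pi (widen_ord (leqnSn K) j)) j' = u j') -> W a =1 Wu u).

Definition dfl : {ffun 'I_K -> UL} * O -> R := letterlaw pL Wu.

Definition kY (k : 'I_K.+1) (u : {ffun 'I_K -> UL}) : Ob -> R := pr (Wu u) (obs (pi k)).
Lemma pmf_kY k u : pmf (kY k u). Proof. exact: pmf_push. Qed.

Definition ge (j : nat) : {set 'I_K} := [set j' : 'I_K | (j <= j')%N].

(** A likelihood ratio whose logarithm is the information density between layer j and the
    observation of node k, given the later layers. *)
Definition rt (k : 'I_K.+1) (j : 'I_K) (u : {ffun 'I_K -> UL}) (y : Ob) : R :=
  kapC pL (kY k) (ge j) u y / kapC pL (kY k) (ge j.+1) u y.

Lemma rt_ge0 k j u y : 0 <= rt k j u y.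
Proof. by rewrite divr_ge0 // kapC_ge0 // => x; exact: pmf_kY. Qed.

Lemma rt_eq k (j : 'I_K) (u u' : {ffun 'I_K -> UL}) y : (forall j' : 'I_K, (j <= j')%N -> u j' = u' j') ->
  rt k j u y = rt k j u' y.
Proof.
move=> h; congr (_ / _); apply: kapC_eq => j'; rewrite inE => hj; apply: h => //.
exact: ltnW.
Qed.

Definition upd (u : {ffun 'I_K -> UL}) (j : 'I_K) (v : UL) : {ffun 'I_K -> UL} :=
  [ffun j' => if j' == j then v else u j'].

(** Averaging the numerator over a fresh letter in layer j removes that layer from the conditioning
    and yields the denominator. Equality fails only when the denominator vanishes. *)
Lemma Ex_rt k j u y : Ex (pL j) (fun v => rt k j (upd u j v) y) <= 1.
Proof.
have hk : forall u, pmf (kY k u) by move=> ?; exact: pmf_kY.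
have e v : rt k j (upd u j v) y = kapC pL (kY k) (ge j) (upd u j v) y / kapC pL (kY k) (ge j.+1) u y.
  congr (_ / _); apply: kapC_eq => j'; rewrite inE ffunE.
  by case: eqP => [->|//]; rewrite ltnn.
under eq_Ex do rewrite e.
rewrite ExZr; have -> : Ex (pL j) (fun v => kapC pL (kY k) (ge j) (upd u j v) y) = kapC pL (kY k) (ge j.+1) u y.
  rewrite /kapC -(Ex_merge (pred1 j) _ hpL).
  rewrite -(Ex_prd1 j (fun v => Ex (prd pL) (fun x' => kY k (merge (mem (ge j)) (upd u j v) x') y)) hpL).
  apply: eq_Ex => f _; apply: eq_Ex => g _; congr (kY _ _ _); apply/ffunP => j'.
  rewrite !ffunE /= !inE; case: (eqVneq j' j) => [->|ne]; first by rewrite leqnn ltnn.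
  by rewrite leq_eqVlt; case: eqP => [/val_inj e'|//]; rewrite e' eqxx in ne.
have := kapC_ge0 hpL hk (ge j.+1) u y; rewrite le_eqVlt => /orP[/eqP <-|h]; first by rewrite mul0r ler01.
by rewrite divff // gt_eqF.
Qed.

Context (M : finType) (m0 : M) (ul0 : UL) (ob0 : Ob) (B : nat) (thr : R).
Let T := (B + K)%N.

(** Every round and every layer has its own codebook; the round index has one spare value so that
    [inord] applies. *)
Definition book : finType := {ffun 'I_T.+1 * 'I_K * M -> UL}.
Definition bookpmf : book -> R := prd (fun k => pL k.1.2).

Lemma pmf_book : pmf bookpmf. Proof. exact: pmf_prd. Qed.

(** Both before message 0 reaches layer j and after the last message, the default [m0] is sent. *)
Definition wm (ws : seq M) (b j : nat) : M := if (j <= b)%N then nth m0 ws (b - j) else m0.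

Definition uround (c : book) ws b : {ffun 'I_K -> UL} := [ffun j : 'I_K => c (inord b, j, wm ws b j)].

(** In round b + j the layers above j carry messages older than b, which are already decoded.
    Entries below j may be wrong, but [rt k j] does not read them. *)
Definition cand (c : book) ws b w (j : 'I_K) : {ffun 'I_K -> UL} :=
  [ffun j' : 'I_K => c (inord (b + j), j', if j' == j then w else wm ws (b + j) j')].

Definition test (k : 'I_K.+1) (c : book) (h : seq Ob) b ws w : bool :=
  expR thr <= \prod_(j < K | (j < k)%N) rt k j (cand c ws b w j) (nth ob0 h (b + j)).

Fixpoint est (k : 'I_K.+1) (c : book) (h : seq Ob) (b : nat) : seq M :=
  if b is b'.+1 then
    rcons (est k c h b') (odflt m0 [pick w | test k c h b' (est k c h b') w])
  else [::].

(** All tests are run with the true past messages, so this event refers to the codebook and the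
    outputs and not to the estimates; on it the estimates are right by induction. *)
Definition good (c : book) (ws : seq M) (h : seq O) : bool :=
  [forall k : 'I_K.+1, (0 < k)%N ==> [forall b : 'I_B, [forall w,
     test k c (map (obs (pi k)) h) b (take b ws) w == (w == nth m0 ws b)]]].

Lemma est_ok (k : 'I_K.+1) c h ws b0 : (b0 <= size ws)%N ->
  (forall b w, (b < b0)%N -> test k c h b (take b ws) w = (w == nth m0 ws b)) ->
  est k c h b0 = take b0 ws.
Proof.
elim: b0 => [|b IH] hs ht /=; first by rewrite take0.
rewrite IH ?(ltnW hs) // => [|b' w hb]; last by apply: ht; rewrite ltnW.
rewrite (take_nth m0) //; congr rcons.
case: pickP => [w|] /=; first by rewrite ht // => /eqP.
by move=> /(_ (nth m0 ws b)); rewrite ht // eqxx.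
Qed.

Lemma test_take (k : 'I_K.+1) c h b b0 ws w : (b + k <= b0)%N ->
  test k c (take b0 h) b ws w = test k c h b ws w.
Proof.
move=> hb; rewrite /test; congr (_ <= _); apply: eq_bigr => j hj; congr (rt _ _ _ _).
by rewrite nth_take // (leq_trans _ hb) // ltn_add2l.
Qed.

Definition dfnode (c : book) (k : 'I_K.+1) (ws : seq M) (h : seq Ob) : {ffun 'I_K -> UL} :=
  let b := size h in
  (* After b rounds the tests for messages 0, ..., b - k are complete, because a test at node k
     reads k rounds; this gives b + 1 - k messages, at most B. The source knows all of them. *)
  let kn := if k == ord0 then ws else est k c h (minn (b.+1 - k) B) in
  [ffun j : 'I_K => if (k <= j)%N then c (inord b, j, wm kn b j) else ul0].

Definition dfst (c : book) (i : I) (ms : {ffun 'I_B -> M}) (h : seq Ob) : {ffun 'I_K -> UL} :=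
  if [pick k | pi k == i] is Some k then dfnode c k (flist ms) h else [ffun=> ul0].

Definition dfdec (c : book) (h : seq Ob) : {ffun 'I_B -> M} :=
  [ffun b : 'I_B => nth m0 (est ord_max c h B) b].

Lemma good_est c (ms : {ffun 'I_B -> M}) h b0 (k : 'I_K.+1) b : good c (flist ms) h ->
  (0 < k)%N -> (b <= B)%N -> (b.-1 + k <= b0)%N ->
  est k c (take b0 (map (obs (pi k)) h)) b = take b (flist ms).
Proof.
move=> /forallP /(_ k) /implyP g k0 hb hb0; apply: est_ok; first by rewrite size_flist.
move=> b' w hb'; rewrite test_take.
  by have /forallP /(_ (Ordinal (leq_trans hb' hb))) /forallP /(_ w) /eqP := g k0.
by apply: leq_trans hb0; rewrite leq_add2r; case: (b) hb'.
Qed.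

(** In round b a layer j' >= k carries message b - j' <= b - k, which node k has decoded by then;
    past the last message both sides fall back on [m0]. *)
Lemma dfst_good c ms h b : (b < size h)%N -> good c (flist ms) h ->
  W [ffun i => dfst c i ms (map (obs i) (take b h))] =1 Wu (uround c (flist ms) b).
Proof.
move=> hb g; apply: hcoh => j j' hj; rewrite ffunE /dfst.
set k := widen_ord _ j; case: pickP => [k' /eqP /pinj ->|/(_ k)]; last by rewrite eqxx.
rewrite !ffunE size_map size_take hb (_ : (k <= j')%N) //.
congr (c (_, _, _)); rewrite /wm; case: ifP => // hj'.
case: eqP => [//|/eqP nk]; have k0 : (0 < k)%N by case: (posnP k) nk => // e; case/eqP; apply: val_inj.
rewrite map_take (@good_est c ms h) ?geq_minr //; last first.
  by have := geq_minl (b.+1 - k) B; have : (k <= j')%N by []; lia.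
have hk : (k <= j')%N by [].
case: (ltnP (b - j') (minn (b.+1 - k) B)) => [lt|ge0]; first by rewrite nth_take.
rewrite !nth_default ?size_flist //; last first.
  by rewrite size_take size_flist; case: ifP; lia.
by move: ge0; rewrite geq_min; lia.
Qed.

Lemma dfdec_good c ms h : size h = T -> good c (flist ms) h ->
  (0 < K)%N -> dfdec c (map (obs (pi ord_max)) h) = ms.
Proof.
move=> hs g K0; apply/ffunP => b; rewrite ffunE.
have := @good_est c ms h T ord_max B g K0 (leqnn _); rewrite take_oversize; last by rewrite size_map hs.
move=> ->; last by rewrite /= leq_add2r leq_pred.
by rewrite take_oversize ?size_flist // nth_flist.
Qed.

(** A fixed message sequence reads the codebook at pairwise distinct places, so the letters it sends
    are independent. *)
Lemma Ex_book (ws : seq M) F :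
  Ex bookpmf (fun c => Ex (prd (fun b : 'I_T => Wu (uround c ws b))) (F [ffun b : 'I_T => uround c ws b])) =
  Ex (prd (fun _ : 'I_T => dfl)) (fun y => F [ffun b => (y b).1] [ffun b => (y b).2]).
Proof.
pose e (x : 'I_T * 'I_K) : 'I_T.+1 * 'I_K * M := (inord x.1, x.2, wm ws x.1 x.2).
have einj : injective e.
  move=> [b j] [b' j'] [/(congr1 val) /= hb -> _]; rewrite !inordK ?ltnS ?(ltnW (ltn_ord _)) // in hb.
  by rewrite (val_inj hb).
have h := Ex_prd_inj (fun f : {ffun 'I_T * 'I_K -> UL} =>
  Ex (prd (fun b : 'I_T => Wu [ffun j => f (b, j)])) (F [ffun b : 'I_T => [ffun j => f (b, j)]]))
  (fun k : 'I_T.+1 * 'I_K * M => hpL k.1.2) einj.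
transitivity (Ex (prd (fun _ : 'I_T => prd pL)) (fun x => Ex (prd (fun b => Wu (x b))) (F x))).
  have c1 := Ex_curry (fun (_ : 'I_T) j => pL j) (fun x => Ex (prd (fun b => Wu (x b))) (F x)).
  rewrite [RHS]c1; refine (etrans _ (etrans h _)).
    apply: eq_Ex => c _.
    have eU (b : 'I_T) : uround c ws b = [ffun j => [ffun x => c (e x)] (b, j)].
      by apply/ffunP => j; rewrite !ffunE.
    rewrite (_ : [ffun b : 'I_T => uround c ws b] = [ffun b => [ffun j => [ffun x => c (e x)] (b, j)]]).
      by apply: eq_bigr => o _; congr (_ * _); apply: eq_bigr => b _; rewrite eU.
    by apply/ffunP => b; rewrite !ffunE eU.
  apply: eq_Ex => g _; apply: eq_bigr => o _; congr (_ * _).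
  by apply: eq_bigr => b _; rewrite ffunE.
exact: (Ex_prd_zip (fun _ : 'I_T => prd pL) (fun _ : 'I_T => Wu) F).
Qed.

Lemma oi_subproof (b : 'I_B) (j : 'I_K) : (b + j < T)%N.
Proof. by rewrite /T; have := ltn_ord b; have := ltn_ord j; lia. Qed.
Definition oi b j : 'I_T := Ordinal (oi_subproof b j).

Lemma cand_true c (ms : {ffun 'I_B -> M}) (b : 'I_B) (w : M) (j j' : 'I_K) : (j <= j')%N ->
  cand c (take b (flist ms)) b w j j' =
  if j' == j then c (inord (b + j), j, w) else uround c (flist ms) (b + j) j'.
Proof.
move=> hj; rewrite !ffunE; case: eqP => [->//|/eqP ne]; congr (c (_, _, _)).
rewrite /wm; case: ifP => // h; rewrite nth_take //.
have : (j != j' :> nat) by apply: contra ne => /eqP e; apply/eqP/val_inj.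
by have := ltn_ord j; lia.
Qed.

Lemma wm_diag (ms : {ffun 'I_B -> M}) (b : 'I_B) (j : 'I_K) : wm (flist ms) (b + j) j = ms b.
Proof. by rewrite /wm leq_addl addnK nth_flist. Qed.

Lemma nth_obs (k : 'I_K.+1) (b : 'I_B) (j : 'I_K) (o : {ffun 'I_T -> O}) :
  nth ob0 (map (obs (pi k)) (flist o)) (b + j) = obs (pi k) (o (oi b j)).
Proof.
rewrite (nth_map (o (oi b j))) ?size_flist ?oi_subproof //.
by rewrite -[X in nth _ _ X]/(val (oi b j)) nth_flist.
Qed.

Context (a : 'I_K.+1 -> 'I_K -> R).
Definition pbad (k : 'I_K.+1) (j : 'I_K) : R :=
  Ex dfl (fun w => (rt k j w.1 (obs (pi k) w.2) < expR (a k j))%R%:R).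

(** The candidate for the true message consists of the letters actually sent. If the test fails, one
    of the k densities must fall short of its share [a k j] of the threshold. *)
Lemma miss_prob (ms : {ffun 'I_B -> M}) (k : 'I_K.+1) (b : 'I_B) :
  thr <= \sum_(j < K | (j < k)%N) a k j ->
  Ex bookpmf (fun c => Ex (prd (fun b : 'I_T => Wu (uround c (flist ms) b))) (fun o =>
    (~~ test k c (map (obs (pi k)) (flist o)) b (take b (flist ms)) (ms b))%:R)) <=
  \sum_(j < K | (j < k)%N) pbad k j.
Proof.
move=> ha; have hd : pmf dfl by exact: pmf_letterlaw.
pose F (x : {ffun 'I_T -> {ffun 'I_K -> UL}}) (o : {ffun 'I_T -> O}) : R :=
  \sum_(j < K | (j < k)%N) (rt k j (x (oi b j)) (obs (pi k) (o (oi b j))) < expR (a k j))%R%:R.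
apply: (@le_trans _ _ (Ex bookpmf (fun c => Ex (prd (fun b : 'I_T => Wu (uround c (flist ms) b)))
   (F [ffun b : 'I_T => uround c (flist ms) b])))).
  apply: ler_Ex => [c|c _]; first exact: pmf_ge0 pmf_book.
  apply: ler_Ex => [o|o _]; first exact: pmf_ge0 (pmf_prd _).
  case: (boolP (test _ _ _ _ _ _)) => [_|/negP nt] /=; first by apply: sumr_ge0 => j _; rewrite ler0n.
  case: (boolP [exists j : 'I_K, (j < k)%N && (rt k j (uround c (flist ms) (b + j))
      (obs (pi k) (o (oi b j))) < expR (a k j))]) => [/existsP[j /andP[jk hj]]|/existsPn al].
    rewrite /F (bigD1 j) //= ffunE /= hj lerDl; apply: sumr_ge0 => i _; exact: ler0n.
  case: nt; rewrite /test; apply: (@le_trans _ _ (expR (\sum_(j < K | (j < k)%N) a k j))).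
    by rewrite ler_expR.
  rewrite expR_sum; apply: ler_prod => j jk; rewrite expR_ge0 /= nth_obs.
  have := al j; rewrite jk /= -leNgt; congr (_ <= _); apply: rt_eq => j' hj'.
  rewrite cand_true //; case: eqP => [->|//].
  by rewrite ffunE wm_diag.
rewrite Ex_book /F Ex_sum; apply: ler_sum => j _.
under eq_Ex do rewrite !ffunE.
by rewrite (Ex_prd1 (oi b j) (fun w => (rt k j w.1 (obs (pi k) w.2) < expR (a k j))%R%:R)).
Qed.

(** A wrong [w] reads codebook entries that the true messages never read, so they can be resampled
    independently of the outputs. Each ratio then has mean at most 1, and Markov's inequality gives
    exp(-thr). *)
Lemma false_prob (ms : {ffun 'I_B -> M}) (k : 'I_K.+1) (b : 'I_B) w : w != ms b ->
  Ex bookpmf (fun c => Ex (prd (fun b : 'I_T => Wu (uround c (flist ms) b))) (fun o =>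
    (test k c (map (obs (pi k)) (flist o)) b (take b (flist ms)) w)%:R)) <= expR (- thr).
Proof.
move=> nw; have hbk := pmf_book.
pose H (c c' : book) (o : {ffun 'I_T -> O}) : R := \prod_(j < K | (j < k)%N)
   rt k j (upd (uround c (flist ms) (b + j)) j (c' (inord (b + j), j, w))) (obs (pi k) (o (oi b j))).
pose S := fun x : 'I_T.+1 * 'I_K * M => x.2 == wm (flist ms) x.1.1 x.1.2.
have uS (c c' : book) (b' : nat) : (b' < T)%N -> uround (merge S c c') (flist ms) b' = uround c (flist ms) b'.
  by move=> hb; apply/ffunP => j; rewrite !ffunE /S /= inordK ?eqxx // ltnS ltnW.
apply: (@le_trans _ _ (Ex bookpmf (fun c => Ex (prd (fun b : 'I_T => Wu (uround c (flist ms) b))) (fun o =>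
   expR (- thr) * \prod_(j < K | (j < k)%N) rt k j (cand c (take b (flist ms)) b w j) (obs (pi k) (o (oi b j))))))).
  apply: ler_Ex => [c|c _]; first exact: pmf_ge0 hbk.
  apply: ler_Ex => [o|o _]; first exact: pmf_ge0 (pmf_prd _).
  rewrite expRN mulrC ler_pdivlMr ?expR_gt0 //.
  case: (boolP (test _ _ _ _ _ _)) => [|_].
    rewrite mul1r /test; under eq_bigr do rewrite nth_obs; exact.
  by rewrite mul0r; apply: prodr_ge0 => j _; exact: rt_ge0.
rewrite /bookpmf -(Ex_merge S) //.
rewrite -[leRHS](Ex_cst _ hbk); apply: ler_Ex => [c|c _]; first exact: pmf_ge0 hbk.
have -> : Ex (prd (fun k0 : 'I_T.+1 * 'I_K * M => pL k0.1.2)) (fun g =>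
   Ex (prd (fun b : 'I_T => Wu (uround (merge S c g) (flist ms) b))) (fun o => expR (- thr) *
     \prod_(j < K | (j < k)%N) rt k j (cand (merge S c g) (take b (flist ms)) b w j) (obs (pi k) (o (oi b j))))) =
   Ex bookpmf (fun g => Ex (prd (fun b : 'I_T => Wu (uround c (flist ms) b))) (fun o => expR (- thr) * H c g o)).
  apply: eq_Ex => g _; apply: eq_bigr => o _; congr (_ * (_ * _)).
    by apply: eq_bigr => b' _; rewrite uS.
  apply: eq_bigr => j jk; apply: rt_eq => j' hj'.
  rewrite cand_true // [in RHS]ffunE; case: eqP => [_|_]; last by rewrite uS ?oi_subproof.
  by rewrite ffunE /S /= inordK ?wm_diag ?(negbTE nw) // ltnS ltnW // oi_subproof.
rewrite Ex_swap; have hp' := pmf_prd (fun b : 'I_T => hWu (uround c (flist ms) b)).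
rewrite -[leRHS](Ex_cst _ hp'); apply: ler_Ex => [o|o _]; first exact: pmf_ge0 hp'.
rewrite ExZ ler_piMr ?expR_ge0 //.
have einj : injective (fun j : 'I_K => (inord (b + j), j, w) : 'I_T.+1 * 'I_K * M) by move=> j j' [].
pose g' (j : 'I_K) v := if (j < k)%N then rt k j (upd (uround c (flist ms) (b + j)) j v) (obs (pi k) (o (oi b j))) else 1.
have := Ex_prd_inj (fun f : {ffun 'I_K -> UL} => \prod_j g' j (f j)) (fun k : 'I_T.+1 * 'I_K * M => hpL k.1.2) einj.
rewrite Ex_prd_prod => e.
have -> : Ex bookpmf (fun g => H c g o) = \prod_j Ex (pL j) (g' j).
  rewrite -e; apply: eq_Ex => g _; rewrite /H big_mkcond; apply: eq_bigr => j _.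
  by rewrite /g' ffunE.
apply: prodr_ile1 => j _; rewrite /g'; case: (boolP (j < k)%N) => _; last by rewrite Ex_cst // ler01 lexx.
by rewrite Ex_rt andbT; apply: Ex_ge0 => [v|v _]; [exact: pmf_ge0|exact: rt_ge0].
Qed.

Lemma df_error (ms : {ffun 'I_B -> M}) : (0 < K)%N ->
  (forall k : 'I_K.+1, (0 < k)%N -> thr <= \sum_(j < K | (j < k)%N) a k j) ->
  Ex bookpmf (fun c => run W T (fun h => [ffun i => dfst c i ms (map (obs i) h)])
     (fun h => (dfdec c (map (obs (pi ord_max)) h) != ms)%:R)) <=
  \sum_(k : 'I_K.+1 | (0 < k)%N) \sum_(b < B)
     (\sum_(j < K | (j < k)%N) pbad k j + #|M|%:R * expR (- thr)).
Proof.
move=> K0 ha; have hbk := pmf_book; set ws := flist ms.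
pose E1 (k : 'I_K.+1) (b : 'I_B) c (o : {ffun 'I_T -> O}) : R :=
  (~~ test k c (map (obs (pi k)) (flist o)) b (take b ws) (ms b))%:R.
pose E2 (k : 'I_K.+1) (b : 'I_B) w c (o : {ffun 'I_T -> O}) : R :=
  (test k c (map (obs (pi k)) (flist o)) b (take b ws) w)%:R.
apply: (@le_trans _ _ (Ex bookpmf (fun c => Ex (prd (fun b : 'I_T => Wu (uround c ws b))) (fun o =>
   \sum_(k : 'I_K.+1 | (0 < k)%N) \sum_(b < B) (E1 k b c o + \sum_(w | w != ms b) E2 k b w c o))))).
  apply: ler_Ex => [c|c _]; first exact: pmf_ge0 hbk.
  apply: (le_trans (run_couple hW hWu (s' := fun h => uround c ws (size h)) (G := good c ws) _ _)).
  - move=> h hs g b hb; rewrite (@size_takel b) ?hs ?(ltnW hb) //.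
    by apply: dfst_good => //; rewrite hs.
  - move=> h hs; case: (boolP (good c ws h)) => [g|_]; last by case: (_ != _); rewrite ?ler01.
    by rewrite (@dfdec_good c ms) // eqxx.
  rewrite (run_open Wu (x := fun b : 'I_T => uround c ws b)); last by move=> h b ->.
  apply: ler_Ex => [o|o _]; first exact: pmf_ge0 (pmf_prd _).
  have ge2 k b w : 0 <= E2 k b w c o by exact: ler0n.
  have ge1 k b : 0 <= E1 k b c o by exact: ler0n.
  have geS k b : 0 <= E1 k b c o + \sum_(w | w != ms b) E2 k b w c o by rewrite addr_ge0 // sumr_ge0.
  have geT k : 0 <= \sum_(b < B) (E1 k b c o + \sum_(w | w != ms b) E2 k b w c o) by rewrite sumr_ge0.
  case: (boolP (good c ws (flist o))) => [_|]; first by rewrite sumr_ge0.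
  case/forallPn => k; rewrite negb_imply => /andP[k0 /forallPn[b /forallPn[w hw]]].
  rewrite (bigD1 k) //= -[leLHS]addr0 lerD // ?sumr_ge0 //.
  rewrite (bigD1 b) //= -[leLHS]addr0 lerD // ?sumr_ge0 //.
  rewrite nth_flist in hw; case: (eqVneq w (ms b)) hw => [->|nw] hw.
    rewrite /E1; move: hw; rewrite eqb_id => ->; by rewrite lerDl sumr_ge0.
  rewrite (bigD1 w) //=; have -> : E2 k b w c o = 1.
    by move: hw; rewrite /E2; case: (test _ _ _ _ _ _).
  by rewrite addrCA lerDl addr_ge0 // sumr_ge0.
have -> : Ex bookpmf (fun c => Ex (prd (fun b : 'I_T => Wu (uround c ws b))) (fun o =>
   \sum_(k : 'I_K.+1 | (0 < k)%N) \sum_(b < B) (E1 k b c o + \sum_(w | w != ms b) E2 k b w c o))) =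
   \sum_(k : 'I_K.+1 | (0 < k)%N) \sum_(b < B) (
     Ex bookpmf (fun c => Ex (prd (fun b : 'I_T => Wu (uround c ws b))) (E1 k b c)) +
     \sum_(w | w != ms b) Ex bookpmf (fun c => Ex (prd (fun b : 'I_T => Wu (uround c ws b))) (E2 k b w c))).
  transitivity (Ex bookpmf (fun c => \sum_(k : 'I_K.+1 | (0 < k)%N) \sum_(b < B) (
     Ex (prd (fun b : 'I_T => Wu (uround c ws b))) (E1 k b c) +
     \sum_(w | w != ms b) Ex (prd (fun b : 'I_T => Wu (uround c ws b))) (E2 k b w c)))).
    apply: eq_Ex => c _; rewrite Ex_sum; apply: eq_bigr => k _; rewrite Ex_sum; apply: eq_bigr => b _.
    by rewrite ExD Ex_sum.
  rewrite Ex_sum; apply: eq_bigr => k _; rewrite Ex_sum; apply: eq_bigr => b _.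
  by rewrite ExD Ex_sum.
apply: ler_sum => k k0; apply: ler_sum => b _; apply: lerD; first exact: miss_prob (ha k k0).
apply: (le_trans (ler_sum _ (fun w nw => false_prob k nw))).
by rewrite sumr_const -[expR _ *+ _]mulr_natl ler_wpM2r ?expR_ge0 // ler_nat max_card.
Qed.

End DecodeForward.

(** * The rate of decode-and-forward over long blocks *)

Section DecodeForwardRate.
Context {R : realType} {I UL O Ob : finType} (K : nat) (pi : 'I_K.+1 -> I) (pinj : injective pi).
Context (pL : 'I_K -> UL -> R) (hpL : forall j, pmf (pL j)).
Context (Wu : {ffun 'I_K -> UL} -> O -> R) (hWu : forall u, pmf (Wu u)).
Context (W : {ffun I -> {ffun 'I_K -> UL}} -> O -> R) (hW : forall a, pmf (W a)).
Context (obs : I -> O -> Ob).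
Context (hcoh : forall (a : {ffun I -> {ffun 'I_K -> UL}}) (u : {ffun 'I_K -> UL}),
  (forall j j' : 'I_K, (j <= j')%N -> a (pi (widen_ord (leqnSn K) j)) j' = u j') -> W a =1 Wu u).

Local Notation dL := (dfl pL Wu).
Local Notation rL := (rt pi pL Wu obs).

(** The difference [Hk k k - Hk k 0] is the mutual information between the layers below k and the
    observation of node k, given the layers from k on. *)
Definition Hk (k : 'I_K.+1) (j : nat) : R :=
  cent dL (fun w => obs (pi k) w.2) (fun w => xres (ge K j) w.1).

Lemma Ex_ln_kapC (k : 'I_K.+1) j :
  Ex dL (fun w => - ln (kapC pL (kY pi Wu obs k) (ge K j) w.1 (obs (pi k) w.2))) = Hk k j.
Proof.
have hk u : pmf (kY pi Wu obs k u) by exact: pmf_kY.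
transitivity (Ex (letterlaw pL (kY pi Wu obs k)) (fun y => - ln (kapC pL (kY pi Wu obs k) (ge K j) y.1 y.2))).
  by rewrite /dfl /letterlaw !Ex_jn; apply: eq_Ex => u _; rewrite /kY Ex_push.
rewrite kapC_cent //; apply: samelaw_cent => phi.
by rewrite /dfl /letterlaw !Ex_jn; apply: eq_Ex => u _; rewrite /kY Ex_push.
Qed.

Lemma dfl_pos (w : {ffun 'I_K -> UL} * O) (k : 'I_K.+1) j : 0 < dL w ->
  0 < kapC pL (kY pi Wu obs k) (ge K j) w.1 (obs (pi k) w.2).
Proof.
rewrite /dfl /letterlaw /jn => h.
have px : 0 < prd pL w.1.
  have := pmf_ge0 w.1 (pmf_prd hpL); rewrite le_eqVlt => /orP[/eqP e|//].
  by move: h; rewrite -e mul0r ltxx.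
apply: kapC_gt0 => // [u|]; first exact: pmf_kY.
by rewrite pmulr_rgt0 // in h; exact: (pr_gt0 (hWu _) (obs (pi k))).
Qed.

Lemma rt_pos (w : {ffun 'I_K -> UL} * O) (k : 'I_K.+1) j : 0 < dL w -> 0 < rL k j w.1 (obs (pi k) w.2).
Proof. by move=> h; rewrite divr_gt0 // dfl_pos. Qed.

Lemma Ex_ln_rt (k : 'I_K.+1) (j : 'I_K) :
  Ex dL (fun w => ln (rL k j w.1 (obs (pi k) w.2))) = Hk k j.+1 - Hk k j.
Proof.
have hd : pmf dL by exact: pmf_letterlaw.
rewrite -!Ex_ln_kapC -ExB; apply: eq_Ex => w hw.
have hw' : 0 < dL w by rewrite lt0r hw (pmf_ge0 _ hd).
by rewrite /rt ln_div ?posrE ?dfl_pos // opprK addrC.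
Qed.

Section Power.
Context (N : nat).
Let J := 'I_N.
Definition powW (a : {ffun I -> {ffun 'I_K -> {ffun 'I_N -> UL}}}) : {ffun 'I_N -> O} -> R :=
  prd (fun c => W [ffun i => [ffun j => a i j c]]).
Definition powobs (i : I) (o : {ffun 'I_N -> O}) : {ffun 'I_N -> Ob} := [ffun c => obs i (o c)].

Lemma pmf_powW a : pmf (powW a). Proof. exact: pmf_prd. Qed.

Lemma powW_coh (a : {ffun I -> {ffun 'I_K -> {ffun 'I_N -> UL}}}) (u : {ffun 'I_K -> {ffun 'I_N -> UL}}) :
  (forall j j' : 'I_K, (j <= j')%N -> a (pi (widen_ord (leqnSn K) j)) j' = u j') ->
  powW a =1 blockK Wu u.
Proof.
move=> h o; apply: eq_bigr => c _; apply: hcoh => j j' hj.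
by rewrite !ffunE h.
Qed.

Lemma rt_block (k : 'I_K.+1) (j : 'I_K) (u : {ffun 'I_K -> {ffun 'I_N -> UL}}) (o : {ffun 'I_N -> O}) :
  rt pi (blockX pL (J := J)) (blockK Wu (J := J)) powobs k j u (powobs (pi k) o) =
  \prod_c rL k j [ffun j => u j c] (obs (pi k) (o c)).
Proof.
have e i : kapC (blockX pL (J := J)) (kY pi (blockK Wu (J := J)) powobs k) (ge K i) u (powobs (pi k) o) =
   \prod_c kapC pL (kY pi Wu obs k) (ge K i) [ffun j => u j c] (obs (pi k) (o c)).
  transitivity (kapC (blockX pL (J := J)) (blockK (kY pi Wu obs k) (J := J)) (ge K i) u (powobs (pi k) o)).
    apply: eq_Ex => x _; rewrite /kY /blockK /powobs.
    exact: (pr_prd (fun c : J => Wu [ffun j => merge (mem (ge K i)) u x j c]) (fun _ => obs (pi k))).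
  by rewrite kapC_block; apply: eq_bigr => c _; rewrite ffunE.
by rewrite /rt !e -prodf_div.
Qed.

(** The law of large numbers in mean at precision d e, followed by Markov's inequality at deviation
    N d, leaves probability e. *)
Lemma pbad_block (k : 'I_K.+1) (j : 'I_K) (v d e : R) (a : 'I_K.+1 -> 'I_K -> R) : 0 < d -> 0 < e -> (0 < N)%N ->
  var dL (fun w => ln (rL k j w.1 (obs (pi k) w.2))) <= v -> v <= (d * e) ^+ 2 * N%:R ->
  a k j = N%:R * (Hk k j.+1 - Hk k j - d) ->
  pbad pi (blockX pL (J := J)) (blockK Wu (J := J)) powobs a k j <= e.
Proof.
move=> d0 e0 N0 hv hN ha; have hd : pmf dL by exact: pmf_letterlaw.
pose f w := ln (rL k j w.1 (obs (pi k) w.2)).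
have hb : pmf (prd (fun _ : J => dL)) by exact: pmf_prd.
have N0' : 0 < N%:R :> R by rewrite ltr0n.
rewrite /pbad /dfl /letterlaw Ex_jn.
rewrite (Ex_block pL Wu (fun x w => (rt pi (blockX pL (J := J)) (blockK Wu (J := J)) powobs k j x (powobs (pi k) w)
   < expR (a k j))%R%:R)).
pose S (y : {ffun J -> {ffun 'I_K -> UL} * O}) : R := `| \sum_c f (y c) - \sum_(c : J) Ex dL f |.
apply: (@le_trans _ _ (Ex (prd (fun _ : J => dL)) (fun y => (N%:R * d < S y)%R%:R))).
  apply: ler_Ex => [y|y py]; first exact: pmf_ge0 hb.
  rewrite ler_nat; case: (ltP _ (expR _)) => // h; rewrite lt0b.
  have pc c : 0 < rL k j (y c).1 (obs (pi k) (y c).2) by apply: rt_pos; exact: (prd_gt0 c (fun _ => hd) py).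
  have : \prod_c rL k j (y c).1 (obs (pi k) (y c).2) < expR (a k j).
    move: h; rewrite rt_block.
    congr (_ < _); apply: eq_bigr => c _; rewrite ffunE; congr (rt _ _ _ _ _ _ _ _).
    by apply/ffunP => i; rewrite !ffunE.
  rewrite -[X in X < _]lnK ?posrE ?prodr_gt0 // ltr_expR ln_prod // ha => h'.
  rewrite /S sumr_const card_ord -[Ex dL f *+ _]mulr_natl Ex_ln_rt.
  rewrite ltr_normr; apply/orP; right; move: h'; rewrite /f; lra.
have h := @markov R _ _ S (N%:R * d) (fun y => N%:R * d < S y)%R hb.
apply: (le_trans (h _ _ _)).
- exact: mulr_gt0.
- by move=> y _; exact: normr_ge0.
- by move=> y _; exact: ltW.
rewrite ler_pdivrMr ?mulr_gt0 //.
have := lln_L1 (p := fun _ : J => dL) (g := fun _ => f) (fun _ => hd) (fun _ => hv) (mulr_gt0 d0 e0).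
rewrite card_ord => /(_ (fun _ => hN)) /le_trans; apply.
by rewrite le_eqVlt; apply/orP; left; apply/eqP; ring.
Qed.

End Power.

Lemma Hk_tele (k : 'I_K.+1) : \sum_(j < K | (j < k)%N) (Hk k j.+1 - Hk k j) = Hk k k - Hk k 0.
Proof.
rewrite -(big_mkord (fun j => (j < k)%N) (fun j => Hk k j.+1 - Hk k j)) -big_filter.
have flt n m : (m <= n)%N -> [seq j <- index_iota 0 n | (j < m)%N] = index_iota 0 m.
  move=> hk; rewrite /index_iota !subn0 -(subnKC hk) iotaD filter_cat add0n.
  rewrite (_ : [seq j <- iota 0 m | _] = iota 0 m); last first.
    by apply/all_filterP/allP => j; rewrite mem_iota.
  rewrite (@eq_in_filter _ _ pred0) ?filter_pred0 ?cats0 // => j.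
  by rewrite mem_iota /=; lia.
rewrite flt; last by rewrite -ltnS.
by rewrite telescope_sumr.
Qed.

(* Sliding-window decode-and-forward over blocks of [N] superletters. *)
Theorem df_rate (Rt eps : R) (B : nat) (ul0 : UL) (ob0 : Ob) : (0 < K)%N -> (0 < B)%N -> 0 < eps ->
  (forall k : 'I_K.+1, (0 < k)%N -> Rt < Hk k k - Hk k 0) ->
  exists N0 : nat, forall N : nat, (N0 <= N)%N -> forall (M : finType) (m0 : M),
    ln #|M|%:R <= N%:R * Rt ->
    pccode (powW (N := N)) (powobs (N := N)) (pi ord0) (pi ord_max) {ffun 'I_B -> M} (B + K) eps.
Proof.
move=> K0 B0 eps0 hR.
(* The inverse of the sum of the inverse gaps lies below every gap. The value 1 at k = 0 fills the
   place of the source, which decodes nothing. *)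
have [g [g0 hg]] : exists g : R, 0 < g /\ forall k : 'I_K.+1, (0 < k)%N -> Rt + 2 * g <= Hk k k - Hk k 0.
  pose gap (k : 'I_K.+1) := if (0 < k)%N then Hk k k - Hk k 0 - Rt else 1.
  have gap0 k : 0 < gap k by rewrite /gap; case: ifP => // /hR; rewrite subr_gt0.
  exists ((\sum_k (gap k)^-1)^-1 / 2); have s0 : 0 < \sum_k (gap k)^-1.
    rewrite (bigD1 ord0) //= ltr_pwDl ?invr_gt0 // sumr_ge0 // => k _; by rewrite invr_ge0 ltW.
  split; first by rewrite divr_gt0 ?invr_gt0.
  move=> k k0; rewrite [2 * _]mulrC divfK ?pnatr_eq0 //.
  have : (\sum_k (gap k)^-1)^-1 <= gap k.
    rewrite -[leRHS]invrK lef_pV2 ?posrE ?invr_gt0 //.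
    by rewrite (bigD1 k) //= lerDl sumr_ge0 // => k' _; by rewrite invr_ge0 ltW.
  by rewrite /gap k0; lra.
have K0' : 0 < K%:R :> R by rewrite ltr0n.
have B0' : 0 < B%:R :> R by rewrite ltr0n.
have K1 : 0 < K.+1%:R :> R by rewrite ltr0n.
(* At most K layers enter a test, so their margins d add up to at most g. The other g of the gap
   separates [thr] from the log size of [M]. *)
pose d := g / K%:R.
have d0 : 0 < d by exact: divr_gt0.
(* The union bound runs over K + 1 node indices and B messages, with K missed densities and one
   false-alarm term, each of size e. *)
pose e := eps / (K.+1%:R * B%:R * K.+1%:R).
have e0 : 0 < e by apply: divr_gt0 => //; rewrite !mulr_gt0.
have hd : pmf dL by exact: pmf_letterlaw.
pose v : R := \sum_(x : 'I_K.+1 * 'I_K) var dL (fun w => ln (rL x.1 x.2 w.1 (obs (pi x.1) w.2))).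
have hv k j : var dL (fun w => ln (rL k j w.1 (obs (pi k) w.2))) <= v.
  by rewrite /v (bigD1 (k, j)) //= lerDl sumr_ge0 // => x _; exact: var_ge0.
have v0 : 0 <= v by apply: sumr_ge0 => x _; exact: var_ge0.
exists (Num.bound (v / (d * e) ^+ 2) + Num.bound ((g * e)^-1))%N.+1 => N hN M m0 hM.
have N0 : (0 < N)%N by exact: leq_trans hN.
have N0' : 0 < N%:R :> R by rewrite ltr0n.
have hN1 : v <= (d * e) ^+ 2 * N%:R.
  rewrite mulrC -ler_pdivrMr; last exact: exprn_gt0 (mulr_gt0 d0 e0).
  apply: (le_trans (ltW (archi_boundP _))); first by rewrite divr_ge0 // sqr_ge0.
  by rewrite ler_nat (leq_trans _ hN) // leqW // leq_addr.
have hN2 : (g * e)^-1 <= N%:R.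
  apply: (le_trans (ltW (archi_boundP _))); first by rewrite invr_ge0 ltW // (mulr_gt0 g0 e0).
  by rewrite ler_nat (leq_trans _ hN) // leqW // leq_addl.
pose a (k : 'I_K.+1) (j : 'I_K) : R := N%:R * (Hk k j.+1 - Hk k j - d).
pose thr := N%:R * (Rt + g).
pose ul : {ffun 'I_N -> UL} := [ffun=> ul0]; pose ob : {ffun 'I_N -> Ob} := [ffun=> ob0].
have hX := pmf_blockX hpL 'I_N; have hK u := pmf_blockK hWu (J := 'I_N) u.
pose ULN : finType := {ffun 'I_N -> UL}.
exists (@book ULN K M B), (@bookpmf R ULN K (blockX pL (J := 'I_N)) M B).
exists (dfst pi (blockX pL (J := 'I_N)) (blockK Wu (J := 'I_N)) (powobs (N := N)) m0 ul ob thr).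
exists (dfdec pi (blockX pL (J := 'I_N)) (blockK Wu (J := 'I_N)) (powobs (N := N)) m0 ob thr).
split.
- exact: pmf_book.
- move=> f i ms ms' h ni; rewrite /dfst; case: pickP => [k /eqP ek|//]; rewrite /dfnode.
  by case: eqP => // k0; case/eqP: ni; rewrite -ek k0.
move=> ms.
have ha (k : 'I_K.+1) : (0 < k)%N -> thr <= \sum_(j < K | (j < k)%N) a k j.
  move=> k0; rewrite /a -mulr_sumr sumrB Hk_tele /thr ler_wpM2l ?ler0n //.
  have hs : \sum_(j < K | (j < k)%N) d <= g.
    rewrite sumr_const -[d *+ _]mulr_natl /d mulrC -mulrA ler_piMr ?(ltW g0) //.
    rewrite mulrC ler_pdivrMr // mul1r ler_nat -[leqRHS]card_ord; exact: max_card.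
  have := hg k k0; lra.
apply: (le_trans (df_error pinj hX hK (@pmf_powW N) (@powobs N) (@powW_coh N) m0 ul ob ms K0 ha)).
have hMe : #|M|%:R * expR (- thr) <= e.
  have M0 : 0 < #|M|%:R :> R by rewrite ltr0n; apply/card_gt0P; exists m0.
  have Ng : 0 < N%:R * g by rewrite mulr_gt0.
  have h1 : #|M|%:R <= expR (N%:R * Rt) by rewrite -[leLHS]lnK ?posrE // ler_expR.
  apply: (le_trans (ler_wpM2r (expR_ge0 _) h1)); rewrite -expRD.
  have -> : N%:R * Rt + - thr = - (N%:R * g) by rewrite /thr; ring.
  rewrite expRN; apply: (@le_trans _ _ (N%:R * g)^-1).
    rewrite lef_pV2 ?posrE ?expR_gt0 //; apply: le_trans (expR_ge1Dx _).
    by rewrite lerDr ler01.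
  rewrite -[leRHS]invrK lef_pV2 ?posrE ?invr_gt0 //.
  by move: hN2; rewrite invfM -ler_pdivlMl ?invr_gt0 // invrK mulrC.
have hS (k : 'I_K.+1) : \sum_(j < K | (j < k)%N) pbad pi (blockX pL (J := 'I_N)) (blockK Wu (J := 'I_N))
    (powobs (N := N)) a k j <= K%:R * e.
  apply: (@le_trans _ _ (\sum_(j < K | (j < k)%N) e)).
    by apply: ler_sum => j _; apply: (pbad_block d0 e0 N0 (hv k j) hN1).
  rewrite sumr_const -[e *+ _]mulr_natl ler_wpM2r ?(ltW e0) // ler_nat -[leqRHS]card_ord; exact: max_card.
apply: (@le_trans _ _ (\sum_(k : 'I_K.+1) \sum_(b < B) (K%:R * e + e))).
  rewrite [leRHS](bigID (fun k : 'I_K.+1 => (0 < k)%N)) /= -[leLHS]addr0; apply: lerD.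
    by apply: ler_sum => k _; apply: ler_sum => b _; apply: lerD.
  apply: sumr_ge0 => k _; apply: sumr_ge0 => b _.
  by apply: addr_ge0; [apply: mulr_ge0; [exact: ler0n|exact: ltW]|exact: ltW].
rewrite !sumr_const !card_ord -mulrnA -[leLHS]mulr_natl natrM.
have -> : K%:R * e + e = K.+1%:R * e by rewrite -natr1 mulrDl mul1r.
rewrite le_eqVlt; apply/orP; left; apply/eqP; rewrite /e.
move: K1 B0'; move: (K.+1%:R : R) (B%:R : R) => x y x0 y0.
by field; rewrite !gt_eqF.
Qed.

End DecodeForwardRate.

(** * Implementing one network by another *)

Section Implementation.
Context {R : realType} {I XX O Ob XX' O' Ob' : finType}.
Context (W : {ffun I -> XX} -> O -> R) (hW : forall a, pmf (W a)) (obs : I -> O -> Ob).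
Context (W' : {ffun I -> XX'} -> O' -> R) (obs' : I -> O' -> Ob').

(* One use of [W'] is realized by [t] uses of [W], public randomness and causal local processing. *)
Definition impl (t : nat) : Prop :=
  exists (Sd : finType) (nu : Sd -> R) (loc : Sd -> I -> XX' -> seq Ob -> XX)
    (out : Sd -> {ffun I -> XX'} -> seq O -> O') (lobs : Sd -> I -> XX' -> seq Ob -> Ob'),
  [/\ pmf nu,
      forall f a os i, size os = t -> obs' i (out f a os) = lobs f i (a i) (map (obs i) os)
    & forall a phi, Ex (W' a) phi =
        Ex nu (fun f => run W t (fun h => [ffun i => loc f i (a i) (map (obs i) h)])
                  (fun os => phi (out f a os)))].

Section Compose.
Context (t : nat) (Sd : finType) (nu : Sd -> R) (loc : Sd -> I -> XX' -> seq Ob -> XX)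
    (out : Sd -> {ffun I -> XX'} -> seq O -> O') (lobs : Sd -> I -> XX' -> seq Ob -> Ob').
Context (hnu : pmf nu)
  (hobs : forall f a os i, size os = t -> obs' i (out f a os) = lobs f i (a i) (map (obs i) os))
  (hlaw : forall a phi, Ex (W' a) phi =
        Ex nu (fun f => run W t (fun h => [ffun i => loc f i (a i) (map (obs i) h)])
                  (fun os => phi (out f a os)))).
Context (x0 : XX).

(** The strategy [s'] is simulated block by block: each block of t symbols uses one seed, and a
    finished block becomes one virtual observation through [lobs]. *)
Fixpoint sst (s' : seq Ob' -> XX') (fs : seq Sd) (i : I) (h : seq Ob) : XX :=
  if fs is f :: fs' then
    if (size h < t)%N then loc f i (s' [::]) h
    else sst (fun h' => s' (lobs f i (s' [::]) (take t h) :: h')) fs' i (drop t h)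
  else x0.

Fixpoint sobs (s' : seq Ob' -> XX') (fs : seq Sd) (i : I) (h : seq Ob) : seq Ob' :=
  if fs is f :: fs' then
    lobs f i (s' [::]) (take t h) ::
    sobs (fun h' => s' (lobs f i (s' [::]) (take t h) :: h')) fs' i (drop t h)
  else [::].

Lemma run_compose T (s' : I -> seq Ob' -> XX') (dst : I) (psi : seq Ob' -> R) :
  Ex (prd (fun _ : 'I_T => nu)) (fun fl => run W (T * t)
     (fun h => [ffun i => sst (s' i) (flist fl) i (map (obs i) h)])
     (fun h => psi (sobs (s' dst) (flist fl) dst (map (obs dst) h)))) =
  run W' T (fun h' => [ffun i => s' i (map (obs' i) h')]) (fun h' => psi (map (obs' dst) h')).
Proof.
elim: T s' psi => [|T IH] s' psi.
  have f0 : {ffun 'I_0 -> Sd} by apply: finfun => -[].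
  by rewrite (Ex_prd_nil _ _ f0) flist_nil.
rewrite Ex_prd_recl /= hlaw; apply: eq_Ex => f _.
set a := [ffun i => s' i [::]].
transitivity (Ex (prd (fun _ : 'I_T => nu)) (fun fl => run W t
   (fun h => [ffun i => loc f i (a i) (map (obs i) h)]) (fun H => run W (T * t)
     (fun h => [ffun i => sst (fun h' => s' i (obs' i (out f a H) :: h')) (flist fl) i (map (obs i) h)])
     (fun h => psi (obs' dst (out f a H) :: sobs (fun h' => s' dst (obs' dst (out f a H) :: h')) (flist fl) dst (map (obs dst) h)))))).
  apply: eq_Ex => fl _; rewrite mulSn run_add; apply: eq_run => [h hh|H hH].
    by apply/ffunP => i; rewrite !ffunE flist_cons /= size_map hh.
  apply: eq_run => [h _|h _].
    apply/ffunP => i; rewrite !ffunE flist_cons /= size_map size_cat hH ltnNge leq_addr /=.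
    by rewrite map_cat take_size_cat ?drop_size_cat ?size_map // hobs // ffunE.
  rewrite flist_cons /= map_cat take_size_cat ?drop_size_cat ?size_map //.
  by rewrite hobs // ffunE.
rewrite run_Ex; apply: eq_run => // H hH.
rewrite (IH (fun i h' => s' i (obs' i (out f a H) :: h')) (fun h' => psi (obs' dst (out f a H) :: h'))).
by apply: eq_run.
Qed.

Lemma eq_sst s1 s2 fs i h : s1 =1 s2 -> sst s1 fs i h = sst s2 fs i h.
Proof.
elim: fs s1 s2 h => //= f fs IH s1 s2 h e; rewrite e; case: ifP => // _.
by apply: IH => h'; rewrite e.
Qed.

Lemma eq_sobs s1 s2 fs i h : s1 =1 s2 -> sobs s1 fs i h = sobs s2 fs i h.
Proof.
elim: fs s1 s2 h => //= f fs IH s1 s2 h e; rewrite e; congr (_ :: _).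
by apply: IH => h'; rewrite e.
Qed.

End Compose.

Lemma pccode_impl t src dst Msg T eps (x0 : XX) : impl t -> dst != src ->
  pccode W' obs' src dst Msg T eps -> pccode W obs src dst Msg (T * t) eps.
Proof.
move=> [Sd [nu [loc [out [lobs [hnu hobs hlaw]]]]]] nd [Sd' [nu' [st [dec [hnu' hst herr]]]]].
exists (Sd' * {ffun 'I_T -> Sd})%type, (jn nu' (fun _ => prd (fun _ => nu))),
  (fun f i m h => sst t loc lobs x0 (st f.1 i m) (flist f.2) i h),
  (* The destination must replay its own strategy, whose type asks for a message; since [dst] is not
     the source, the arbitrary value [dec f.1 [::]] serves. *)
  (fun f h => dec f.1 (sobs t lobs (st f.1 dst (dec f.1 [::])) (flist f.2) dst h)).
split.
- by apply: pmf_jn => // _; exact: pmf_prd.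
- by move=> f i m m' h ni; apply: eq_sst => h'; exact: hst.
move=> m; apply: le_trans (herr m); rewrite Ex_jn le_eqVlt; apply/orP; left; apply/eqP.
apply: eq_Ex => f' _.
rewrite -(run_compose hobs hlaw x0 T (st f' ^~ m) dst (fun l => (dec f' l != m)%:R)).
apply: eq_Ex => fl _; apply: eq_run => // h _ /=; congr (_ != _)%:R; congr (dec f' _).
by apply: eq_sobs => h'; exact: hst.
Qed.

Lemma impl_open (S : finType) (pS : S -> R) (n : nat) (enc : S -> I -> XX' -> 'I_n -> XX)
    (mk : S -> {ffun 'I_n -> O} -> O') (mkl : S -> {ffun 'I_n -> Ob} -> Ob') (x0 : XX) (o0 : O) :
  pmf pS ->
  (forall s y i, obs' i (mk s y) = mkl s [ffun r => obs i (y r)]) ->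
  (forall a phi, Ex (W' a) phi = Ex pS (fun s =>
     Ex (prd (fun r => W [ffun i => enc s i (a i) r])) (fun y => phi (mk s y)))) ->
  impl n.
Proof.
move=> hS hob hlaw.
exists S, pS, (fun s i a h => oapp (enc s i a) x0 (insub (size h))),
  (fun s _ os => mk s [ffun r : 'I_n => nth o0 os r]),
  (fun s i _ h => mkl s [ffun r : 'I_n => nth (obs i o0) h r]).
split=> // [s a os i hs|a phi].
  rewrite hob; congr mkl; apply/ffunP => r; rewrite !ffunE (nth_map o0) //.
  by rewrite hs.
rewrite hlaw; apply: eq_Ex => s _.
rewrite (run_open W (x := fun r : 'I_n => [ffun i => enc s i (a i) r])); last first.
  by move=> h r hr; apply/ffunP => i; rewrite !ffunE size_map hr valK.
apply: eq_Ex => y _; congr (phi (mk s _)); apply/ffunP => r; rewrite ffunE.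
by rewrite nth_flist.
Qed.

Lemma pccode_pad src dst Msg T r eps (x0 : XX) :
  pccode W obs src dst Msg T eps -> pccode W obs src dst Msg (T + r) eps.
Proof.
move=> [Sd [nu [st [dec [hnu hst herr]]]]].
exists Sd, nu, (fun f i m h => if (size h < T)%N then st f i m h else x0), (fun f h => dec f (take T h)).
split=> //; first by move=> f i m m' h ni; rewrite (hst f i m m' h ni).
move=> m; apply: le_trans (herr m); rewrite le_eqVlt; apply/orP; left; apply/eqP.
apply: eq_Ex => f _; rewrite run_add; apply: eq_run => [h hh|h hh].
  by apply/ffunP => i; rewrite !ffunE size_map hh.
rewrite -[RHS](run_cst hW r (fun h' => [ffun i => x0])).
apply: eq_run => [h' _|h' _].
  by apply/ffunP => i; rewrite !ffunE size_map size_cat hh ltnNge leq_addr.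
by rewrite map_cat take_size_cat // size_map.
Qed.

Lemma pccode_sub src dst (Msg Msg' : finType) T eps :
  (#|Msg'| <= #|Msg|)%N -> (0 < #|Msg'|)%N ->
  pccode W obs src dst Msg T eps -> pccode W obs src dst Msg' T eps.
Proof.
move=> hc /card_gt0P[m0 _] [Sd [nu [st [dec [hnu hst herr]]]]].
pose e (m : Msg') : Msg := enum_val (widen_ord hc (enum_rank m)).
pose d (m : Msg) : Msg' := odflt m0 [pick m' | e m' == m].
have einj : injective e.
  move=> m m' /enum_val_inj /(congr1 val) /= h; apply: enum_rank_inj; exact: val_inj.
have eK m : d (e m) = m.
  by rewrite /d; case: pickP => [m' /eqP /einj //|/(_ m)]; rewrite eqxx.
exists Sd, nu, (fun f i m h => st f i (e m) h), (fun f h => d (dec f h)).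
split=> //; first by move=> f i m m' h ni; exact: hst.
move=> m; apply: le_trans (herr (e m)); apply: ler_Ex => [f|f _]; first exact: pmf_ge0.
apply: ler_run => // h _; rewrite ler_nat.
by case: (eqVneq (dec f (map (obs dst) h)) (e m)) => [->|_]; rewrite ?eK ?eqxx // leq_b1.
Qed.

End Implementation.

(** * Removing public randomness and fitting arbitrary block lengths *)

Section Derandomize.
Context {R : realType}.

Lemma run_ffun (In : Type) (O : finType) (W : In -> O -> R) T s phi :
  run W T s phi = \sum_(ys : {ffun 'I_T -> O})
    (\prod_(t < T) W (s (take t (flist ys))) (ys t)) * phi (flist ys).
Proof.
elim: T s phi => [|T IH] s phi /=.
  have f0 : {ffun 'I_0 -> O} by apply: finfun => -[].
  have h (f : {ffun 'I_0 -> O}) : f = f0 by apply/ffunP => -[].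
  rewrite (big_pred1 f0) => [|f]; first by rewrite big_ord0 mul1r flist_nil.
  by rewrite (h f) /= eqxx.
rewrite [RHS](reindex (fun w : O * {ffun 'I_T -> O} => fcons w.1 w.2)) /=; last first.
  exists (fun f : {ffun 'I_T.+1 -> O} => (f ord0, [ffun c => f (lift ord0 c)])) => [[o f] _|f _].
    by rewrite fcons0; congr (_, _); apply/ffunP => c; rewrite ffunE fconsS.
  apply/ffunP => c; rewrite ffunE /=; case: unliftP => [c' ->|->] //.
  by rewrite ffunE.
rewrite -(pair_bigA _ (fun o (f : {ffun 'I_T -> O}) =>
  (\prod_(t < T.+1) W (s (take t (flist (fcons o f)))) (fcons o f t)) * phi (flist (fcons o f)))) /=.
apply: eq_bigr => o _; rewrite IH mulr_sumr; apply: eq_bigr => f _.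
rewrite mulrA flist_cons; congr (_ * _); rewrite big_ord_recl take0 fcons0; congr (_ * _).
by apply: eq_bigr => t _; rewrite fconsS.
Qed.

Lemma Ex_exists_le (A : finType) (p f : A -> R) c : pmf p -> Ex p f <= c -> exists a, f a <= c.
Proof.
move=> hp h; apply/existsP; apply: contraT => /existsPn al.
have [a0 pa0] := pmf_inhab hp.
suff : c < Ex p f by rewrite ltNge h.
rewrite -[ltLHS](Ex_cst c hp) /Ex (bigD1 a0) //= [ltRHS](bigD1 a0) //= ltr_leD //.
  by rewrite ltr_pM2l // ltNge al.
apply: ler_sum => a _; rewrite ler_wpM2l ?pmf_ge0 //.
by apply: ltW; rewrite ltNge al.
Qed.

Context {n : nat} {Xa Ya : 'I_n.+2 -> finType}.
Context (ch : {dffun forall i, Xa i} -> {dffun forall i, Ya i} -> R) (chP : is_channel ch).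

(** Node i supplies a whole input vector, of which coordinate i is used. This gives all nodes one
    input type, as the tags in [obs0] do for the outputs. *)
Definition W0 (a : {ffun 'I_n.+2 -> {dffun forall i, Xa i}}) (y : {dffun forall i, Ya i}) : R :=
  ch (finfun (fun i => a i i) : {dffun forall i, Xa i}) y.

Definition obs0 (i : 'I_n.+2) (y : {dffun forall i, Ya i}) : {i & Ya i} := Tagged Ya (y i).

Lemma pmf_W0 a : pmf (W0 a). Proof. by have [h1 h2] := chP (finfun (fun i => a i i)); split. Qed.

(** Some seed does no worse than the average for the error averaged over messages. Causality holds
    because [st] receives only the first t outputs. *)
Lemma pccode_det (Mw T : nat) eps : (0 < Mw)%N ->
  pccode W0 obs0 ord0 ord_max 'I_Mw T eps ->
  exists (f : forall i : 'I_n.+2, 'I_Mw -> 'I_T -> ('I_T -> Ya i) -> Xa i)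
         (dec : ('I_T -> Ya ord_max) -> 'I_Mw),
    causal_code f /\ code_error ch f dec <= eps.
Proof.
move=> Mw0 [Sd [nu [st [dec [hnu hst herr]]]]].
pose hl (i : 'I_n.+2) (h : 'I_T -> Ya i) := [seq Tagged Ya (h s) | s <- enum 'I_T].
pose ff sd (i : 'I_n.+2) (w : 'I_Mw) (t : 'I_T) (h : 'I_T -> Ya i) : Xa i :=
  st sd i w (take t (hl i h)) i.
pose dd sd (h : 'I_T -> Ya ord_max) : 'I_Mw := dec sd (hl ord_max h).
pose err sd m := run W0 T (fun h => [ffun i => st sd i m (map (obs0 i) h)])
                          (fun h => (dec sd (map (obs0 ord_max) h) != m)%:R).
have M0 : 0 < Mw%:R :> R by rewrite ltr0n.
have eqe sd : code_error ch (ff sd) (dd sd) = Mw%:R^-1 * \sum_m err sd m.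
  rewrite /code_error; congr (_ * _); apply: eq_bigr => m _.
  rewrite /err run_ffun big_mkcond; apply: eq_bigr => ys _.
  have eh i : hl i (fun t => ys t i) = map (obs0 i) (flist ys).
    by rewrite /flist -map_comp.
  rewrite /dd eh; case: (_ != m); rewrite ?mulr0 ?mulr1 //.
  apply: eq_bigr => t _; rewrite /W0; congr (ch _ _); apply/ffunP => i; rewrite !ffunE.
  by rewrite /ff eh map_take.
have [sd hsd] : exists sd, code_error ch (ff sd) (dd sd) <= eps.
  apply: (Ex_exists_le hnu); under eq_Ex do rewrite eqe.
  rewrite ExZ Ex_sum ler_pdivrMl //.
  apply: (le_trans (ler_sum _ (fun m _ => herr m))).
  by rewrite sumr_const card_ord mulr_natl.
exists (ff sd), (dd sd); split=> // i ni w w' t h h' hh; rewrite /ff.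
have -> : take t (hl i h) = take t (hl i h').
  rewrite /hl -[LHS]map_take -[RHS]map_take; apply/eq_in_map => s hs; rewrite hh //.
  have : val s \in take t (map val (enum 'I_T)) by rewrite -map_take; exact: (@map_f _ _ val _ s hs).
  by rewrite val_enum_ord take_iota mem_iota /=; have := ltn_ord t; lia.
by rewrite (hst sd i w w').
Qed.

(** The power 2^(T rate) lies in (0, 1], so its ceiling is 1, and a single message is decoded
    without error. *)
Lemma achievable_npos (rate : R) (x0 : {dffun forall i, Xa i}) : rate <= 0 -> achievable ch rate.
Proof.
move=> hr eps eps0; exists 0%N => T _.
exists 1%N, (fun i _ _ _ => x0 i), (fun _ => ord0); split; last first.
  split; first by [].
  rewrite /code_error big1 ?mulr0; first exact: ltW.
  by move=> w _; apply: big1 => ys; rewrite (ord1 w).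
apply/esym/eqP; rewrite ceil_eq //; apply/andP; split; first by rewrite (_ : (_%:~R : R) = 0) ?powR_gt0 ?ltr0n.
rewrite (_ : (_%:~R : R) = 1) // /powR gt_eqF ?ltr0n // -[leRHS]expR0 ler_expR.
apply: mulr_le0_ge0; first by apply: mulr_ge0_le0; rewrite ?ler0n.
by apply: ln_ge0; rewrite ler1n.
Qed.

Lemma achievable_of (rate Rt : R) (tt K : nat) (x0 : {dffun forall i, Xa i}) :
  (0 < tt)%N -> 0 < rate -> tt%:R * rate * ln 2 < Rt ->
  (forall eps : R, 0 < eps -> forall B : nat, (0 < B)%N ->
     exists N0 : nat, forall N : nat, (N0 <= N)%N -> forall (M : finType) (m0 : M),
     ln #|M|%:R <= N%:R * Rt ->
     pccode W0 obs0 ord0 ord_max {ffun 'I_B -> M} ((B + K) * N * tt) eps) ->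
  achievable ch rate.
Proof.
move=> t0 r0 hR H eps eps0.
have l2 : 0 < ln 2 :> R by rewrite ln_gt0 // ltr1n.
pose c := tt%:R * rate * ln 2.
have c0 : 0 < c by rewrite !mulr_gt0 // ltr0n.
have Rt0 : 0 < Rt by exact: lt_trans hR.
have g0 : 0 < Rt - c by rewrite subr_gt0.
(* B is so large that the K additional rounds do not use up the margin: (B + K) c < B Rt. *)
pose B := (Num.bound (K%:R * c / (Rt - c))).+1.
have hB : K%:R * c < B%:R * (Rt - c).
  rewrite -ltr_pdivrMr // /B; apply: (lt_le_trans (archi_boundP _)); last by rewrite ler_nat.
  by rewrite divr_ge0 ?mulr_ge0 ?ler0n // ltW.
pose D := B%:R * Rt - (B + K)%:R * c.
have D0 : 0 < D by rewrite /D natrD; lra.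
have [N0 hN] := H eps eps0 B isT.
(* N D has to absorb an unfinished period, worth (B + K) c, a factor 2 for the ceiling of the
   message count, and a factor 2 for rounding down each of the B alphabets. *)
pose N1 := maxn N0 (Num.bound (((B + K)%:R * c + B.+1%:R * ln 2) / D)).
exists ((B + K) * N1 * tt)%N => T hT.
pose q := ((B + K) * tt)%N; have q0 : (0 < q)%N by rewrite muln_gt0 t0 andbT addn_gt0.
pose N := (T %/ q)%N.
have hN1 : (N1 <= N)%N by rewrite /N leq_divRL //; rewrite /q; nia.
have N0N : (N0 <= N)%N by apply: leq_trans hN1; exact: leq_maxl.
have hD : (B + K)%:R * c + B.+1%:R * ln 2 <= N%:R * D.
  rewrite -ler_pdivrMr //; apply: (le_trans (ltW (archi_boundP _))).
    by rewrite divr_ge0 ?(ltW D0) // addr_ge0 // mulr_ge0 ?ler0n // ltW.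
  by rewrite ler_nat; apply: leq_trans hN1; exact: leq_maxr.
have hTN : T%:R * rate * ln 2 <= N.+1%:R * ((B + K)%:R * c).
  have : (T <= N.+1 * q)%N by rewrite ltnW // ltn_ceil.
  rewrite -(ler_nat R) !natrM => h.
  have rl : 0 <= rate * ln 2 by rewrite mulr_ge0 // ltW.
  rewrite -mulrA; apply: (le_trans (ler_wpM2r rl h)).
  by rewrite /c le_eqVlt; apply/orP; left; apply/eqP; ring.
pose x : R := powR 2 (T%:R * rate).
have xE : x = expR (T%:R * rate * ln 2) by rewrite /x /powR gt_eqF.
have x1 : 1 <= x.
  rewrite xE -[leLHS]expR0 ler_expR !mulr_ge0 ?ler0n // ltW //.
pose Mw := `|Num.ceil x|%N.
have xm1 : -1 < x by apply: lt_le_trans x1; lra.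
have cx : (Mw : int) = Num.ceil x by rewrite /Mw gez0_abs // ceil_ge0.
have Mw0 : (0 < Mw)%N.
  have : (0 < (Mw : int))%R by rewrite cx ceil_gt0; apply: lt_le_trans x1.
  by [].
have Mwx : Mw%:R <= 2 * x.
  have := ceilB1_lt x; rewrite -cx intrB (_ : (_ Mw)%:~R = Mw%:R :> R) // => h.
  by move: h x1; rewrite (_ : 1%:~R = 1 :> R) //; lra.
pose Wd := (Num.truncn (expR (N%:R * Rt))).
have e1 : 1 <= expR (N%:R * Rt) by rewrite -[leLHS]expR0 ler_expR mulr_ge0 ?ler0n // ltW.
have /andP[Wd1 Wd2] := truncn_itv (expR_ge0 (N%:R * Rt)).
have Wd0 : (0 < Wd)%N by rewrite truncn_ge_nat // expR_ge0.
have hWd : expR (N%:R * Rt - ln 2) <= Wd%:R.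
  rewrite expRB lnK ?posrE // ler_pdivrMr //.
  have : (1 : R) <= Wd%:R by rewrite ler1n.
  move: Wd2; rewrite -/Wd -natr1; lra.
have pc : pccode W0 obs0 ord0 ord_max {ffun 'I_B -> 'I_Wd} ((B + K) * N * tt) eps.
  apply: hN => //; first exact: (Ordinal Wd0).
  by rewrite card_ord -[leRHS]expRK ler_ln ?posrE ?expR_gt0 // ltr0n.
have hM : (Mw <= #|{ffun 'I_B -> 'I_Wd}|)%N.
  rewrite card_ffun !card_ord -(ler_nat R) natrX.
  apply: (le_trans Mwx); apply: (@le_trans _ _ (expR (N%:R * Rt - ln 2) ^+ B)); last first.
    by rewrite lerXn2r ?nnegrE ?expR_ge0 ?ler0n.
  rewrite -expRM_natl xE -{1}[2](lnK (x := 2 : R)) ?posrE // -expRD ler_expR.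
  move: hD hTN; rewrite /D -!natr1; nra.
have hT' : T = ((B + K) * N * tt + (T - (B + K) * N * tt))%N.
  apply/esym/subnKC; apply: (@leq_trans (N * q)%N); last exact: leq_divM.
  by rewrite leq_eqVlt; apply/orP; left; apply/eqP; rewrite /q mulnA (mulnC N).
have pc' : pccode W0 obs0 ord0 ord_max 'I_Mw T eps.
  apply: (pccode_sub pmf_W0 (Msg := {ffun 'I_B -> 'I_Wd})); rewrite ?card_ord //.
  by rewrite hT'; apply: pccode_pad => //; exact: pmf_W0.
have [f [dec hf]] := pccode_det Mw0 pc'.
by exists Mw, f, dec; split.
Qed.

End Derandomize.

Lemma ent_vres_prd {R : realType} (I A : finType) (q : I -> A -> R) (C : {set I}) :
  (forall j, pmf (q j)) -> ent (prd q) (vres C (fun i (f : {ffun I -> A}) => f i)) = \sum_(j in C) ent (q j) id.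
Proof.
move=> hq; rewrite [RHS]big_mkcond /=.
rewrite (ent_prd (fun (j : I) v => if j \in C then Some v else None) hq); apply: eq_bigr => j _.
case: ifP => _; last exact: ent_cst.
by apply: ent_eq => // v v' _ _; [move=> ->|case].
Qed.

(** * Decode-and-forward over whole compress-and-forward runs *)

Section SuperLetter.
Context {R : realType} {I U O1 Ob : finType} (K : nat) (pi : 'I_K.+1 -> I) (pinj : injective pi).
Context (p : I -> U -> R) (hp : forall i, pmf (p i)).
Context (kp : {ffun I -> U} -> O1 -> R) (hkp : forall u, pmf (kp u)).
Context (W1 : {ffun I -> {ffun I -> U}} -> O1 -> R) (hW1 : forall a, pmf (W1 a)).
Context (obs : I -> O1 -> Ob).

(** Layers are indexed by the transmitting nodes, which are all values of [pi] except the last, the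
    destination. *)
Definition wpi (j : 'I_K) : I := pi (widen_ord (leqnSn K) j).
Definition tx : {set I} := [set wpi j | j : 'I_K].

Context (hcoh : forall (a : {ffun I -> {ffun I -> U}}) (u : {ffun I -> U}),
  (forall i, i \notin tx -> a i i = u i) ->
  (forall j j' : 'I_K, (j <= j')%N -> a (wpi j) (wpi j') = u (wpi j')) -> W1 a =1 kp u).
Context (u0 : U) (ob0 : Ob) (o0 : O1).

Lemma wpi_inj : injective wpi.
Proof. by move=> j j' /pinj /(congr1 val) /= h; exact: val_inj. Qed.

Definition mix (c : {ffun 'I_K -> U}) (x : I -> U) : {ffun I -> U} :=
  [ffun i => if [pick j | wpi j == i] is Some j then c j else x i].

Lemma mix_in c x j : mix c x (wpi j) = c j.
Proof.
rewrite ffunE; case: pickP => [j' /eqP /wpi_inj -> //|/(_ j)].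
by rewrite eqxx.
Qed.

Lemma mix_out c x i : i \notin tx -> mix c x i = x i.
Proof.
move=> h; rewrite ffunE; case: pickP => // j /eqP e.
by case/negP: h; rewrite -e; exact: imset_f.
Qed.

Definition col (u : {ffun I -> U}) : {ffun 'I_K -> U} := [ffun j => u (wpi j)].

Lemma merge_mix (x u : {ffun I -> U}) : merge (mem (~: tx)) x u = mix (col u) x.
Proof.
apply/ffunP => i; rewrite [LHS]ffunE /= inE; case: (boolP (i \in tx)) => [/imsetP[j _ ->]|h] /=.
  by rewrite mix_in ffunE.
by rewrite mix_out.
Qed.

Local Notation kcN := (kc p kp (~: tx)).
Local Notation A1' := (@A1 I U O1).

Definition pK (c : {ffun 'I_K -> U}) : R := prd (fun j => p (wpi j)) c.

(** The letters of the nodes in [tx] are fresh at each time and independent of the feedback, so they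
    can be drawn for all times in advance. *)
Lemma run_mix t (s' : seq O1 -> {ffun I -> U}) (Phi : seq {ffun 'I_K -> U} -> seq O1 -> R) c0 :
  run kcN t (fun h => s' (map snd h)) (fun h => Phi [seq col a.1 | a <- h] (map snd h)) =
  Ex (prd (fun _ : 'I_t => pK)) (fun v =>
    run kp t (fun os => mix (nth c0 (flist v) (size os)) (s' os)) (fun os => Phi (flist v) os)).
Proof.
elim: t s' Phi => [|t IH] s' Phi.
  have f0 : {ffun 'I_0 -> {ffun 'I_K -> U}} by apply: finfun => -[].
  by rewrite (Ex_prd_nil _ _ f0) flist_nil.
rewrite Ex_prd_recl /= Ex_kc.
have -> : Ex pK = Ex (prd (fun j => p (wpi j))) by [].
rewrite -[RHS](Ex_prd_inj (p := p) (e := wpi)) //; last exact: wpi_inj.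
apply: eq_Ex => u' _; rewrite merge_mix -/(col u').
transitivity (Ex (kp (mix (col u') (s' [::]))) (fun o => Ex (prd (fun _ : 'I_t => pK)) (fun v =>
  run kp t (fun os => mix (nth c0 (flist v) (size os)) (s' (o :: os))) (fun os => Phi (col u' :: flist v) (o :: os))))).
  apply: eq_Ex => o _; rewrite -(IH (fun os => s' (o :: os)) (fun cs os => Phi (col u' :: cs) (o :: os))).
  apply: eq_run => // h _ /=; congr (Phi (_ :: _)).
  by apply/ffunP => j; rewrite [LHS]ffunE mix_in.
rewrite Ex_swap; apply: eq_Ex => v _; rewrite flist_cons /=.
by apply: eq_Ex.
Qed.

Section Level.
Local Notation level := (@level R I U Ob).
Context (L : level) (hL : forall i, pmf (@lnu R I U Ob L i)) (Tn : I -> {set I}).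
Let t := lt L.
Definition UL : finType := {ffun 'I_t -> U}.
Definition O2 : finType := ({ffun I -> lSd L} * t.-tuple O1)%type.
Definition Ob2 : finType := ({ffun I -> option (lSd L)} * t.-tuple Ob)%type.

Definition loc2 (f : {ffun I -> lSd L}) (i : I) (a : {ffun 'I_K -> UL}) (h : seq Ob) : {ffun I -> U} :=
  mix [ffun j => oapp (a j) u0 (insub (size h))] (fun=> lsig i (f i) h).

(** One use is a complete run of [L] in which the layers prescribe the letters at [tx]. The seeds
    are part of the output, and [obs2] discloses to node i those of [Tn i]. *)
Definition W2 (a : {ffun I -> {ffun 'I_K -> UL}}) : O2 -> R :=
  jn (prd (@lnu R I U Ob L)) (fun f (os : t.-tuple O1) =>
    lik W1 (fun h => [ffun i => loc2 f i (a i) (map (obs i) h)]) os).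

Definition fT (C : {set I}) (f : {ffun I -> lSd L}) : {ffun I -> option (lSd L)} :=
  [ffun i => if i \in C then Some (f i) else None].

Definition obs2 (i : I) (o : O2) : Ob2 := (fT (Tn i) o.1, [tuple of map (obs i) o.2]).

Lemma pmf_W2 a : pmf (W2 a).
Proof. by apply: pmf_jn => [|f]; [exact: pmf_prd|exact: pmf_lik]. Qed.

Lemma impl_W2 : impl W1 obs W2 obs2 t.
Proof.
exists {ffun I -> lSd L}, (prd (@lnu R I U Ob L)), loc2,
  (fun f _ os => (f, insubd (nseq_tuple t o0) os)),
  (fun f i _ h => (fT (Tn i) f, insubd (nseq_tuple t ob0) h)).
split.
- exact: pmf_prd.
- move=> f a os i hs; congr (_, _); apply: val_inj => /=.
  by rewrite !val_insubd /= ?size_map hs eqxx.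
move=> a phi; rewrite Ex_jn; apply: eq_Ex => f _; rewrite run_lik; apply: eq_Ex => os _.
by congr (phi (_, _)); apply: val_inj; rewrite val_insubd size_tuple eqxx.
Qed.

Definition supin (u : {ffun 'I_K -> UL}) (f : {ffun I -> lSd L}) (h : seq O1) : {ffun I -> U} :=
  mix [ffun j => oapp (u j) u0 (insub (size h))] (fun i => lsig i (f i) (map (obs i) h)).

Lemma lik_supin (a : {ffun I -> {ffun 'I_K -> UL}}) (u : {ffun 'I_K -> UL}) f os :
  (forall j j' : 'I_K, (j <= j')%N -> a (wpi j) j' = u j') ->
  lik W1 (fun h => [ffun i => loc2 f i (a i) (map (obs i) h)]) os = lik kp (supin u f) os.
Proof.
move=> h; apply: lik_eq => b _; apply: hcoh => [i hi|j j' hj].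
  by rewrite ffunE /loc2 /supin !mix_out.
by rewrite ffunE /loc2 /supin !mix_in !ffunE size_map h.
Qed.

Lemma W2_coh (a : {ffun I -> {ffun 'I_K -> UL}}) (u : {ffun 'I_K -> UL}) :
  (forall j j' : 'I_K, (j <= j')%N -> a (wpi j) j' = u j') -> W2 a =1 W2 [ffun=> u].
Proof.
by move=> h [f os]; rewrite /W2 /jn /=; congr (_ * _); rewrite (lik_supin _ _ h) (@lik_supin _ u) // => j j' _; rewrite ffunE.
Qed.

Definition pL (j : 'I_K) : UL -> R := prd (fun _ : 'I_t => p (wpi j)).
Lemma pmf_pL j : pmf (pL j). Proof. exact: pmf_prd. Qed.

Local Notation dL := (dfl pL (fun u => W2 [ffun=> u])).
Local Notation lL := (@llaw R I U O1 Ob p kp obs (~: tx) L).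

Lemma dfl_llaw (a0 : A1') (Phi : {ffun 'I_K -> UL} -> {ffun I -> lSd L} -> seq O1 -> R) :
  Ex dL (fun w => Phi w.1 w.2.1 w.2.2) =
  Ex lL (fun w => Phi [ffun j => [ffun c : 'I_t => (nth a0 w.2 c).1 (wpi j)]] w.1 (map snd w.2)).
Proof.
rewrite /dfl /letterlaw /llaw /runlaw !Ex_jn.
transitivity (Ex (prd (@lnu R I U Ob L)) (fun f => Ex (prd pL) (fun u => run kp t (supin u f) (Phi u f)))).
  rewrite Ex_swap; apply: eq_Ex => u _; rewrite /W2 Ex_jn; apply: eq_Ex => f _.
  rewrite run_lik; apply: eq_bigr => os _ /=; congr (_ * _).
  by rewrite (@lik_supin _ u) // => j j' _; rewrite ffunE.
apply: eq_Ex => f _.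
pose c0 : {ffun 'I_K -> U} := [ffun=> u0].
pose P' cs os := Phi [ffun j => [ffun c : 'I_t => (nth c0 cs c : {ffun 'I_K -> U}) j]] f os.
transitivity (Ex (prd (fun _ : 'I_t => pK)) (fun v =>
    run kp t (fun os => mix (nth c0 (flist v) (size os)) [ffun i => lsig i (f i) (map (obs i) os)])
      (fun os => P' (flist v) os))).
  transitivity (Ex (prd (fun _ : 'I_t => pK)) (fun v : {ffun 'I_t -> {ffun 'I_K -> U}} =>
     run kp t (supin [ffun j => [ffun c => v c j]] f) (Phi [ffun j => [ffun c => v c j]] f))).
    exact: (Ex_prd_transpose (fun j => p (wpi j)) (fun u => run kp t (supin u f) (Phi u f))).
  apply: eq_Ex => v _; apply: eq_run => [os hs|os _].
    rewrite /supin; have -> : nth c0 (flist v) (size os) = v (Ordinal hs) by exact: (nth_flist v c0 (Ordinal hs)).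
    apply/ffunP => i; rewrite !ffunE; case: pickP => // j _.
    rewrite (insubT (fun c => c < t)%N hs) /= !ffunE. by congr (v _ _); exact: val_inj.
  rewrite /P'; congr (Phi _ _ _); apply/ffunP => j; rewrite !ffunE; apply/ffunP => c; rewrite !ffunE.
  by rewrite nth_flist.
rewrite -run_mix; transitivity (run kcN t (lstrat obs f) (fun h =>
  Phi [ffun j => [ffun c : 'I_t => (nth a0 h c).1 (wpi j)]] f (map snd h))); last by rewrite run_lik.
apply: eq_run => h hs.
  apply/ffunP => i; rewrite !ffunE /lhist; congr (lsig _ _ _).
  by elim: h {hs} => //= a h ->.
rewrite /P'; congr (Phi _ _ _); apply/ffunP => j; rewrite !ffunE; apply/ffunP => c; rewrite !ffunE.
by rewrite (nth_map a0) ?hs // ffunE.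
Qed.

Definition zk (k : 'I_K.+1) (j : nat) (a : A1') : {ffun 'I_K -> option U} * Ob :=
  (xres (ge K j) (col a.1), obs (pi k) a.2).

(** Conditioning on independent layers is subtracting their known entropy from a joint entropy, and
    that joint law is the law of a run of the level with its letters recorded. The entropy of the
    seeds cancels in differences. *)
Lemma Hk_level (k : 'I_K.+1) j : Hk pi pL (fun u => W2 [ffun=> u]) obs2 k j =
  cent lL (fun w => [seq zk k j a | a <- w.2]) (fun w => fT (Tn (pi k)) w.1) +
  ent lL (fun w => fT (Tn (pi k)) w.1) - t%:R * \sum_(j' in ge K j) ent (p (wpi j')) id.
Proof.
pose a0 : A1' := ([ffun=> u0], o0).
have hd : pmf dL by apply: pmf_letterlaw => [j'|u]; [exact: pmf_pL|exact: pmf_W2].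
have hl : pmf lL by apply: pmf_llaw.
rewrite [in RHS]/cent subrK /Hk /cent; congr (_ - _); last first.
  rewrite (@ent_fst _ _ _ (prd pL) (fun u => W2 [ffun=> u])) => [|u]; last exact: pmf_W2.
  rewrite (ent_vres_prd _ pmf_pL) mulr_sumr; apply: eq_bigr => j' _.
  transitivity (ent (prd (fun _ : 'I_t => p (wpi j'))) (fun f : {ffun 'I_t -> U} => [ffun c => id (f c)])).
    have hj := pmf_pL j'.
    by apply: ent_eq => // v v' _ _; [move/ffunP => e; apply/ffunP => c; have := e c; rewrite !ffunE|move=> ->].
  by rewrite (ent_prd (fun _ => id)) ?sumr_const ?card_ord ?mulr_natl.
pose Phi (u : {ffun 'I_K -> UL}) f (os : seq O1) := (fT (Tn (pi k)) f, map (obs (pi k)) os, xres (ge K j) u).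
transitivity (ent dL (fun w => Phi w.1 w.2.1 w.2.2)).
  apply: ent_eq => // w w' _ _; rewrite /obs2 /Phi; last by case=> -> -> ->.
  by case=> -> e ->; congr (_, _, _); exact: val_inj.
transitivity (ent lL (fun w => Phi [ffun j => [ffun c : 'I_t => (nth a0 w.2 c).1 (wpi j)]] w.1 (map snd w.2))).
  by apply: samelaw_ent => phi; rewrite -(dfl_llaw a0 (fun u f os => phi (Phi u f os))).
apply: ent_eq => // -[f os] [f' os'] _ _; rewrite /Phi /=; case.
  move=> ez -> ; have en c : (c < t)%N -> zk k j (nth a0 os c) = zk k j (nth a0 os' c).
    move=> hc; have := congr1 (nth (zk k j a0) ^~ c) ez.
    by rewrite /= !(nth_map a0) ?size_tuple.
  congr (_, _, _).
    apply: (@eq_from_nth _ ob0); rewrite !size_map ?size_tuple // => c hc.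
    rewrite !(nth_map o0) ?size_map ?size_tuple // !(nth_map a0) ?size_tuple //.
    by have [_] := en c hc.
  apply/xresP => j' hj; rewrite !ffunE; apply/ffunP => c; rewrite !ffunE.
  have [/xresP /(_ j' hj)] := en c (ltn_ord c).
  by rewrite !ffunE.
move=> -> eo /xresP ex; congr (_, _).
apply: (@eq_from_nth _ (zk k j a0)); rewrite !size_map ?size_tuple // => c hc.
rewrite !(nth_map a0) ?size_tuple //; congr (_, _).
  apply/xresP => j' hj; have /ffunP /(_ (Ordinal hc)) := ex j' hj.
  by rewrite !ffunE.
have := congr1 (nth ob0 ^~ c) eo.
by rewrite /= !(nth_map o0) ?size_map ?size_tuple // !(nth_map a0) ?size_tuple.
Qed.

End Level.

Context {Yh : finType} (yq : I -> U -> Ob -> Yh) (Tk : 'I_K.+1 -> {set I}).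
Context (TkN : forall k, Tk k \subset ~: tx) (K0 : (0 < K)%N).
Local Notation Al := (Alaw p kp).

Theorem superletter_rate (rho Rt : R) : Rt < rho ->
  (forall (k : 'I_K.+1) (C : {set I}), (0 < k)%N -> C \subset Tk k ->
    rho + cent Al (Wf obs yq (zk k 0) (Tk k)) (vres (Tk k) (@aU I U O1)) <=
    ent Al (Wf obs yq (zk k k) C) - ent Al (vres C (@aU I U O1)) +
    \sum_(j < K | (j < k)%N) ent (p (wpi j)) id) ->
  exists2 t : nat, (0 < t)%N & forall (eps : R) (B : nat), 0 < eps -> (0 < B)%N ->
    exists N0 : nat, forall N : nat, (N0 <= N)%N -> forall (M : finType) (m0 : M),
    ln #|M|%:R <= N%:R * (t%:R * Rt) ->
    pccode W1 obs (pi ord0) (pi ord_max) {ffun 'I_B -> M} ((B + K) * N * t) eps.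
Proof.
move=> hR H; have hA := pmf_Alaw hp hkp.
pose ph k := cent Al (Wf obs yq (zk k 0) (Tk k)) (vres (Tk k) (@aU I U O1)).
pose sg (k : 'I_K.+1) := \sum_(j < K | (j < k)%N) ent (p (wpi j)) id.
(* Chosen so that m - ph + sg = rho: the layers below k are recorded in [zk k 0] but not in
   [zk k k], and [Hk_level] gives their entropy [sg] back. At k = 0 nothing is decoded, and a crude
   lower bound suffices. *)
pose m (k : 'I_K.+1) := if (0 < k)%N then rho + ph k - sg k
  else - \sum_(C : {set I}) ent Al (vres C (@aU I U O1)).
have [|||L [t0 hL gap]] := @levels_gap R I U O1 Ob Yh _ 'I_K.+1 p hp kp hkp obs yq u0 ob0 (~: tx) Tk TkN
  (fun k => zk k k) (fun k => zk k 0) m ph _ _ ((rho - Rt) / 2).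
- move=> k C hC; rewrite /m; case: ifP => k0; first by have := H k C k0 hC; rewrite /ph /sg; lra.
  have : ent Al (vres C (@aU I U O1)) <= \sum_(C : {set I}) ent Al (vres C (@aU I U O1)).
    by rewrite [leRHS](bigD1 C) //= lerDl sumr_ge0 // => C' _; exact: ent_ge0.
  have := ent_ge0 hA (Wf obs yq (zk k k) C); lra.
- by move=> k.
- by rewrite divr_gt0 // subr_gt0.
exists (lt L) => // eps B eps0 B0.
pose Tn i := if [pick k | pi k == i] is Some k then Tk k else set0.
have TnE k : Tn (pi k) = Tk k.
  by rewrite /Tn; case: pickP => [k' /eqP /pinj -> //|/(_ k)]; rewrite eqxx.
pose ob2 : Ob2 L := ([ffun=> None], nseq_tuple (lt L) ob0).
pose ul : UL L := [ffun=> u0].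
have [|N0 hN] := @df_rate R I (UL L) (O2 L) (Ob2 L) K pi pinj (pL (L := L)) (pmf_pL L) (fun u => W2 (L := L) [ffun=> u])
  (fun u => pmf_W2 hL _) (W2 (L := L)) (pmf_W2 hL) (obs2 Tn) (W2_coh (L := L)) ((lt L)%:R * Rt) eps B ul ob2 K0 B0 eps0.
  move=> k k0; rewrite !Hk_level // TnE.
  have := gap k; rewrite /m k0 -/(ph k) => hg.
  have t0' : 0 < (lt L)%:R :> R by rewrite ltr0n.
  have e0 : \sum_(j in ge K 0) ent (p (wpi j)) id = \sum_(j in ge K k) ent (p (wpi j)) id + sg k.
    rewrite (bigID (fun j => j \in ge K k)) /=; congr (_ + _); apply: eq_bigl => j; rewrite !inE //= -ltnNge //.
  have : (lt L)%:R * Rt < (lt L)%:R * (rho + ph k - sg k - ph k - (rho - Rt) / 2 + sg k).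
    by rewrite ltr_pM2l //; lra.
  rewrite mulrDr => h; apply: (lt_le_trans h); rewrite e0 mulrDr.
  have eS : (fun w : @lOm R I U O1 Ob L => fT (Tk k) w.1) = @lseed R I U O1 Ob (Tk k) L by [].
  rewrite eS; move: hg.
  lra.
have [f0 _] := pmf_inhab (pmf_prd hL).
exists N0 => N hNN M m0 hM.
have nd : pi ord_max != pi ord0 by apply/eqP => /pinj /(congr1 val) /= e; have := K0; rewrite e.
apply: (pccode_impl [ffun=> u0] (impl_W2 hL Tn) nd).
have I2 : impl (W2 (L := L)) (obs2 Tn) (powW (W2 (L := L)) (N := N)) (powobs (obs2 Tn) (N := N)) N.
  pose enc (s : unit) (i : I) (a : {ffun 'I_K -> {ffun 'I_N -> UL L}}) r : {ffun 'I_K -> UL L} := [ffun j => a j r].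
  pose oo : O2 L := (f0, nseq_tuple _ o0).
  apply: (@impl_open R I _ _ _ _ _ _ (W2 (L := L)) (obs2 Tn) (powW (W2 (L := L)) (N := N)) (powobs (obs2 Tn) (N := N))
    unit (fun=> 1) N enc (fun _ y => y) (fun _ y => y) [ffun=> ul] oo) => //.
    by split=> [a|]; [exact: ler01|rewrite (big_pred1 tt) // => -[]].
  by move=> a phi; rewrite [RHS]/Ex (big_pred1 tt) ?mul1r // => -[].
apply: (pccode_impl [ffun=> ul] I2 nd).
exact: hN.
Qed.

End SuperLetter.

(** * Dithered quantization *)

Section Resample.
Context {R : realType} {V : finType} (p r : V -> R) (hp : pmf p) (hr : pmf r).
Context (K : nat) (M d : R) (K0 : (0 < K)%N) (M0 : 0 < M) (d0 : 0 < d) (hK : M <= d ^+ 2 * K%:R).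

(** Truncation at [M] bounds the variance of a weight by [M]. The maximum with [K] in [wnorm] keeps
    the mean of [rs0] below [r], so that the residual [rsres] is nonnegative. *)
Definition wt (v : V) : R := Num.min (r v / p v) M.
Definition wsum (D : {ffun 'I_K -> V}) : R := \sum_l wt (D l).
Definition wnorm (D : {ffun 'I_K -> V}) : R := Num.max K%:R (wsum D).
Definition rs0 (D : {ffun 'I_K -> V}) (v : V) : R := \sum_l (D l == v)%:R * wt (D l) / wnorm D.
Definition rskeep (D : {ffun 'I_K -> V}) : R := wsum D / wnorm D.
Local Notation pD := (prd (fun _ : 'I_K => p)).
Definition rsfail : R := 1 - Ex pD rskeep.
Definition rsres (v : V) : R := r v - Ex pD (rs0^~ v).

(* Importance resampling among the proposals [D], completed so that the output law is exactly [r]. *)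
Definition rsk (D : {ffun 'I_K -> V}) (v : V) : R :=
  rs0 D v + (1 - rskeep D) * (if rsfail == 0 then r v else rsres v / rsfail).

Let K0' : 0 < K%:R :> R. Proof. by rewrite ltr0n. Qed.
Let hpD : pmf pD. Proof. exact: pmf_prd. Qed.

Lemma wt_ge0 v : 0 <= wt v.
Proof. by rewrite le_min (ltW M0) divr_ge0 ?pmf_ge0. Qed.

Lemma wt_leM v : wt v <= M. Proof. by rewrite ge_min lexx orbT. Qed.

Lemma p_wt v : p v * wt v <= r v.
Proof.
case: (eqVneq (p v) 0) => [->|pn]; first by rewrite mul0r pmf_ge0.
have pv : 0 < p v by rewrite lt0r pn pmf_ge0.
by rewrite mulrC -ler_pdivlMr // ge_min lexx.
Qed.

Lemma wnorm_gt0 D : 0 < wnorm D. Proof. by rewrite lt_max K0'. Qed.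

Lemma rskeep_le1 D : rskeep D <= 1.
Proof. by rewrite ler_pdivrMr ?wnorm_gt0 // mul1r le_max lexx orbT. Qed.

Lemma rs0_ge0 D v : 0 <= rs0 D v.
Proof. by apply: sumr_ge0 => l _; rewrite divr_ge0 ?mulr_ge0 ?wt_ge0 // ltW ?wnorm_gt0. Qed.

Lemma sum_rs0 D : \sum_v rs0 D v = rskeep D.
Proof.
rewrite exchange_big /rskeep /wsum mulr_suml; apply: eq_bigr => l _.
rewrite (bigD1 (D l)) //= eqxx mul1r big1 ?addr0 // => v nv.
by rewrite eq_sym (negbTE nv) !mul0r.
Qed.

Lemma Ex_rs0 v : Ex pD (rs0^~ v) <= r v.
Proof.
apply: (@le_trans _ _ (Ex pD (fun D => \sum_l (D l == v)%:R * wt (D l) / K%:R))).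
  apply: ler_Ex => [D|D _]; first exact: pmf_ge0 hpD.
  apply: ler_sum => l _; rewrite ler_wpM2l ?mulr_ge0 ?wt_ge0 //.
  by rewrite lef_pV2 ?posrE ?wnorm_gt0 // le_max lexx.
rewrite (Ex_prd_sum (fun _ u => (u == v)%:R * wt u / K%:R)) // sumr_const card_ord.
have -> : Ex p (fun u => (u == v)%:R * wt u / K%:R) = p v * wt v / K%:R.
  rewrite /Ex (bigD1 v) //= eqxx big1 ?addr0 ?mul1r ?mulrA // => u nu.
  by rewrite (negbTE nu) !mul0r mulr0.
by rewrite -[_ *+ K]mulr_natr divfK ?gt_eqF // p_wt.
Qed.

Lemma rsres_ge0 v : 0 <= rsres v. Proof. by rewrite subr_ge0 Ex_rs0. Qed.

Lemma sum_rsres : \sum_v rsres v = rsfail.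
Proof.
rewrite /rsres /rsfail sumrB (pmf_sum1 hr) -Ex_sum; congr (_ - _).
by apply: eq_Ex => D _; rewrite sum_rs0.
Qed.

Lemma rsfail_ge0 : 0 <= rsfail.
Proof. by rewrite -sum_rsres sumr_ge0 // => v _; exact: rsres_ge0. Qed.

Lemma pmf_rsk D : pmf (rsk D).
Proof.
have k0 : 0 <= 1 - rskeep D by rewrite subr_ge0 rskeep_le1.
split=> [v|].
  apply: addr_ge0; first exact: rs0_ge0.
  apply: mulr_ge0 => //; case: ifP => _; first exact: pmf_ge0.
  by rewrite divr_ge0 ?rsres_ge0 ?rsfail_ge0.
rewrite /rsk big_split /= sum_rs0 -mulr_sumr; set s := (X in _ * X).
have -> : s = 1 by rewrite /s; case: eqP => [_|/eqP h]; rewrite ?(pmf_sum1 hr) // -mulr_suml sum_rsres divff.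
by rewrite mulr1 addrC subrK.
Qed.

(** The missing mass has mean [rsfail], and the residual divided by it supplies what [rs0] lacks. If
    [rsfail] is 0 the residual vanishes. *)
Lemma Ex_rsk phi : Ex pD (fun D => Ex (rsk D) phi) = Ex r phi.
Proof.
rewrite /Ex; under eq_bigr do rewrite mulr_sumr.
rewrite exchange_big /=; apply: eq_bigr => v _.
rewrite (_ : \sum_i _ = Ex pD (fun D => rsk D v * phi v)); last by [].
rewrite ExZr; congr (_ * _); rewrite /rsk ExD ExZr ExB Ex_cst // -/rsfail.
case: eqP => [f0|/eqP fn]; last by rewrite mulrC divfK // /rsres addrC subrK.
rewrite f0 mul0r addr0; apply/eqP; rewrite eq_sym -subr_eq0 -/(rsres v).
have /psumr_eq0P h : \sum_v rsres v = 0 by rewrite sum_rsres.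
by rewrite h // => u _; exact: rsres_ge0.
Qed.

Lemma rs0_notin (D : {ffun 'I_K -> V}) v : v \notin codom D -> rs0 D v = 0.
Proof.
move=> h; apply: big1 => l _; case: eqP => [e|_]; last by rewrite !mul0r.
by case/negP: h; rewrite -e codom_f.
Qed.

Lemma rsk_notin : Ex pD (fun D : {ffun 'I_K -> V} => Ex (rsk D) (fun v => (v \notin codom D)%:R)) <= rsfail.
Proof.
have -> : rsfail = Ex pD (fun D => 1 - rskeep D) by rewrite ExB Ex_cst.
apply: ler_Ex => [D|D _]; first exact: pmf_ge0 hpD.
have k0 : 0 <= 1 - rskeep D by rewrite subr_ge0 rskeep_le1.
have [h0 h1] := pmf_rsk D.
apply: (@le_trans _ _ (\sum_v (rsk D v - rs0 D v))); last by rewrite sumrB h1 sum_rs0.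
apply: ler_sum => v _; case: (boolP (v \in codom D)) => h /=; last by rewrite mulr1 rs0_notin ?subr0.
rewrite mulr0 subr_ge0 /rsk lerDl mulr_ge0 //; case: ifP => _; first exact: pmf_ge0.
by rewrite divr_ge0 ?rsres_ge0 ?rsfail_ge0.
Qed.

(** Mass is missing when the total weight stays below K. Either its mean is too small, which is the
    effect of truncation, or it deviates from its mean, which costs at most d. *)
Lemma rsfail_le : rsfail <= d + \sum_v r v * (M * p v < r v)%R%:R.
Proof.
pose a := Ex p wt.
have a1 : 1 - a <= \sum_v r v * (M * p v < r v)%R%:R.
  rewrite -[X in X - a](pmf_sum1 hr) /a /Ex -sumrB; apply: ler_sum => v _; case: ltP => h.
    by rewrite mulr1 lerBlDr lerDl mulr_ge0 ?wt_ge0 ?pmf_ge0.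
  rewrite mulr0 subr_le0; case: (eqVneq (p v) 0) => [e|pn].
    by move: h; rewrite e mulr0 mul0r.
  have pv : 0 < p v by rewrite lt0r pn pmf_ge0.
  by rewrite mulrC -ler_pdivrMr // /wt le_min lexx ler_pdivrMr.
have a0 : a <= 1.
  by rewrite -(pmf_sum1 hr); apply: ler_sum => v _; exact: p_wt.
have ag : 0 <= a by apply: Ex_ge0 => [v|v _]; [exact: pmf_ge0|exact: wt_ge0].
have hvar : var p wt <= M.
  apply: (@le_trans _ _ (Ex p (fun v => wt v ^+ 2))).
    rewrite /var -/a (_ : Ex p _ = Ex p (fun v => wt v ^+ 2 - (a *+ 2 * wt v - a ^+ 2))).
      by rewrite ExB ExB ExZ Ex_cst // -/a; have := sqr_ge0 a; lra.
    by apply: eq_Ex => v _; ring.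
  apply: (@le_trans _ _ (Ex p (fun v => M * wt v))).
    apply: ler_Ex => [v|v _]; first exact: pmf_ge0.
    by rewrite expr2 ler_wpM2r ?wt_ge0 ?wt_leM.
  by rewrite ExZ -/a; have := M0; nra.
have hl := @lln_L1 R _ _ (fun _ : 'I_K => p) (fun _ => wt) M d (fun _ => hp) (fun _ => hvar) d0.
rewrite card_ord in hl; have {}hl := hl (fun _ => hK).
rewrite sumr_const card_ord -/a -[a *+ K]mulr_natl in hl.
have -> : rsfail = Ex pD (fun D => 1 - rskeep D) by rewrite ExB Ex_cst.
apply: (@le_trans _ _ (Ex pD (fun D => `|wsum D - K%:R * a| / K%:R + (1 - a)))).
  apply: ler_Ex => [D|D _]; first exact: pmf_ge0 hpD.
  rewrite /rskeep /wnorm; case: (leP K%:R (wsum D)) => h.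
    rewrite divff; last by rewrite gt_eqF // (lt_le_trans K0').
    by rewrite subrr; apply: addr_ge0; [apply: divr_ge0; [exact: normr_ge0|exact: ltW]|rewrite subr_ge0].
  rewrite -(ler_pM2l K0') !mulrDr mulrN !mulr1 [K%:R * (_ / _)]mulrC divfK ?gt_eqF //.
  rewrite [K%:R * (_ / _)]mulrC divfK ?gt_eqF //.
  have := ler_norm (K%:R * a - wsum D); rewrite distrC; lra.
rewrite ExD Ex_cst // ExZr; apply: lerD => //.
by rewrite ler_pdivrMr // mulrC; move: hl; rewrite mulrC.
Qed.

End Resample.

Lemma cent_gibbs {R : realType} {Om T1 T2 : finType} (P : Om -> R) (A : Om -> T1) (B : Om -> T2)
  (q : T1 -> T2 -> R) : pmf P -> (forall a b, 0 <= q a b) -> (forall b, \sum_a q a b <= 1) ->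
  (forall w, 0 < P w -> 0 < q (A w) (B w)) -> cent P A B <= Ex P (fun w => - ln (q (A w) (B w))).
Proof.
move=> hP q0 q1 qp; pose Q w := q (A w) (B w) * pr P B (B w).
have h : ent P (fun w => (A w, B w)) <= Ex P (fun w => - ln (Q w)).
  apply: ent_gibbs => // [w pw|]; first by rewrite mulr_gt0 ?qp ?pr_gt0.
  pose F (x : T1 * T2) := q x.1 x.2 * pr P B x.2 / pr P (fun w => (A w, B w)) x.
  have -> : Ex P (fun w => Q w / pr P (fun w => (A w, B w)) (A w, B w)) =
      Ex (pr P (fun w => (A w, B w))) F by rewrite Ex_push.
  apply: (@le_trans _ _ (\sum_(x : T1 * T2) q x.1 x.2 * pr P B x.2)).
    apply: ler_sum => x _; rewrite /F; set c := pr P _ x.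
    case: (eqVneq c 0) => [->|cn]; first by rewrite mul0r mulr_ge0 ?pr_ge0.
    by rewrite mulrC divfK.
  rewrite -(pair_bigA _ (fun a b => q a b * pr P B b)) /= exchange_big /=.
  rewrite -[leRHS](pmf_sum1 (pmf_push B hP)); apply: ler_sum => b _.
  by rewrite -mulr_suml ler_piMl ?pr_ge0.
rewrite /cent lerBlDr; apply: (le_trans h); rewrite /ent -ExD; apply: ler_Ex => [w|w pw]; first exact: pmf_ge0.
by rewrite /Q lnM ?posrE ?qp ?pr_gt0 // opprD.
Qed.

Section Quantizer.
Context {R : realType} {A Y V : finType} (p : A -> V -> R) (r : A -> Y -> V -> R).
Context (hp : forall a, pmf (p a)) (hr : forall a y, pmf (r a y)).
Context (K : nat) (M d : R) (K0 : (0 < K)%N) (M0 : 0 < M) (d0 : 0 < d) (hK : M <= d ^+ 2 * K%:R).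

(** The dither has two parts: proposals for every [a], and for every [a], [y] and list of proposals
    an outcome of the resampling drawn in advance. This makes [vq] deterministic. *)
Definition qD1 : finType := {ffun A * 'I_K -> V}.
Definition qD2 : finType := {ffun A * Y * qD1 -> V}.
Definition qprop (D : qD1) (a : A) : {ffun 'I_K -> V} := [ffun l => D (a, l)].
Definition qdit : qD1 * qD2 -> R :=
  jn (prd (fun k => p k.1)) (fun _ => prd (fun k => rsk (p k.1.1) (r k.1.1 k.1.2) M (qprop k.2 k.1.1))).
Definition vq (a : A) (y : Y) (D : qD1 * qD2) : V := D.2 (a, y, D.1).

Lemma pmf_qdit : pmf qdit.
Proof. by apply: pmf_jn => [|D]; apply: pmf_prd => k //; exact: pmf_rsk. Qed.

Lemma Ex_vq a y F : Ex qdit (fun D => F (qprop D.1 a) (vq a y D)) =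
  Ex (prd (fun _ : 'I_K => p a)) (fun D' => Ex (rsk (p a) (r a y) M D') (F D')).
Proof.
rewrite Ex_jn; transitivity (Ex (prd (fun k : A * 'I_K => p k.1)) (fun D1 : qD1 =>
    Ex (rsk (p a) (r a y) M (qprop D1 a)) (F (qprop D1 a)))).
  apply: eq_Ex => D1 _; rewrite /vq /=.
  rewrite (Ex_prd1 (p := fun k : A * Y * qD1 => rsk (p k.1.1) (r k.1.1 k.1.2) M (qprop k.2 k.1.1)) (a, y, D1) (F (qprop D1 a))) //.
  by move=> k; exact: pmf_rsk.
have ei : injective (fun l : 'I_K => (a, l)) by move=> l l' [].
exact: (Ex_prd_inj (p := fun k : A * 'I_K => p k.1) (fun D' => Ex (rsk (p a) (r a y) M D') (F D')) (fun k => hp k.1) ei).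
Qed.

Lemma vq_law a y phi : Ex qdit (fun D => phi (vq a y D)) = Ex (r a y) phi.
Proof. by rewrite (Ex_vq a y (fun _ => phi)) Ex_rsk. Qed.

(** Knowing [a] and the dither, one guesses uniformly among the K proposals and one further option,
    a uniform value. The code length is ln(K + 1), plus ln |V| when the output is not a proposal. *)
Lemma cent_vq (mu : A * Y -> R) : pmf mu ->
  cent (jn mu (fun _ => qdit)) (fun w => vq w.1.1 w.1.2 w.2) (fun w => (w.1.1, w.2)) <=
  ln K.+1%:R + (d + Ex mu (fun x => \sum_v r x.1 x.2 v * (M * p x.1 v < r x.1 x.2 v)%R%:R)) * ln #|V|%:R.
Proof.
move=> hmu; have hq := pmf_qdit; have hO : pmf (jn mu (fun _ => qdit)) by exact: pmf_jn.
have [w0 _] := pmf_inhab hO.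
have cV : 0 < #|V|%:R :> R by rewrite ltr0n; apply/card_gt0P; exists (vq w0.1.1 w0.1.2 w0.2).
have lV : 0 <= ln #|V|%:R :> R by rewrite ln_ge0 // ler1n -(ltr0n R).
have K1 : 0 < K.+1%:R :> R by rewrite ltr0n.
pose q (v : V) (b : A * (qD1 * qD2)) : R := (\sum_l (qprop b.2.1 b.1 l == v)%:R + #|V|%:R^-1) / K.+1%:R.
have q0 v b : 0 < q v b.
  apply: divr_gt0 => //; rewrite ltr_wpDl ?invr_gt0 // sumr_ge0 // => l _; exact: ler0n.
apply: (le_trans (@cent_gibbs _ _ _ _ _ _ _ q hO _ _ _)).
- by move=> v b; exact: ltW.
- move=> b; rewrite -mulr_suml ler_pdivrMr // mul1r big_split /= sumr_const.
  rewrite -[_ *+ #|_|]mulr_natr mulVf ?gt_eqF // exchange_big /= -natr1 lerD2r.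
  rewrite -[leRHS](_ : \sum_(l < K) (1 : R) = _); last by rewrite sumr_const card_ord.
  apply: ler_sum => l _; rewrite (bigD1 (qprop b.2.1 b.1 l)) //= eqxx big1 ?addr0 // => v nv.
  by rewrite eq_sym (negbTE nv).
- by move=> w _; exact: q0.
apply: (@le_trans _ _ (Ex (jn mu (fun _ => qdit)) (fun w => ln K.+1%:R +
   (vq w.1.1 w.1.2 w.2 \notin codom (qprop w.2.1 w.1.1))%:R * ln #|V|%:R))).
  apply: ler_Ex => [w|w _]; first exact: pmf_ge0.
  set v := vq _ _ _; rewrite -lnV ?posrE ?q0 //.
  case: (boolP (v \in _)) => hv /=; rewrite ?mul0r ?addr0 ?mul1r.
    rewrite ler_ln ?posrE ?invr_gt0 ?q0 // -[leRHS]invrK lef_pV2 ?posrE ?invr_gt0 ?q0 //.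
    rewrite /q -[leLHS]mul1r ler_wpM2r ?invr_ge0 ?(ltW K1) //.
    case/codomP: hv => l hl; rewrite (bigD1 l) //= -hl eqxx -addrA lerDl.
    by apply: addr_ge0; [apply: sumr_ge0 => l' _; exact: ler0n|rewrite invr_ge0 ltW].
  rewrite -lnM ?posrE // /q big1 ?add0r => [|l _]; last first.
    by case: eqP => // e; case/negP: hv; rewrite -e codom_f.
  by rewrite invfM invrK invrK mulrC.
rewrite ExD Ex_cst // ExZr; apply: lerD => //; apply: ler_wpM2r => //.
rewrite Ex_jn -[X in _ <= X + _](Ex_cst d hmu) -ExD; apply: ler_Ex => [x|[a y] _]; first exact: pmf_ge0.
rewrite (Ex_vq a y (fun D' v => (v \notin codom D')%:R)).
apply: (le_trans (rsk_notin (hp a) (hr a y) K0 M0)).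
exact: (rsfail_le (hp a) (hr a y) K0 M0 d0 hK).
Qed.

End Quantizer.

(** * Quantizing blocks at the conditional mutual information *)

Section BlockQuantizer.
Context {R : realType} {A Y V : finType} (mu : A * Y -> R) (hmu : pmf mu).
Context (r : A -> Y -> V -> R) (hr : forall a y, pmf (r a y)).

Definition qlaw : (A * Y) * V -> R := jn mu (fun x => r x.1 x.2).
Lemma pmf_qlaw : pmf qlaw. Proof. exact: pmf_jn. Qed.

Definition hVA : R := cent qlaw (fun w => w.2) (fun w => w.1.1).
Definition hVAY : R := cent qlaw (fun w => w.2) (fun w => w.1).

Definition pA (a : A) : R := pr mu fst a.
(** The conditional law of the output given [a]; at an [a] of probability 0 the arbitrary [y0] keeps
    it a probability law. *)
Definition vprop (y0 : Y) (a : A) (v : V) : R :=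
  if pA a == 0 then r a y0 v else (\sum_y mu (a, y) * r a y v) / pA a.

Lemma Ex_pair F : Ex mu F = \sum_a \sum_y mu (a, y) * F (a, y).
Proof. by rewrite /Ex pair_bigA; apply: eq_bigr => -[]. Qed.

Lemma pAE a : pA a = \sum_y mu (a, y).
Proof.
rewrite /pA /pr Ex_pair (bigD1 a) //=.
rewrite [X in _ + X]big1 ?addr0 => [|a' na]; last by apply: big1 => y _; rewrite (negbTE na) mulr0.
by apply: eq_bigr => y _; rewrite eqxx mulr1.
Qed.

Lemma pmf_vprop y0 a : pmf (vprop y0 a).
Proof.
rewrite /vprop; case: eqP => [_|/eqP h]; first exact: hr.
split=> [v|].
  by rewrite divr_ge0 ?pr_ge0 // sumr_ge0 // => y _; rewrite mulr_ge0 // pmf_ge0.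
rewrite -mulr_suml exchange_big /=; under eq_bigr do rewrite -mulr_sumr (pmf_sum1 (hr a _)) mulr1.
by rewrite -pAE divff.
Qed.

Lemma qlaw_gt0 w : 0 < qlaw w -> [/\ 0 < mu w.1, 0 < r w.1.1 w.1.2 w.2, 0 < pA w.1.1 & 
  forall y0, 0 < vprop y0 w.1.1 w.2].
Proof.
case: w => [[a y] v]; rewrite /qlaw /jn /= => h.
have m0 : 0 < mu (a, y).
  by rewrite lt0r (pmf_ge0 _ hmu) andbT; apply: contraTneq h => ->; rewrite mul0r ltxx.
have r0 : 0 < r a y v by rewrite pmulr_rgt0 in h.
have p0 : 0 < pA a by exact: (pr_gt0 hmu fst m0).
split=> // y0; rewrite /vprop gt_eqF // divr_gt0 // (bigD1 y) //= ltr_pwDl ?mulr_gt0 //.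
by apply: sumr_ge0 => y' _; rewrite mulr_ge0 // pmf_ge0.
Qed.

Definition qinfo y0 (w : (A * Y) * V) : R := ln (r w.1.1 w.1.2 w.2 / vprop y0 w.1.1 w.2).

Lemma Ex_qinfo y0 : Ex qlaw (qinfo y0) = hVA - hVAY.
Proof.
have hq := pmf_qlaw.
have e1 : hVA = Ex qlaw (fun w => - ln (vprop y0 w.1.1 w.2)).
  apply: cent_kernel => // w /qlaw_gt0[_ _ p0 _].
  have -> : pr qlaw (fun w => w.1.1) w.1.1 = pA w.1.1.
    by rewrite /pr /qlaw Ex_jn; apply: eq_Ex => x _; rewrite /= Ex_cst.
  rewrite /vprop gt_eqF // mulrC divfK ?gt_eqF //.
  case: w p0 => [[a y] v] /= p0; rewrite /pr /qlaw Ex_jn Ex_pair (bigD1 a) //=.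
  rewrite [X in _ + X]big1 ?addr0 => [|a' na]; last first.
    apply: big1 => y' _; rewrite [X in _ * X](_ : _ = 0) ?mulr0 //; apply: big1 => v' _.
    by rewrite -pair_eqE /= /pair_eq /= (negbTE na) andbF mulr0.
  apply: eq_bigr => y' _; congr (_ * _); rewrite /Ex (bigD1 v) //= eqxx mulr1 big1 ?addr0 // => v' nv.
  by rewrite -pair_eqE /= /pair_eq /= (negbTE nv) mulr0.
have e2 : hVAY = Ex qlaw (fun w => - ln (r w.1.1 w.1.2 w.2)).
  apply: cent_kernel => // w /qlaw_gt0[m0 _ _ _].
  have -> : pr qlaw (fun w => w.1) w.1 = mu w.1.
    rewrite /pr /qlaw Ex_jn /Ex (bigD1 w.1) //= eqxx -[X in _ + X = _](_ : 0 = _).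
      by rewrite addr0 -/(Ex _ _) Ex_cst // mulr1.
    apply/esym/big1 => x nx; rewrite [X in _ * X](_ : _ = 0) ?mulr0 //; apply: big1 => v' _.
    by rewrite (negbTE nx) mulr0.
  case: w m0 => [x v] /= m0; rewrite /pr /qlaw Ex_jn /Ex (bigD1 x) //= [X in _ + X]big1 ?addr0 => [|x' nx]; last first.
    rewrite [X in _ * X](_ : _ = 0) ?mulr0 //; apply: big1 => v' _.
    by rewrite -pair_eqE /= /pair_eq /= (negbTE nx) andbF mulr0.
  congr (_ * _); rewrite (bigD1 v) //= eqxx mulr1 big1 ?addr0 // => v' nv.
  by rewrite -pair_eqE /= /pair_eq /= (negbTE nv) mulr0.
rewrite e1 e2 -ExB; apply: eq_Ex => w hw.
have /qlaw_gt0[_ r0 _ v0] : 0 < qlaw w by rewrite lt0r hw (pmf_ge0 _ hq).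
by rewrite /qinfo ln_div ?posrE // opprK addrC.
Qed.

Lemma block_quantizer (delta : R) : 0 < delta ->
  exists N0 : nat, forall n : nat, (N0 <= n)%N -> (0 < n)%N ->
  exists (Dd : finType) (pD : Dd -> R) (q : {ffun 'I_n -> A} -> {ffun 'I_n -> Y} -> Dd -> {ffun 'I_n -> V}),
  [/\ pmf pD,
      forall a y phi, Ex pD (fun D => phi (q a y D)) = Ex (prd (fun s => r (a s) (y s))) phi
    & cent (jn (prd (fun _ : 'I_n => mu)) (fun _ => pD))
        (fun w => q [ffun s => (w.1 s).1] [ffun s => (w.1 s).2] w.2) (fun w => ([ffun s => (w.1 s).1], w.2)) <=
      n%:R * (hVA - hVAY + delta)].
Proof.
move=> dl0; have hq := pmf_qlaw.
have [[a0 y0] _] := pmf_inhab hmu; have [w0 _] := pmf_inhab hq.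
have cV : (0 < #|V|)%N by apply/card_gt0P; exists w0.2.
have lV : 0 <= ln #|V|%:R :> R by rewrite ln_ge0 // ler1n.
pose Inf := hVA - hVAY.
have I0 : 0 <= Inf.
  by rewrite subr_ge0; apply: cent_cond => // w w' _ _ [] ->.
(* Failure has probability at most 2 c, which costs at most delta / 2 per letter. Two shares [d1] of
   delta / 4 pay for the spread of the information density and for the constant [cst]. *)
pose c := delta / (4 * (ln #|V|%:R + 1)).
have c0 : 0 < c by rewrite divr_gt0 // mulr_gt0 // ltr_wpDl.
have hc : 2 * c * ln #|V|%:R <= delta / 2.
  have h1 : ln #|V|%:R + 1 != 0 :> R by rewrite gt_eqF // ltr_wpDl.
  have e : delta / 2 = 2 * c * (ln #|V|%:R + 1) by rewrite /c; field.
  by rewrite e; apply: ler_wpM2l; [apply: mulr_ge0 => //; exact: ltW|rewrite lerDl].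
pose d1 := delta / 4; have d10 : 0 < d1 by rewrite divr_gt0.
pose vr := var qlaw (qinfo y0); have vr0 : 0 <= vr by exact: var_ge0.
(* Since M >= 1, K + 1 <= M c^-2 + 2 <= M (c^-2 + 2); so ln(K + 1) exceeds ln M by at most [cst]. *)
pose cst := ln (c ^- 2 + 2).
have ci0 : 0 < c ^- 2 by rewrite invr_gt0 exprn_gt0.
exists (Num.bound (vr / (d1 * c) ^+ 2) + Num.bound (cst / d1))%N => n hn n0.
have n0' : 0 < n%:R :> R by rewrite ltr0n.
have cst0 : 0 <= cst by rewrite ln_ge0 //; lra.
have hn1 : vr <= (d1 * c) ^+ 2 * n%:R.
  rewrite mulrC -ler_pdivrMr; last by rewrite exprn_gt0 // mulr_gt0.
  apply: (le_trans (ltW (archi_boundP _))); first by rewrite divr_ge0 // sqr_ge0.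
  by rewrite ler_nat (leq_trans _ hn) // leq_addr.
have hn2 : cst <= n%:R * d1.
  rewrite -ler_pdivrMr //; apply: (le_trans (ltW (archi_boundP _))); first by rewrite divr_ge0 // ltW.
  by rewrite ler_nat (leq_trans _ hn) // leq_addl.
pose M := expR (n%:R * (Inf + d1)); have M0 : 0 < M by exact: expR_gt0.
have M1 : 1 <= M by rewrite -[leLHS]expR0 ler_expR mulr_ge0 ?ler0n // addr_ge0 // ltW.
pose K := (Num.truncn (M * c ^- 2)).+1.
have Mc0 : 0 <= M * c ^- 2 by rewrite mulr_ge0 // ltW.
have /andP[K1 K2] := truncn_itv Mc0.
have hK : M <= c ^+ 2 * K%:R.
  by move: (ltW K2); rewrite ler_pdivrMr ?exprn_gt0 // mulrC.
have hlK : ln K.+1%:R <= n%:R * (Inf + d1) + cst.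
  rewrite -[n%:R * _]expRK -/M -lnM ?posrE // ?ler_ln ?posrE ?ltr0n //; last 2 first.
  - by rewrite mulr_gt0 // addr_gt0.
  - by rewrite addr_gt0.
  rewrite mulrDr -natr1 /K -natr1; lra.
pose pn (a : {ffun 'I_n -> A}) := prd (fun s => vprop y0 (a s)).
pose rn (a : {ffun 'I_n -> A}) (y : {ffun 'I_n -> Y}) := prd (fun s => r (a s) (y s)).
have hpn a : pmf (pn a) by apply: pmf_prd => s; exact: pmf_vprop.
have hrn a y : pmf (rn a y) by exact: pmf_prd.
have hmn : pmf (prd (fun _ : 'I_n => mu)) by exact: pmf_prd.
pose XY (f : {ffun 'I_n -> A * Y}) : {ffun 'I_n -> A} * {ffun 'I_n -> Y} := ([ffun s => (f s).1], [ffun s => (f s).2]).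
pose mun := pr (prd (fun _ : 'I_n => mu)) XY.
have hmun : pmf mun by exact: pmf_push.
exists (@qD1 {ffun 'I_n -> A} {ffun 'I_n -> V} K * @qD2 {ffun 'I_n -> A} {ffun 'I_n -> Y} {ffun 'I_n -> V} K)%type.
exists (qdit pn rn M (K := K)), (@vq _ _ _ K).
have hqd : pmf (qdit pn rn M (K := K)) by exact: pmf_qdit.
split=> //; first by move=> a y phi; exact: vq_law.
have h := cent_vq hpn hrn (isT : (0 < K)%N) M0 c0 hK hmun.
rewrite (_ : cent _ _ _ = cent (jn mun (fun _ => qdit pn rn M (K := K)))
  (fun w => vq w.1.1 w.1.2 w.2) (fun w => (w.1.1, w.2))); last first.
  by apply: samelaw_cent => phi; rewrite !Ex_jn [RHS]Ex_push.
apply: (le_trans h).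
have hbad : Ex mun (fun x => \sum_v rn x.1 x.2 v * (M * pn x.1 v < rn x.1 x.2 v)%R%:R) <= c.
  rewrite Ex_push.
  apply: (@le_trans _ _ (Ex (prd (fun _ : 'I_n => mu)) (fun f => Ex (prd (fun s => r (f s).1 (f s).2)) (fun v =>
      (M * pn (XY f).1 v < rn (XY f).1 (XY f).2 v)%R%:R)))).
    rewrite le_eqVlt; apply/orP; left; apply/eqP; apply: eq_Ex => f _; apply: eq_bigr => v _; congr (_ * _).
    by apply: eq_bigr => s _; rewrite !ffunE.
  rewrite (Ex_prd_zip (fun _ : 'I_n => mu) (fun _ x => r x.1 x.2) (fun f v => (M * pn (XY f).1 v < rn (XY f).1 (XY f).2 v)%R%:R)).
  have hqn : pmf (prd (fun _ : 'I_n => qlaw)) by exact: pmf_prd.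
  pose S (w : {ffun 'I_n -> (A * Y) * V}) := `| \sum_s qinfo y0 (w s) - \sum_(s < n) Ex qlaw (qinfo y0) |.
  apply: (@le_trans _ _ (Ex (prd (fun _ : 'I_n => qlaw)) (fun w => (n%:R * d1 < S w)%R%:R))).
    apply: ler_Ex => [w|w pw]; first exact: pmf_ge0 hqn.
    rewrite ler_nat; case: (ltP _ (rn _ _ _)) => // hb; rewrite lt0b.
    have pc s := qlaw_gt0 (prd_gt0 s (fun _ => hq) pw).
    have P0 : 0 < \prod_s vprop y0 (w s).1.1 (w s).2 by apply: prodr_gt0 => s _; have [_ _ _] := pc s; exact.
    have R0 : 0 < \prod_s r (w s).1.1 (w s).1.2 (w s).2 by apply: prodr_gt0 => s _; have [] := pc s.
    have hb' : M * \prod_s vprop y0 (w s).1.1 (w s).2 < \prod_s r (w s).1.1 (w s).1.2 (w s).2.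
      move: hb; congr (_ * _ < _); apply: eq_bigr => s _; by rewrite !ffunE.
    have : n%:R * (Inf + d1) < \sum_s qinfo y0 (w s).
      have -> : \sum_s qinfo y0 (w s) = ln (\prod_s r (w s).1.1 (w s).1.2 (w s).2 / \prod_s vprop y0 (w s).1.1 (w s).2).
        rewrite -prodf_div ln_prod // => s; have [_ r0 _ v0] := pc s; by rewrite divr_gt0.
      rewrite -[ltLHS]expRK -/M ltr_ln ?posrE ?divr_gt0 //.
      by rewrite ltr_pdivlMr.
    rewrite /S Ex_qinfo -/Inf sumr_const card_ord -[Inf *+ n]mulr_natl ltr_normr => h'.
    by apply/orP; left; move: h'; lra.
  have hm := @markov R _ _ S (n%:R * d1) (fun y => n%:R * d1 < S y)%R hqn.
  apply: (le_trans (hm _ _ _)).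
  - exact: mulr_gt0.
  - by move=> y _; exact: normr_ge0.
  - by move=> y _; exact: ltW.
  rewrite ler_pdivrMr; last exact: mulr_gt0.
  have := lln_L1 (p := fun _ : 'I_n => qlaw) (g := fun _ => qinfo y0) (fun _ => hq) (fun _ => lexx _) (mulr_gt0 d10 c0).
  rewrite card_ord => /(_ (fun _ => hn1)) /le_trans; apply.
  by rewrite le_eqVlt; apply/orP; left; apply/eqP; ring.
set lv := ln #|_|%:R; have -> : lv = n%:R * ln #|V|%:R.
  by rewrite /lv card_ffun card_ord natrX lnXn ?ltr0n // mulr_natl.
have lV' : 0 <= n%:R * ln #|V|%:R :> R by rewrite mulr_ge0 ?ler0n.
have h2 := ler_wpM2r lV' (lerD (lexx c) hbad).
apply: (le_trans (lerD hlK h2)).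
have h3 := ler_wpM2l (ltW n0') hc.
have d4 : delta = d1 + d1 + delta / 2 by rewrite /d1; field.
move: h3 hn2; rewrite [X in _ -> _ -> _ <= _ * (_ + X)]d4 -/Inf; lra.
Qed.

End BlockQuantizer.

(** * Functional representation of the inputs *)

Lemma eq_Ex_law {R : realType} (A : finType) (p p' : A -> R) f : p =1 p' -> Ex p f = Ex p' f.
Proof. by move=> h; apply: eq_bigr => a _; rewrite h. Qed.

Lemma eq_prd {R : realType} (I A : finType) (p p' : I -> A -> R) : (forall i, p i =1 p' i) -> prd p =1 prd p'.
Proof. by move=> h f; apply: eq_bigr => i _; rewrite h. Qed.

Section DependentProduct.
Context {R : realType} {I : finType} {F : I -> finType}.

Definition dprd (p : forall i, F i -> R) (f : {dffun forall i, F i}) : R := \prod_i p i (f i).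
Definition tg i (x : F i) : {i & F i} := Tagged F x.
Definition dtag (f : {dffun forall i, F i}) : {ffun I -> {i & F i}} := [ffun i => tg (f i)].
Definition utg i (x0 : F i) (t : {i & F i}) : F i := if [pick x | tg x == t] is Some x then x else x0.

Lemma tg_inj i : injective (@tg i).
Proof. by move=> x y /eqP; rewrite /tg eq_Tagged => /eqP. Qed.

Lemma utgK i (x0 x : F i) : utg x0 (tg x) = x.
Proof. by rewrite /utg; case: pickP => [y /eqP /tg_inj //|/(_ x)]; rewrite eqxx. Qed.

Lemma tgK i (x0 : F i) t : tag t = i -> tg (utg x0 t) = t.
Proof. by case: t => j x /= e; move: x0; rewrite -e => x0; rewrite -[existT _ _ _]/(tg x) utgK. Qed.

Context (p : forall i, F i -> R).
Arguments p : clear implicits.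
Context (hp : forall i, pmf (p i)).

Lemma dprd_inhab : exists d0 : {dffun forall i, F i}, True.
Proof.
suff h i : exists x : F i, xpredT x by exists (finfun (fun i => xchoose (h i))).
by have [x _] := pmf_inhab (hp i); exists x.
Qed.

Lemma pr_tg i x : pr (p i) (@tg i) (tg x) = p i x.
Proof.
rewrite /pr /Ex (bigD1 x) //= eqxx mulr1 big1 ?addr0 // => y ny.
by case: eqP => [/tg_inj e|]; [rewrite e eqxx in ny|rewrite mulr0].
Qed.

Lemma Ex_dprd phi : Ex (dprd p) (fun f => phi (dtag f)) = Ex (prd (fun i => pr (p i) (@tg i))) phi.
Proof.
have [d0 _] := dprd_inhab.
rewrite [RHS]/Ex (bigID (fun g : {ffun I -> {i & F i}} => [forall i, tag (g i) == i])) /= [X in _ + X]big1 ?addr0.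
  rewrite (reindex dtag) /=.
    rewrite [RHS](eq_bigl xpredT) => [|f]; last by apply/forallP => i; rewrite ffunE.
    by apply: eq_bigr => f _; congr (_ * _); apply: eq_bigr => i _; rewrite ffunE pr_tg.
  exists (fun g => finfun (fun i => utg (d0 i) (g i)) : {dffun forall i, F i}) => [f _|g].
    by apply/ffunP => i; rewrite !ffunE utgK.
  by rewrite inE => /forallP h; apply/ffunP => i; rewrite !ffunE tgK //; apply/eqP.
move=> g /forallPn[i ni]; rewrite /prd (bigD1 i) //= (_ : pr _ _ _ = 0) ?mul0r //.
apply: big1 => x _; case: eqP => [e|_]; last by rewrite mulr0.
by rewrite -e /= eqxx in ni.
Qed.

Lemma pmf_dprd : pmf (dprd p).
Proof.
split=> [f|]; first by apply: prodr_ge0 => i _; exact: pmf_ge0.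
have h : pmf (prd (fun i => pr (p i) (@tg i))) by apply: pmf_prd => i; exact: pmf_push.
rewrite -[RHS](Ex_cst 1 h) -(Ex_dprd (fun=> 1)).
by apply: eq_bigr => f _; rewrite mulr1.
Qed.

Lemma Ex_dprd1 i phi : Ex (dprd p) (fun f => phi (tg (f i))) = Ex (p i) (fun x => phi (tg x)).
Proof.
transitivity (Ex (dprd p) (fun f => phi (dtag f i))).
  by apply: eq_Ex => f _; rewrite ffunE.
rewrite (Ex_dprd (fun g => phi (g i))) Ex_prd1; last by move=> j; exact: pmf_push.
by rewrite Ex_push.
Qed.

End DependentProduct.

Section FunctionalRepresentation.
Context {R : realType} {I Qt : finType} {Xa : I -> finType}.
Local Notation XX := {dffun forall i, Xa i}.
Context (g : Qt -> XX -> R) (hg : forall q, pmf (g q)).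
Context (px : forall i, Qt -> Xa i -> R).
Arguments px : clear implicits.
Context (hpx : forall i q, pmf (px i q)).
Context (ns : seq I) (uns : uniq ns) (x0 : XX).

(** A letter is a table that lists an outcome for every time-sharing value and every vector of
    inputs fixed so far. Its entries are full vectors, of which one coordinate becomes the input, so
    that all nodes share one type. *)
Definition U0 : finType := {ffun Qt * XX -> XX}.
Definition agr (s : seq I) (x x' : XX) : bool := [forall i, (i \in s) ==> (x i == x' i)].
Definition gG s q x : R := \sum_(x' | agr s x' x) g q x'.
(** The conditional law of the input vector given its coordinates in [s], with [g q] itself on null
    events. *)
Definition gc s q x x' : R := if gG s q x == 0 then g q x' else g q x' * (agr s x' x)%:R / gG s q x.
Definition tail i := drop (index i ns).+1 ns.
Definition dmg (s : seq I) (x x' : XX) : XX := finfun (fun i => if i \in s then x i else x' i).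
(** Resetting the other coordinates to [x0] makes a table lookup depend on the fixed inputs only. *)
Definition dres s x := dmg s x x0.

(** Inputs are produced from the end of [ns] towards its head, so the input of a node involves its
    own letter and those of the nodes after it, which are the layers known to a coherent
    transmitter. *)
Fixpoint st (q : Qt) (u : {ffun I -> U0}) (s : seq I) : XX :=
  if s is i :: s' then dmg s' (st q u s') (u i (q, dres s' (st q u s'))) else x0.

Definition p0 (i : I) : U0 -> R :=
  prd (fun z => if i \in ns then gc (tail i) z.1 z.2 else dprd (fun i => px i z.1)).

Definition xi q u i : Xa i := st q u (i :: tail i) i.
Definition xv q u : XX := finfun (xi q u).

Lemma agrP (s : seq I) (x x' : XX) : reflect {in s, forall i, x i = x' i} (agr s x x').
Proof.
apply: (iffP forallP) => [h i hi|h i]; first by have := h i; rewrite hi => /eqP.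
by apply/implyP => /h ->.
Qed.

Lemma agr_sym s x x' : agr s x x' = agr s x' x.
Proof. by apply: eq_forallb => i; rewrite eq_sym. Qed.

Lemma gG_agr s q x x' : agr s x x' -> gG s q x = gG s q x'.
Proof.
move=> /agrP h; apply: eq_bigl => y; apply/agrP/agrP => k i hi; first by rewrite -h // k.
by rewrite h // k.
Qed.

Lemma gc_agr s q x x' : agr s x x' -> gc s q x =1 gc s q x'.
Proof.
move=> h y; rewrite /gc (gG_agr _ h); congr (if _ then _ else _ * _%:R / _).
by move/agrP in h; congr nat_of_bool; apply/agrP/agrP => k i hi; rewrite k // h.
Qed.

Lemma gc_nil q x : gc [::] q x =1 g q.
Proof.
move=> y; have a0 z z' : agr [::] z z' by apply/agrP.
have e : gG [::] q x = 1 by rewrite -[RHS](pmf_sum1 (hg q)); apply: eq_bigl => z; rewrite a0.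
by rewrite /gc e oner_eq0 a0 divr1 mulr1.
Qed.

Lemma pmf_gc s q x : pmf (gc s q x).
Proof.
rewrite /gc; case: eqP => [_|/eqP h]; first exact: hg.
have G0 : 0 <= gG s q x by apply: sumr_ge0 => y _; exact: pmf_ge0.
split=> [y|]; first by rewrite divr_ge0 // mulr_ge0 ?pmf_ge0.
rewrite -mulr_suml (_ : \sum_a _ = gG s q x) ?divff // /gG [RHS]big_mkcond /=.
by apply: eq_bigr => y _; case: (agr _ _ _); rewrite ?mulr1 ?mulr0.
Qed.

(** Invariance of a law under a step of its Gibbs sampler: [x'] has positive conditional weight
    exactly in proportion to its weight among the vectors agreeing with [x] on [s]. *)
Lemma gibbs s q psi : Ex (g q) (fun x => Ex (gc s q x) (fun x' => psi (dmg s x x'))) = Ex (g q) psi.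
Proof.
transitivity (Ex (g q) (fun x => \sum_x' g q x' * (agr s x' x)%:R / gG s q x' * psi x')).
  apply: eq_Ex => x hx; apply: eq_bigr => x' _.
  have G0 : gG s q x != 0.
    rewrite gt_eqF // /gG (bigD1 x) /=; last by apply/agrP.
    rewrite ltr_pwDl ?lt0r ?hx ?pmf_ge0 //.
    by apply: sumr_ge0 => y _; exact: pmf_ge0.
  rewrite /gc (negbTE G0); case: (boolP (agr s x' x)) => [ha|_]; last by rewrite !mulr0 !mul0r.
  rewrite (gG_agr _ ha); congr (_ * psi _); apply/ffunP => i; rewrite ffunE; case: ifP => // hi.
  by move/agrP: ha => ->.
rewrite Ex_sum; apply: eq_bigr => x' _.
rewrite (_ : Ex _ _ = Ex (g q) (fun x => (agr s x' x)%:R) * (g q x' / gG s q x' * psi x')); last first.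
  by rewrite -ExZr; apply: eq_Ex => x _; ring.
have -> : Ex (g q) (fun x => (agr s x' x)%:R) = gG s q x'.
  rewrite /gG [RHS]big_mkcond; apply: eq_bigr => y _; rewrite agr_sym.
  by case: (agr _ _ _); rewrite ?mulr1 ?mulr0.
case: (eqVneq (g q x') 0) => [->|h]; first by rewrite !mul0r mulr0.
have G0 : gG s q x' != 0.
  rewrite gt_eqF // /gG (bigD1 x') /=; last by apply/agrP.
  rewrite ltr_pwDl ?lt0r ?h ?pmf_ge0 //.
  by apply: sumr_ge0 => y _; exact: pmf_ge0.
by rewrite mulrA mulrCA divff // mulr1.
Qed.

Lemma pmf_p0 i : pmf (p0 i).
Proof.
apply: pmf_prd => z; case: ifP => _; first exact: pmf_gc.
exact: pmf_dprd.
Qed.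

Lemma tail_suffix s1 i s : ns = s1 ++ i :: s -> tail i = s.
Proof.
move=> e; have i1 : i \notin s1.
  by move: uns; rewrite e cat_uniq => /and3P[_ /hasPn /(_ i (mem_head _ _))].
by rewrite /tail e index_cat (negbTE i1) /= eqxx addn0 -cat_rcons drop_size_cat // size_rcons.
Qed.

Lemma suffix_notin s1 i s : ns = s1 ++ i :: s -> i \notin s.
Proof. by move=> e; move: uns; rewrite e cat_uniq => /and3P[_ _] /=/andP[]. Qed.

Lemma st_in q (u : {ffun I -> U0}) (s1 s : seq I) i : ns = s1 ++ s -> i \in s -> st q u s i = xi q u i.
Proof.
elim: s s1 => //= j s IH s1 e; rewrite in_cons ffunE => /orP[/eqP ->|h].
  by rewrite (negbTE (suffix_notin e)) /xi (tail_suffix e) /= ffunE (negbTE (suffix_notin e)).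
by rewrite h (IH (rcons s1 j)) // cat_rcons.
Qed.

Lemma eq_st q (u u' : {ffun I -> U0}) (s : seq I) : {in s, u =1 u'} -> st q u s = st q u' s.
Proof.
elim: s => //= i s IH h; rewrite (h i (mem_head _ _)) IH // => j hj.
by apply: h; rewrite in_cons hj orbT.
Qed.

Lemma xi_eq q (u u' : {ffun I -> U0}) i : {in i :: tail i, u =1 u'} -> xi q u i = xi q u' i.
Proof. by move=> h; rewrite /xi (eq_st q h). Qed.

(** The table of node i is independent of the letters after it, so adding node i to the suffix is a
    step of [gibbs]. The last node of [ns] draws from the unconditioned law. *)
Lemma law_st q psi s1 s : ns = s1 ++ s -> s != [::] ->
  Ex (prd p0) (fun u => psi (st q u s)) = Ex (g q) psi.
Proof.
elim: s s1 psi => // i s IH s1 psi e _.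
have hp0 := pmf_p0; have is' := suffix_notin e.
have hns : i \in ns by rewrite e mem_cat mem_head orbT.
rewrite -(Ex_merge (predC1 i) _ hp0).
transitivity (Ex (prd p0) (fun u => Ex (gc s q (st q u s)) (fun x' => psi (dmg s (st q u s) x')))).
  apply: eq_Ex => u _; set x := st q u s.
  transitivity (Ex (prd p0) (fun u' : {ffun I -> U0} => (fun v : U0 => psi (dmg s x (v (q, dres s x)))) (u' i))).
    apply: eq_Ex => u' _; rewrite /= ffunE /= eqxx /=.
    rewrite (_ : st q _ s = x) //; apply: eq_st => j hj; rewrite ffunE /=.
    by case: eqP => // ej; rewrite -ej hj in is'.
  rewrite (Ex_prd1 i (fun v : U0 => psi (dmg s x (v (q, dres s x)))) hp0) /p0.
  rewrite (Ex_prd1 (q, dres s x) (fun v => psi (dmg s x v))); last first.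
    by move=> z; case: ifP => _; [exact: pmf_gc|exact: pmf_dprd].
  rewrite /= hns (tail_suffix e); apply: eq_Ex_law; apply: gc_agr.
  by apply/agrP => j hj; rewrite ffunE hj.
case: s IH e {is'} => [_ _|j s IH e].
  rewrite -[RHS](Ex_cst _ (pmf_prd hp0)); apply: eq_Ex => u _.
  rewrite (eq_Ex_law _ (gc_nil q _)); apply: eq_Ex => x _; congr psi.
  by apply/ffunP => k; rewrite ffunE.
rewrite (IH (rcons s1 i) (fun x => Ex (gc (j :: s) q x) (fun x' => psi (dmg (j :: s) x x')))) //; last by rewrite cat_rcons.
exact: gibbs.
Qed.

Lemma tail_notin i : i \notin ns -> tail i = [::].
Proof. by move=> h; rewrite /tail memNindex // drop_oversize. Qed.

Lemma law_xv q phi : ns != [::] -> Ex (prd p0) (fun u => phi (xv q u)) =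
  Ex (g q) (fun x' => Ex (dprd (fun i => px i q)) (fun z => phi (dmg ns x' z))).
Proof.
move=> n0; have hp0 := pmf_p0.
pose z0 : Qt * XX := (q, dres [::] x0).
pose dg (u : {ffun I -> U0}) : XX := finfun (fun i => u i z0 i).
pose p1 (i : I) : U0 -> R := prd (fun z => dprd (fun i => px i z.1)).
have hp1 i : pmf (p1 i) by apply: pmf_prd => z; exact: pmf_dprd.
rewrite -(Ex_merge (mem ns) _ hp0).
transitivity (Ex (prd p0) (fun u => Ex (prd p0) (fun u' => phi (dmg ns (st q u ns) (dg u'))))).
  apply: eq_Ex => u _; apply: eq_Ex => u' _; congr phi; apply/ffunP => i.
  rewrite !ffunE; case: (boolP (i \in ns)) => hi.
    rewrite (@st_in q u [::] ns) //; apply: xi_eq => j.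
    rewrite in_cons ffunE /= => /orP[/eqP ->|hj]; first by rewrite hi.
    by rewrite (mem_drop hj).
  by rewrite /xi (tail_notin hi) /= !ffunE /= (negbTE hi).
rewrite (law_st q (fun x => Ex (prd p0) (fun u' => phi (dmg ns x (dg u')))) (s1 := [::])) //.
apply: eq_Ex => x _.
(* The tables of the nodes in [ns] are masked by [dmg], so they may be redrawn from [p1], under
   which all nodes have independent inputs. *)
transitivity (Ex (prd p1) (fun u' => phi (dmg ns x (dg u')))).
  pose F u' := phi (dmg ns x (dg u')).
  transitivity (Ex (prd p0) (fun f => Ex (prd p1) (fun f' => F (merge (mem ns) f f')))).
    rewrite (Ex_merge2 (mem ns) F hp0 hp1); apply: eq_Ex_law; apply: eq_prd => i v /=.
    by rewrite /p0 /p1; case: ifP => // hi; apply: eq_prd => z; rewrite hi.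
  rewrite -[RHS](Ex_cst _ (pmf_prd hp0)); apply: eq_Ex => f _; apply: eq_Ex => f' _.
  rewrite /F; congr phi; apply/ffunP => i; rewrite [RHS]ffunE [LHS]ffunE; case: ifP => [_|hi]; first by []. rewrite [LHS]ffunE [RHS]ffunE ffunE. by rewrite /= hi.
pose ph (h : {ffun I -> {i & Xa i}}) := phi (dmg ns x (finfun (fun i => utg (x0 i) (h i)) : XX)).
have phE z : phi (dmg ns x z) = ph (dtag z).
  rewrite /ph.
  have -> : (finfun (fun i => utg (x0 i) (dtag z i)) : XX) = z by apply/ffunP => j; rewrite !ffunE utgK.
  by [].
under [RHS]eq_Ex do rewrite phE; rewrite Ex_dprd //.
transitivity (Ex (prd p1) (fun u' => ph [ffun i => tg (u' i z0 i)])).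
  apply: eq_Ex => u' _; rewrite phE; congr ph; apply/ffunP => i; by rewrite !ffunE.
rewrite -(Ex_prd_push p1 (fun i (v : U0) => tg (v z0 i))); apply: eq_Ex_law; apply: eq_prd => i t.
rewrite /pr /p1 (Ex_prd1 z0 (fun v : XX => (tg (v i) == t)%:R)); last by move=> z; exact: pmf_dprd.
by rewrite (@Ex_dprd1 _ _ _ _ _ i (fun y => (y == t)%:R)).
Qed.

(** If [S] is closed under successors, inputs in [S] never read a resampled letter, and the other
    inputs read the kept letters only through the inputs in [S]. *)
Lemma xv_merge (S : pred I) q (u u1 u' : {ffun I -> U0}) : (forall i, S i -> all S (tail i)) ->
  (forall i, S i -> xi q u i = xi q u1 i) -> xv q (merge S u u') = xv q (merge S u1 u').
Proof.
move=> hS h.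
have hm (v : {ffun I -> U0}) i : S i -> xi q (merge S v u') i = xi q v i.
  move=> Si; apply: xi_eq => j; rewrite in_cons ffunE => /orP[/eqP ->|hj]; first by rewrite Si.
  by have /allP -> := hS i Si.
have hs s1 s : ns = s1 ++ s -> {in s, forall i, st q (merge S u u') s i = st q (merge S u1 u') s i}.
  elim: s s1 => // j s IH s1 e i hi.
  have {}IH := IH (rcons s1 j); rewrite cat_rcons in IH; have {}IH := IH e.
  case: (boolP (S i)) => Si; first by rewrite !(st_in _ _ e) // !hm // h.
  rewrite /= !ffunE; case: ifP => his; first exact: IH.
  move: hi; rewrite in_cons his orbF => /eqP ei; rewrite -ei (negbTE Si).
  congr (u' i (q, _) i); apply/ffunP => k; rewrite !ffunE; case: ifP => // hk; exact: IH.
apply/ffunP => i; rewrite !ffunE; case: (boolP (S i)) => Si; first by rewrite !hm // h.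
case: (boolP (i \in ns)) => hi.
  by rewrite -!(@st_in _ _ [::] ns) // (hs [::]).
by rewrite /xi (tail_notin hi) /= !ffunE (negbTE Si).
Qed.

End FunctionalRepresentation.

Lemma cent_map_le {R : realType} (Om I : finType) (P : Om -> R) (T T' : eqType) (X : I -> Om -> T) (B : Om -> T')
  (s : seq I) : pmf P -> cent P (fun w => [seq X i w | i <- s]) B <= \sum_(i <- s) cent P (X i) B.
Proof.
move=> hP; elim: s => [|i s IH]; first by rewrite big_nil cent_det.
rewrite big_cons; apply: le_trans (lerD (lexx _) IH).
apply: le_trans (cent_sub hP (X i) (fun w => [seq X i w | i <- s]) B).
by apply: cent_arg => // w w' _ _ /= [-> -> _].
Qed.

Lemma cent_vres_le {R : realType} (Om I : finType) (P : Om -> R) (T T' : eqType) (X : I -> Om -> T) (B : Om -> T')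
  (C : {set I}) : pmf P -> cent P (vres C X) B <= \sum_(i in C) cent P (X i) B.
Proof.
move=> hP; rewrite -[leRHS]big_enum; apply: le_trans (cent_map_le X B (enum C) hP).
apply: cent_arg => // w w' _ _ [e _]; apply/vresP => i iC.
have := congr1 (nth (X i w) ^~ (index i (enum C))) e.
by rewrite /= !(nth_map i) ?index_mem ?mem_enum // nth_index ?mem_enum.
Qed.

(** * Single letters and quantized blocks of the extended network *)

Section Letter.
Context {R : realType} {I Qt : finType} {Xa Ya Yh : I -> finType}.
Local Notation XX := {dffun forall i, Xa i}.
Local Notation YY := {dffun forall i, Ya i}.
Context (ch : XX -> YY -> R) (hch : forall x, pmf (ch x)).
Context (pq : Qt -> R) (hpq : pmf pq) (g : Qt -> XX -> R) (hg : forall q, pmf (g q)).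
Context (px : forall i, Qt -> Xa i -> R).
Arguments px : clear implicits.
Context (hpx : forall i q, pmf (px i q)).
Context (pyh : forall i, Qt -> Xa i -> Ya i -> Yh i -> R).
Arguments pyh : clear implicits.
Context (hpyh : forall i q x y, pmf (pyh i q x y)).
Context (ns : seq I) (uns : uniq ns) (x0 : XX) (y0 : YY).

Definition XT : finType := {i & Xa i}.
Definition YT : finType := {i & Ya i}.
Definition VT : finType := {i & Yh i}.
Local Notation U := (@U0 I Qt Xa).
Definition base : finType := (Qt * ({ffun I -> U} * YY))%type.
Local Notation p0i := (p0 g px ns).
Local Notation xvv := (xv ns x0).

(** Tags merge the alphabets of the nodes into one type; [utg], with [x0] and [y0] as defaults,
    removes them. *)
Definition ry (i : I) (a : Qt * XT) (t : YT) : VT -> R :=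
  pr (pyh i a.1 (utg (x0 i) a.2) (utg (y0 i) t)) (@tg I Yh i).
Definition ai (i : I) (l : base) : Qt * XT := (l.1, @tg I Xa i (xvv l.1 l.2.1 i)).
Definition yi (i : I) (l : base) : YT := @tg I Ya i (l.2.2 i).

Definition Lam : base -> R := jn pq (fun q => jn (prd p0i) (fun u => ch (xvv q u))).
Definition Lam' : base * {ffun I -> VT} -> R := jn Lam (fun l => prd (fun i => ry i (ai i l) (yi i l))).

Lemma pmf_p0i i : pmf (p0i i). Proof. exact: pmf_p0. Qed.
Lemma pmf_ry i a t : pmf (ry i a t). Proof. exact: pmf_push. Qed.
Lemma pmf_Lam : pmf Lam.
Proof. by apply: pmf_jn => // q; apply: pmf_jn => //; apply: pmf_prd => i; exact: pmf_p0i. Qed.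
Lemma pmf_Lam' : pmf Lam'.
Proof. by apply: pmf_jn => [|l]; [exact: pmf_Lam|apply: pmf_prd => i; exact: pmf_ry]. Qed.

Definition lv (i : I) (w : base * {ffun I -> VT}) : VT := w.2 i.
Definition lu (i : I) (l : base) : U := l.2.1 i.
Definition lx (i : I) (l : base) : XT := @tg I Xa i (xvv l.1 l.2.1 i).
Definition hV (i : I) : R := cent Lam' (lv i) (fun w => (ai i w.1, yi i w.1)).
Definition hVa (i : I) : R := cent Lam' (lv i) (fun w => ai i w.1).

(* Resampling the functional representations outside [S] does not change the law of the outputs given the inputs on [S],
   so conditioning on the representations or on the inputs is the same. *)
Section Screening.
Context (S : {set I}) (hS : forall i, i \in S -> {subset tail ns i <= S}).
Context (TB : finType) (b : YY * {ffun I -> VT} -> TB).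

Definition kyv (q : Qt) (x : XX) : YY * {ffun I -> VT} -> R :=
  jn (ch x) (fun y => prd (fun i => ry i (q, @tg I Xa i (x i)) (@tg I Ya i (y i)))).

Definition scr (w : base * {ffun I -> VT}) : R :=
  Ex (prd p0i) (fun u' => pr (kyv w.1.1 (xvv w.1.1 (merge (mem S) w.1.2.1 u'))) b (b (w.1.2.2, w.2))).

(** The kernel [scr] reads the conditioning only through q and the inputs in [S]. Every variable
    that determines these, and is itself determined without the letters outside [S], thus gives the
    same conditional entropy. *)
Lemma cent_screen (TA : finType) (a : Qt -> {ffun I -> U} -> TA) :
  (forall q u u', a q (merge (mem S) u u') = a q u) ->
  (forall q q1 u u1, a q u = a q1 u1 -> q = q1 /\ forall i, i \in S -> xi ns x0 q u i = xi ns x0 q u1 i) ->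
  cent Lam' (fun w => b (w.1.2.2, w.2)) (fun w => a w.1.1 w.1.2.1) = Ex Lam' (fun w => - ln (scr w)).
Proof.
move=> h1 h2; apply: cent_kernel => [|w pw]; first exact: pmf_Lam'.
have e F : Ex Lam' (fun w => F w.1.1 w.1.2.1 (w.1.2.2, w.2)) =
    Ex pq (fun q => Ex (prd p0i) (fun u => Ex (kyv q (xvv q u)) (F q u))).
  rewrite /Lam' /Lam !Ex_jn; apply: eq_Ex => q _; rewrite Ex_jn; apply: eq_Ex => u _.
  by rewrite Ex_jn; apply: eq_Ex => y _.
have -> : pr Lam' (fun w => a w.1.1 w.1.2.1) (a w.1.1 w.1.2.1) =
    Ex pq (fun q => Ex (prd p0i) (fun u => (a q u == a w.1.1 w.1.2.1)%:R)).
  rewrite /pr (e (fun q u _ => (a q u == a w.1.1 w.1.2.1)%:R)).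
  apply: eq_Ex => q _; apply: eq_Ex => u _; rewrite Ex_cst //.
  by apply: pmf_jn => // y; apply: pmf_prd => i; exact: pmf_ry.
rewrite /pr (e (fun q u yv => ((b yv, a q u) == (b (w.1.2.2, w.2), a w.1.1 w.1.2.1))%:R)).
rewrite -ExZr; apply: eq_Ex => q _; rewrite -ExZr -(Ex_merge (mem S) _ pmf_p0i).
apply: eq_Ex => u _; rewrite -ExZ; apply: eq_Ex => u' _.
under eq_Ex do rewrite h1.
case: (eqVneq (a q u) (a w.1.1 w.1.2.1)) => [ea|na]; last first.
  rewrite mul0r; apply: big1 => yv _.
  by rewrite -pair_eqE /= /pair_eq /= (negbTE na) andbF mulr0.
have [eq ex] := h2 _ _ _ _ ea.
have -> : xvv q (merge (mem S) u u') = xvv w.1.1 (merge (mem S) w.1.2.1 u').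
  rewrite eq; apply: (xv_merge uns) => [i iS|i iS]; first by apply/allP => j hj; exact: (hS iS).
  by rewrite -eq; exact: ex.
rewrite mul1r ea eq; apply: eq_Ex => yv _.
by rewrite -pair_eqE /= /pair_eq /= eqxx andbT.
Qed.

Lemma cent_screen_ux :
  cent Lam' (fun w => b (w.1.2.2, w.2)) (fun w => (vres S lu w.1, w.1.1)) =
  cent Lam' (fun w => b (w.1.2.2, w.2)) (fun w => (vres S lx w.1, w.1.1)).
Proof.
rewrite (@cent_screen _ (fun q u => ([ffun i => if i \in S then Some (u i) else None] : {ffun I -> option U}, q))).
- rewrite (@cent_screen _ (fun q u => ([ffun i => if i \in S then Some (@tg I Xa i (xvv q u i)) else None]
     : {ffun I -> option XT}, q))) //.
    move=> q u u'; congr (_, _); apply/ffunP => i; rewrite !ffunE; case: ifP => // iS; congr (Some (tg _)).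
    apply: xi_eq => j; rewrite in_cons ffunE /= => /orP[/eqP ->|hj]; first by rewrite iS.
    by rewrite (hS iS hj).
  move=> q q1 u u1 [/ffunP e eq]; split=> // i iS; have := e i.
  by rewrite !ffunE iS -eq => -[] /eqP; rewrite eq_Tagged => /eqP.
- by move=> q u u'; congr (_, _); apply/ffunP => i; rewrite !ffunE /=; case: ifP => // ->.
move=> q q1 u u1 [/ffunP e eq]; split=> // i iS; apply: xi_eq => j hj.
have jS : j \in S by move: hj; rewrite in_cons => /orP[/eqP ->//|]; exact: (hS iS).
by have := e j; rewrite !ffunE jS => -[].
Qed.

End Screening.

Lemma ent_lu (S : {set I}) :
  ent Lam' (fun w => (vres S lu w.1, w.1.1)) = \sum_(i in S) ent (p0i i) id + ent pq id.
Proof.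
have hp := pmf_p0i; have hP := pmf_prd hp.
transitivity (ent (jn pq (fun _ => prd p0i)) (fun w => (id w.1, vres S (fun i (f : {ffun I -> U}) => f i) w.2))).
  transitivity (ent Lam' (fun w => (w.1.1, vres S lu w.1))).
    by apply: ent_eq; [exact: pmf_Lam'|move=> w w' _ _ [-> ->]..].
  apply: samelaw_ent => phi; rewrite /Lam' /Lam !Ex_jn; apply: eq_Ex => q _; rewrite Ex_jn.
  apply: eq_Ex => u _; rewrite -[RHS](Ex_cst _ (hch (xvv q u))); apply: eq_Ex => y _.
  by apply: (Ex_cst (phi (q, vres S (fun i (f : {ffun I -> U}) => f i) u))); apply: pmf_prd => i; exact: pmf_ry.
by rewrite (ent_jn_indep id (vres S (fun i (f : {ffun I -> U}) => f i)) hpq hP) ent_vres_prd // addrC.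
Qed.

Section Block.
Context (n : nat) (Dd : finType) (pD : I -> Dd -> R) (hpD : forall i, pmf (pD i)).
Context (vqn : I -> {ffun 'I_n -> Qt * XT} -> {ffun 'I_n -> YT} -> Dd -> {ffun 'I_n -> VT}) (delta : R).
Context (hlaw : forall i (a : {ffun 'I_n -> Qt * XT}) (y : {ffun 'I_n -> YT}) phi,
  Ex (pD i) (fun D => phi (vqn i a y D)) = Ex (prd (fun s => ry i (a s) (y s))) phi).
Definition mui (i : I) : (Qt * XT) * YT -> R := pr Lam (fun l => (ai i l, yi i l)).
Context (hrate : forall i,
  cent (jn (prd (fun _ : 'I_n => mui i)) (fun _ => pD i))
    (fun w => vqn i [ffun s => (w.1 s).1] [ffun s => (w.1 s).2] w.2) (fun w => ([ffun s => (w.1 s).1], w.2)) <=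
  n%:R * (hVa i - hV i + delta)).

Definition Om1 : finType := ({ffun 'I_n -> base} * {ffun I -> Dd})%type.
Definition Om1law : Om1 -> R := jn (prd (fun _ : 'I_n => Lam)) (fun _ => prd pD).
Definition VV (i : I) (o : Om1) : {ffun 'I_n -> VT} :=
  vqn i [ffun r => ai i (o.1 r)] [ffun r => yi i (o.1 r)] (o.2 i).

Let hLn : pmf (prd (fun _ : 'I_n => Lam)). Proof. by apply: pmf_prd => _; exact: pmf_Lam. Qed.
Let hDn : pmf (prd pD). Proof. exact: pmf_prd. Qed.
Lemma pmf_Om1law : pmf Om1law. Proof. exact: pmf_jn. Qed.
Let hO := pmf_Om1law.
Let hLn' : pmf (prd (fun _ : 'I_n => Lam')). Proof. by apply: pmf_prd => _; exact: pmf_Lam'. Qed.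

(** For each block of inputs and outputs the quantizer has exactly the letterwise law, so averaging
    over the dither leaves independent letters of [Lam']. *)
Lemma block_law : samelaw Om1law (prd (fun _ : 'I_n => Lam')) (fun o => (o.1, [ffun i => VV i o]))
  (fun w => ([ffun r => (w r).1], [ffun i => [ffun r => (w r).2 i]])).
Proof.
move=> phi; rewrite Ex_jn.
transitivity (Ex (prd (fun _ : 'I_n => Lam)) (fun x => Ex (prd (fun r => prd (fun i => ry i (ai i (x r)) (yi i (x r)))))
  (fun v : {ffun 'I_n -> {ffun I -> VT}} => phi (x, [ffun i => [ffun r => v r i]])))); last first.
  rewrite (Ex_prd_zip (fun _ : 'I_n => Lam) (fun _ l => prd (fun i => ry i (ai i l) (yi i l)))
    (fun x (v : {ffun 'I_n -> {ffun I -> VT}}) => phi (x, [ffun i => [ffun r => v r i]]))).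
  apply: eq_Ex => y _; congr (phi (_, _)); apply/ffunP => i; rewrite !ffunE; apply/ffunP => r.
  by rewrite !ffunE.
apply: eq_Ex => x _; rewrite /VV /=.
rewrite -(Ex_prd_push pD (fun i D => vqn i [ffun r => ai i (x r)] [ffun r => yi i (x r)] D) (fun v => phi (x, v))).
rewrite -(Ex_prd_transpose_dep (fun i r => ry i (ai i (x r)) (yi i (x r))) (fun v => phi (x, v))).
apply: eq_Ex_law; apply: eq_prd => i t.
rewrite /pr (hlaw _ _ _ (fun v => (v == t)%:R)) /Ex (bigD1 t) //= eqxx mulr1 big1 ?addr0 => [|v nv].
  by apply: eq_bigr => r _; rewrite !ffunE.
by rewrite (negbTE nv) mulr0.
Qed.

Lemma block_ent (T : eqType) (z : base -> T) (C : {set I}) :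
  ent Om1law (fun o => ([ffun r => z (o.1 r)], vres C VV o)) = n%:R * ent Lam' (fun w => (z w.1, vres C lv w)).
Proof.
pose Z (y : {ffun 'I_n -> base} * {ffun I -> {ffun 'I_n -> VT}}) : {ffun 'I_n -> T} * {ffun I -> option {ffun 'I_n -> VT}} :=
  ([ffun r => z (y.1 r)], [ffun i => if i \in C then Some (y.2 i) else None]).
transitivity (ent Om1law (fun o => Z (o.1, [ffun i => VV i o]))).
  apply: ent_eq => // w w' _ _ [e1 /ffunP e2]; congr (_, _) => //; apply/ffunP => i; have := e2 i; by rewrite !ffunE.
rewrite (samelaw_ent (samelaw_comp Z block_law)).
transitivity (ent (prd (fun _ : 'I_n => Lam')) (fun w : {ffun 'I_n -> base * {ffun I -> VT}} =>
    [ffun r => (z (w r).1, vres C lv (w r))])).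
  apply: ent_eq => // w w' _ _; last first.
    move=> [/ffunP e1 /ffunP e2]; apply/ffunP => r; rewrite !ffunE; congr (_, _).
      by have := e1 r; rewrite !ffunE.
    apply/vresP => i iC; have := e2 i; rewrite !ffunE iC => -[/ffunP /(_ r)].
    by rewrite !ffunE.
  move=> /ffunP e; congr (_, _); apply/ffunP => k; rewrite !ffunE.
    by have := e k; rewrite !ffunE => -[].
  case: ifP => // kC; congr Some; apply/ffunP => r; rewrite !ffunE; have := e r; rewrite !ffunE => -[_ /vresP].
  by apply.
by rewrite (ent_prd (fun _ w => (z w.1, vres C lv w))) ?sumr_const ?card_ord ?mulr_natl // => _; exact: pmf_Lam'.
Qed.

Lemma block_cent_dither (T : finType) (z : base -> T) (C : {set I}) :
  ent Om1law (fun o => (([ffun r => z (o.1 r)], vres C VV o), o.2)) =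
  n%:R * ent Lam' (fun w => (z w.1, vres C lv w)) +
  cent Om1law (fun o => o.2) (fun o => ([ffun r => z (o.1 r)], vres C VV o)).
Proof.
rewrite -block_ent -(entE Om1law (fun o => o.2)).
by apply: ent_eq => // w w' _ _ [-> -> ->].
Qed.

(** Given all base letters, the quantized outputs are functions of the dither, so they reveal no
    more about it than their own entropy, at most the sum of the [hV i] per letter. Conditioning on
    less leaves the dither at least as uncertain. *)
Lemma block_lower (T : finType) (z : base -> T) (C : {set I}) :
  n%:R * (ent Lam' (fun w => (z w.1, vres C lv w)) - \sum_(i in C) hV i) + ent (prd pD) id <=
  ent Om1law (fun o => (([ffun r => z (o.1 r)], vres C VV o), o.2)).
Proof.
have hL' := pmf_Lam'.
rewrite block_cent_dither mulrBr -addrA lerD2l.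
apply: (@le_trans _ _ (cent Om1law (fun o => o.2) (fun o => ([ffun r => id (o.1 r)], vres C VV o)))); last first.
  apply: cent_cond => // w w' _ _ [/ffunP e ->]; congr (_, _); apply/ffunP => r; rewrite !ffunE; have := e r.
  by rewrite !ffunE => ->.
rewrite /cent (block_ent id C).
have -> : ent Om1law (fun o => (o.2, ([ffun r => id (o.1 r)], vres C VV o))) =
    n%:R * ent Lam' (fun w => w.1) + ent (prd pD) id.
  transitivity (ent Om1law (fun o => ([ffun r => id (o.1 r)], id o.2))).
    apply: ent_eq => // -[w D] [w' D'] _ _ /=; last by case=> -> ->.
    move=> [/ffunP e ->]; have -> : w = w' by apply/ffunP => r; have := e r; rewrite !ffunE.
    by [].
  rewrite (ent_jn_indep (fun w : {ffun 'I_n -> base} => [ffun r => id (w r)]) id) //; congr (_ + _).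
  rewrite (ent_prd (fun _ => id)) => [|_]; last exact: pmf_Lam.
  rewrite sumr_const card_ord mulr_natl; congr (_ *+ _); rewrite /Lam'.
  by rewrite (ent_fst _ id) // => l; apply: pmf_prd => i; exact: pmf_ry.
have h : cent Lam' (vres C lv) (fun w => w.1) <= \sum_(i in C) hV i.
  apply: (le_trans (cent_vres_le lv _ C hL')); apply: ler_sum => i _.
  by apply: cent_cond => // w w' _ _ ->.
have e : ent Lam' (fun w => (id w.1, vres C lv w)) = ent Lam' (fun w => w.1) + cent Lam' (vres C lv) (fun w => w.1).
  rewrite -entE; by apply: ent_eq => // w w' _ _ [-> ->].
have := ler_wpM2l (ler0n R n) h; rewrite e; lra.
Qed.

(** Given the inputs and the quantized output of relay i, its dither has entropy H(D) + H(V|A,D) -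
    H(V|A) on blocks, and [hrate] bounds the middle term. Hypothesis [hz] says that conditioning on
    [z] includes these inputs. *)
Lemma block_upper (T : finType) (z : base -> T) (C : {set I}) :
  (forall i l l', i \in C -> z l = z l' -> ai i l = ai i l') ->
  ent Om1law (fun o => (([ffun r => z (o.1 r)], vres C VV o), o.2)) <=
  n%:R * (ent Lam' (fun w => (z w.1, vres C lv w)) + \sum_(i in C) (delta - hV i)) + ent (prd pD) id.
Proof.
move=> hz; have hL' := pmf_Lam'; have hL := pmf_Lam.
rewrite block_cent_dither mulrDr -addrA lerD2l.
pose B (o : Om1) := ([ffun r => z (o.1 r)], vres C VV o); rewrite -/B.
apply: (@le_trans _ _ (\sum_(i in [set: I]) cent Om1law (fun o => o.2 i) B)).
  apply: (le_trans _ (cent_vres_le (fun (i : I) (o : Om1) => o.2 i) B [set: I] hO)).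
  apply: (cent_arg hO) => w w' _ _ ew; have /vresP e := congr1 fst ew.
  by apply/ffunP => i; apply: (e i); rewrite inE.
have -> : ent (prd pD) id = \sum_i ent (pD i) id.
  rewrite -(ent_prd (fun _ => id)) //; apply: ent_eq => // w w' _ _; last by move=> ->.
  by move/ffunP => e; apply/ffunP => i; have := e i; rewrite !ffunE.
rewrite mulr_sumr [X in _ <= X + _]big_mkcond -big_split /=.
rewrite (eq_bigl xpredT) => [|i]; last by rewrite inE.
apply: ler_sum => i _.
have eD : ent Om1law (fun o => o.2 i) = ent (pD i) id.
  apply: samelaw_ent => phi; rewrite Ex_jn -[RHS](Ex_cst _ hLn); apply: eq_Ex => w _.
  exact: (Ex_prd1 i phi hpD).
case: ifP => iC; last by rewrite add0r -eD cent_ent.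
pose Ai (o : Om1) : {ffun 'I_n -> Qt * XT} := [ffun r => ai i (o.1 r)].
apply: (@le_trans _ _ (cent Om1law (fun o => o.2 i) (fun o => (Ai o, VV i o)))).
  apply: cent_cond => // w w' _ _ [/ffunP e1 /vresP e2]; congr (_, _); last exact: e2.
  apply/ffunP => r; rewrite !ffunE; apply: hz => //; have := e1 r; by rewrite !ffunE.
have e1 : ent Om1law (fun o => (Ai o, VV i o)) = n%:R * (ent Lam' (fun w => ai i w.1) + hVa i).
  rewrite /hVa -entE.
  transitivity (ent Om1law (fun o => ([ffun r => ai i (o.1 r)], vres [set i] VV o))).
    apply: ent_eq => // w w' _ _ []; rewrite /Ai.
      by move=> -> /vresP e; congr (_, _); apply: e; rewrite inE.
    by move=> -> e; congr (_, _); apply/vresP => j; rewrite inE => /eqP ->.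
  rewrite block_ent; congr (_ * _); apply: ent_eq => // w w' _ _ ew.
    have e1 := congr1 fst ew; have e2 := congr1 snd ew; rewrite /= in e1 e2; rewrite e2; congr (_, _).
    by apply/vresP => j; rewrite inE => /eqP ->.
  have e2 := congr1 fst ew; have /vresP e1 := congr1 snd ew; rewrite /= in e2; rewrite e2; congr (_, _).
  by apply: e1; rewrite inE.
have e2 : ent Om1law (fun o => (o.2 i, (Ai o, VV i o))) =
   ent Om1law (fun o => (Ai o, o.2 i)) + cent Om1law (VV i) (fun o => (Ai o, o.2 i)).
  by rewrite -entE; apply: ent_eq => // w w' _ _ [-> -> ->].
have e3 : ent Om1law (fun o => (Ai o, o.2 i)) = n%:R * ent Lam' (fun w => ai i w.1) + ent (pD i) id.
  rewrite (ent_jn_indep (fun w : {ffun 'I_n -> base} => [ffun r => ai i (w r)]) (fun D : {ffun I -> Dd} => D i)) //.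
  congr (_ + _); last by apply: samelaw_ent => phi; rewrite (Ex_prd1 i phi).
  rewrite (ent_prd (fun _ => ai i)) => [|_]; last exact: pmf_Lam.
  rewrite sumr_const card_ord mulr_natl; congr (_ *+ _); rewrite /Lam'.
  by rewrite (ent_fst _ (ai i)) // => l; apply: pmf_prd => j; exact: pmf_ry.
have e4 : cent Om1law (VV i) (fun o => (Ai o, o.2 i)) <= n%:R * (hVa i - hV i + delta).
  apply: le_trans (hrate i); rewrite le_eqVlt; apply/orP; left; apply/eqP.
  apply: samelaw_cent => phi; rewrite !Ex_jn.
  pose G (w : {ffun 'I_n -> (Qt * XT) * YT}) (D : Dd) :=
    phi (vqn i [ffun s => (w s).1] [ffun s => (w s).2] D, ([ffun s => (w s).1], D)).
  rewrite [RHS](_ : _ = Ex (prd (fun s : 'I_n => mui i)) (fun w => Ex (pD i) (G w))) //.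
  rewrite (Ex_prd_push (fun _ : 'I_n => Lam) (fun _ l => (ai i l, yi i l)) (fun w => Ex (pD i) (G w))).
  apply: eq_Ex => w _; rewrite -(Ex_prd1 i (G _) hpD); apply: eq_Ex => D _; rewrite /G /VV /Ai /=.
  have -> : [ffun s => ([ffun s => (ai i (w s), yi i (w s))] s).1] = [ffun r => ai i (w r)].
    by apply/ffunP => s; rewrite !ffunE.
  by have -> : [ffun s => ([ffun s => (ai i (w s), yi i (w s))] s).2] = [ffun r => yi i (w r)]
    by apply/ffunP => s; rewrite !ffunE.
rewrite /cent e1 e2 e3; move: e4; lra.
Qed.

End Block.
End Letter.

(** The factor ln 2 converts the bits of [cmi] into nats. *)
Lemma cmi_cent {R : realType} {Om TA TB TC : finType} (P : Om -> R) (A : Om -> TA) (B : Om -> TB) (C : Om -> TC) :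
  pmf P -> cmi P A B C * ln 2 = cent P B C - cent P B (fun w => (A w, C w)).
Proof.
move=> hP; have l2 : ln 2 != 0 :> R by rewrite gt_eqF // ln_gt0 // ltr1n.
have probE (E : pred Om) : prob P E = Ex P (fun w => (E w)%:R).
  by rewrite /prob /Ex big_mkcond; apply: eq_bigr => w _; case: (E w); rewrite ?mulr1 ?mulr0.
pose J w := (A w, B w, C w).
pose F (x : TA * TB * TC) := log2 (pr P J x * pr P C x.2 /
   (pr P (fun w => (A w, C w)) (x.1.1, x.2) * pr P (fun w => (B w, C w)) (x.1.2, x.2))).
have -> : cmi P A B C = Ex (pr P J) F.
  rewrite /cmi /Ex pair_bigA pair_bigA /=; apply: eq_bigr => -[[a b] c] _ /=.
  rewrite /F /= !probE.
  have e1 : Ex P (fun w => [&& A w == a, B w == b & C w == c]%:R) = pr P J (a, b, c).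
    by apply: eq_Ex => w _; rewrite /J -!pair_eqE /= /pair_eq /= -!pair_eqE /= /pair_eq /= andbA.
  by rewrite e1; congr (_ * log2 (_ / (_ * _))); apply: eq_Ex => w _; rewrite -pair_eqE.
rewrite Ex_push -ExZr /cent /ent.
rewrite [X in _ = _ - (X - _)](_ : _ = Ex P (fun w => - ln (pr P J (J w)))); last first.
  apply: eq_Ex => w _; congr (- ln _); apply: eq_Ex => w' _.
  by rewrite /J -!pair_eqE /= /pair_eq /= -!pair_eqE /= /pair_eq /= andbCA andbA.
rewrite -!ExB; apply: eq_Ex => w /eqP pw.
have pw' : 0 < P w by rewrite lt0r (pmf_ge0 _ hP) andbT; apply/eqP.
have a1 : 0 < pr P J (J w) := pr_gt0 hP J pw'.
have a2 : 0 < pr P C (C w) := pr_gt0 hP C pw'.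
have a3 : 0 < pr P (fun w => (A w, C w)) (A w, C w) := pr_gt0 hP (fun w => (A w, C w)) pw'.
have a4 : 0 < pr P (fun w => (B w, C w)) (B w, C w) := pr_gt0 hP (fun w => (B w, C w)) pw'.
rewrite /F /= /log2 divfK // ln_div ?posrE ?mulr_gt0 // !lnM ?posrE //; lra.
Qed.

(** * The prescribed joint law as the law of the extended network *)

Section SingleLetter.
Context {R : realType} {n : nat} {Qt : finType} {Xa Ya Yh : 'I_n.+2 -> finType}.
Local Notation I := 'I_n.+2.
Local Notation XX := {dffun forall i, Xa i}.
Local Notation YY := {dffun forall i, Ya i}.
Context (ch : XX -> YY -> R) (hch : forall x, pmf (ch x)).
Context (pq : Qt -> R) (hpq : pmf pq) (g : Qt -> XX -> R) (hg : forall q, pmf (g q)).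
Context (px : forall i : I, Qt -> Xa i -> R).
Arguments px : clear implicits.
Context (hpx : forall i q, pmf (px i q)).
Context (pyh : forall i : I, Qt -> Xa i -> Ya i -> Yh i -> R).
Arguments pyh : clear implicits.
Context (hpyh : forall i q x y, pmf (pyh i q x y)).
Context (Mset : {set I}) (Msub : Mset \subset relays n) (dst1 : #|Xa ord_max| = 1%N).
Context (ns : seq I) (uns : uniq ns) (nsE : forall i, (i \in ns) = (i \in ord0 |: Mset)) (x0 : XX) (y0 : YY).

Local Notation XT := (@XT I Xa).
Local Notation YT := (@YT I Ya).
Local Notation VT := (@VT I Yh).
Local Notation jP := (joint_pmf ch Mset pq g px pyh).
Local Notation Lm := (Lam' ch pq g px pyh ns x0 y0).

Definition QQ : finType := (Qt * ({ffun I -> XT} * ({ffun I -> YT} * {ffun I -> VT})))%type.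
Definition Zp (w : Qt * (XX * (YY * {dffun forall i, Yh i}))) : QQ := (w.1, (dtag w.2.1, (dtag w.2.2.1, dtag w.2.2.2))).
Definition Zl (w : base * {ffun I -> VT}) : QQ :=
  (w.1.1, (dtag (xv ns x0 w.1.1 w.1.2.1), (dtag w.1.2.2, w.2))).

(** The product of [px] leaves out the destination, which belongs neither to [ns] nor to the relays;
    its singleton alphabet makes the missing factor 1. *)
Lemma law_x q (psi : XX -> R) :
  \sum_(x : XX) ((\sum_(x' : XX | [forall i, (i \in ord0 |: Mset) ==> (x' i == x i)]) g q x') *
    \prod_(i in relays n :\: Mset) px i q (x i)) * psi x =
  Ex (g q) (fun x' => Ex (dprd (fun i => px i q)) (fun z => psi (dmg ns x' z))).
Proof.
pose K (x' x : XX) := Ex (dprd (fun i => px i q)) (fun z => (dmg ns x' z == x)%:R).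
have hK x' x : K x' x = (agr ns x' x)%:R * \prod_(i in relays n :\: Mset) px i q (x i).
  pose h i (t : XT) : R := ((i \in ns) || (t == @tg I Xa i (x i)))%:R.
  have hE z : (dmg ns x' z == x)%:R = (agr ns x' x)%:R * \prod_i h i (dtag z i) :> R.
    case: (boolP (agr ns x' x)) => [/agrP ha|na]; last first.
      rewrite mul0r; case: eqP => // e; case/negP: na; apply/agrP => i hi.
      by rewrite -e ffunE hi.
    rewrite mul1r; case: eqP => [e|ne].
      rewrite big1 // => i _; rewrite /h ffunE -e ffunE; case: (i \in ns) => //=.
      by rewrite eqxx.
    case: (pickP (fun i => (i \notin ns) && (z i != x i))) => [i /andP[ni nz]|al].
      rewrite (bigD1 i) //= /h ffunE (negbTE ni) /= (inj_eq (@tg_inj _ _ i)) (negbTE nz).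
      by rewrite mul0r.
    case: ne; apply/ffunP => i; rewrite ffunE; case: (boolP (i \in ns)) => hi; first exact: ha.
    by have := al i; rewrite hi /= => /negbFE/eqP.
  rewrite /K; under eq_Ex do rewrite hE; rewrite ExZ; congr (_ * _).
  rewrite (Ex_dprd (fun i => hpx i q) (fun f => \prod_i h i (f i))) Ex_prd_prod.
  rewrite [RHS]big_mkcond; apply: eq_bigr => i _; rewrite Ex_push /h.
  have hrel : (i \in relays n :\: Mset) = (i \notin ns) && (i != ord_max).
    rewrite nsE !inE; case: (boolP (i \in Mset)) => iM /=; first by rewrite orbT.
    rewrite orbF -lt0n -[i != ord_max]/(_ != _) -(inj_eq val_inj) /=.
    by have := ltn_ord i; lia.
  rewrite hrel; case: (boolP (i \in ns)) => hi /=; first by rewrite Ex_cst.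
  have e : Ex (px i q) (fun w => (@tg I Xa i w == @tg I Xa i (x i))%:R) = px i q (x i).
    by have := pr_tg (fun i => px i q) (x i).
  rewrite e; case: (eqVneq i ord_max) => [ei|] //=.
  have [_ h1] := hpx i q; rewrite -h1 (bigD1 (x i)) //= big1 ?addr0 // => y ny.
  have : #|Xa i| = 1%N by rewrite ei dst1.
  by rewrite (cardD1 (x i)) (cardD1 y) !inE ny.
transitivity (Ex (g q) (fun x' => \sum_x K x' x * psi x)).
  rewrite Ex_sum; apply: eq_bigr => x _; rewrite ExZr; congr (_ * _).
  under eq_Ex do rewrite hK; rewrite ExZr; congr (_ * _); rewrite [LHS]big_mkcond.
  apply: eq_bigr => x' _; rewrite [X in if X then _ else _](_ : _ = agr ns x' x); last first.
    by apply: eq_forallb => i; rewrite nsE.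
  by case: (agr _ _ _); rewrite ?mulr1 ?mulr0.
apply: eq_Ex => x' _; rewrite /K; under eq_bigr do rewrite -ExZr.
rewrite -Ex_sum; apply: eq_Ex => z _; rewrite (bigD1 (dmg ns x' z)) //= eqxx mul1r big1 ?addr0 // => x nx.
by rewrite eq_sym (negbTE nx) mul0r.
Qed.

Lemma joint_law : ns != [::] -> samelaw jP Lm Zp Zl.
Proof.
move=> n0 phi; have hp0 := pmf_p0 hg hpx ns.
pose Psi q x := Ex (ch x) (fun y => Ex (dprd (fun i => pyh i q (x i) (y i))) (fun yh => phi (Zp (q, (x, (y, yh)))))).
transitivity (Ex pq (fun q => Ex (g q) (fun x' => Ex (dprd (fun i => px i q)) (fun z => Psi q (dmg ns x' z))))).
  pose W q (x : XX) := (\sum_(x' : XX | [forall i, (i \in ord0 |: Mset) ==> (x' i == x i)]) g q x') *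
    \prod_(i in relays n :\: Mset) px i q (x i).
  transitivity (\sum_q pq q * \sum_x (W q x * Psi q x)); last by apply: eq_bigr => q _; rewrite -law_x.
  under [RHS]eq_bigr do rewrite mulr_sumr.
  rewrite pair_bigA /=.
  transitivity (\sum_(w : Qt * XX) \sum_(w' : YY * {dffun forall i, Yh i}) jP (w.1, (w.2, w')) * phi (Zp (w.1, (w.2, w')))).
    rewrite pair_bigA /= [RHS](reindex (fun w : Qt * (XX * (YY * {dffun forall i, Yh i})) => ((w.1, w.2.1), w.2.2))) /=.
      by apply: eq_bigr => -[q [x w]] _.
    by exists (fun w => (w.1.1, (w.1.2, w.2))) => [[q [x w]]|[[q x] w]].
  apply: eq_bigr => -[q x] _ /=; rewrite /Psi /Ex.
  under [X in _ * (_ * X)]eq_bigr do rewrite mulr_sumr.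
  rewrite pair_bigA !mulr_sumr; apply: eq_bigr => -[y yh] _ /=.
  by rewrite /joint_pmf /= /dprd !mulrA.
rewrite /Lam' /Lam !Ex_jn; apply: eq_Ex => q _; rewrite Ex_jn.
rewrite -(law_xv hg hpx uns x0 q (Psi q) n0); apply: eq_Ex => u _; apply: eq_Ex => y _.
rewrite /Zp /Zl /= (Ex_dprd (fun i => @hpyh i q _ _) (fun v => phi (q, (dtag (xv ns x0 q u), (dtag y, v))))).
by apply: eq_Ex_law; apply: eq_prd => i t; rewrite /ry /ai /yi /= !utgK.
Qed.

End SingleLetter.

Lemma restrP {n : nat} {F : 'I_n.+2 -> finType} (S : {set 'I_n.+2}) (v v' : {dffun forall i, F i}) :
  restr S v = restr S v' <-> {in S, forall i, v i = v' i}.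
Proof.
split=> [/ffunP h i iS|h]; first by have := h i; rewrite !ffunE iS => -[].
by apply/ffunP => i; rewrite !ffunE; case: ifP => // /h ->.
Qed.

(** * From mutual informations to conditional entropies *)

Section RateBound.
Context {R : realType} {n : nat} {Qt : finType} {Xa Ya Yh : 'I_n.+2 -> finType}.
Local Notation I := 'I_n.+2.
Local Notation XX := {dffun forall i, Xa i}.
Local Notation YY := {dffun forall i, Ya i}.
Local Notation HH := {dffun forall i, Yh i}.
Local Notation QQ := (@QQ n Qt Xa Ya Yh).
Local Notation Zp := (@Zp n Qt Xa Ya Yh).
Definition Omj : finType := (Qt * (XX * (YY * HH)))%type.
Context (P : Omj -> R) (hP : pmf P).

Definition cq (z : QQ) := z.1.
Definition cx (i : I) (z : QQ) := z.2.1 i.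
Definition cy (i : I) (z : QQ) := z.2.2.1 i.
Definition cv (i : I) (z : QQ) := z.2.2.2 i.
Definition LL : QQ -> R := pr P Zp.
Lemma pmf_LL : pmf LL. Proof. exact: pmf_push. Qed.

Lemma cent_LL (T T' : eqType) (A : QQ -> T) (B : QQ -> T') : cent P (fun w => A (Zp w)) (fun w => B (Zp w)) = cent LL A B.
Proof. by apply: samelaw_cent => phi; rewrite Ex_push. Qed.

Lemma vcx S (w w' : Omj) : vres S cx (Zp w) = vres S cx (Zp w') <-> {in S, forall i, w.2.1 i = w'.2.1 i}.
Proof.
split=> [/vresP h i iS|h]; last by apply/vresP => i iS; rewrite /cx /Zp /= !ffunE h.
by have := h i iS; rewrite /cx /Zp /= !ffunE => /tg_inj.
Qed.

Lemma vcy S (w w' : Omj) : vres S cy (Zp w) = vres S cy (Zp w') <-> {in S, forall i, w.2.2.1 i = w'.2.2.1 i}.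
Proof.
split=> [/vresP h i iS|h]; last by apply/vresP => i iS; rewrite /cy /Zp /= !ffunE h.
by have := h i iS; rewrite /cy /Zp /= !ffunE => /tg_inj.
Qed.

Lemma vcv S (w w' : Omj) : vres S cv (Zp w) = vres S cv (Zp w') <-> {in S, forall i, w.2.2.2 i = w'.2.2.2 i}.
Proof.
split=> [/vresP h i iS|h]; last by apply/vresP => i iS; rewrite /cv /Zp /= !ffunE h.
by have := h i iS; rewrite /cv /Zp /= !ffunE => /tg_inj.
Qed.

Lemma ccy m (w w' : Omj) : cy m (Zp w) = cy m (Zp w') <-> w.2.2.1 m = w'.2.2.1 m.
Proof. by rewrite /cy /Zp /= !ffunE; split=> [/tg_inj|->]. Qed.

Lemma inU (S S' : {set I}) (Q : I -> Prop) :
  {in S :|: S', forall i, Q i} <-> {in S, forall i, Q i} /\ {in S', forall i, Q i}.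
Proof.
split=> [h|[h h'] i]; last by rewrite inE => /orP[/h|/h'].
by split=> i iS; apply: h; rewrite inE iS ?orbT.
Qed.

(** With C = T \ S, the negative terms H(Yhat_C, Y | X, Q) and H(Yhat_S | Yhat_C, Y, X, Q) merge by
    the chain rule into one entropy of (Yhat_T, Y). The remaining H(Yhat_S | Y_S, ...) splits into
    single relays by subadditivity. *)
Lemma rate_bound (m : I) (A B Pi S T : {set I}) : A :|: B = Pi -> S \subset T ->
  (cmi P (fun w : Omj => (restr A w.2.1, restr S w.2.1))
         (fun w : Omj => (restr (T :\: S) w.2.2.2, w.2.2.1 m))
         (fun w : Omj => (restr (T :\: S) w.2.1, restr B w.2.1, w.1)) -
   cmi P (fun w : Omj => restr S w.2.2.1) (fun w : Omj => restr S w.2.2.2)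
         (fun w : Omj => (restr Pi w.2.1, restr T w.2.1, w.2.2.1 m, restr (T :\: S) w.2.2.2, w.1))) * ln 2 <=
  cent LL (fun z => (cy m z, vres (T :\: S) cv z)) (fun z => (vres ((T :\: S) :|: B) cx z, cq z)) -
  cent LL (fun z => (cy m z, vres T cv z)) (fun z => (vres (T :|: Pi) cx z, cq z)) +
  \sum_(i in S) cent LL (cv i) (fun z => ((cq z, cx i z), cy i z)).
Proof.
move=> AB ST; have hL := pmf_LL; set C := T :\: S.
have TE : C :|: S = T by rewrite setUC /C -{1}(setIidPr ST) setID.
rewrite mulrBl !cmi_cent //.
pose bb z := (cy m z, vres C cv z).
pose cc z := (vres (T :|: Pi) cx z, cq z).
have PiT (w w' : Omj) : {in T :|: Pi, forall i, w.2.1 i = w'.2.1 i} <->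
   [/\ {in A, forall i, w.2.1 i = w'.2.1 i}, {in B, forall i, w.2.1 i = w'.2.1 i},
       {in C, forall i, w.2.1 i = w'.2.1 i} & {in S, forall i, w.2.1 i = w'.2.1 i}].
  rewrite -AB -TE !inU; by split=> [[[? ?] [? ?]]|[? ? ? ?]].
have t1 : cent P (fun w : Omj => (restr C w.2.2.2, w.2.2.1 m)) (fun w : Omj => (restr C w.2.1, restr B w.2.1, w.1)) =
   cent LL bb (fun z => (vres (C :|: B) cx z, cq z)).
  rewrite -cent_LL; apply: cent_eq => // w w' _ _ /=.
  - by move=> [/restrP e1 /restrP e2 e3]; congr (_, _) => //; apply/vcx/inU.
  - by move=> [/vcx/inU[e1 e2] e3]; congr (_, _, _) => //; exact/restrP.
  - by move=> [/restrP e1 e2 _ _ _]; congr (_, _); [exact/ccy|exact/vcv].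
  by move=> [/ccy e1 /vcv e2 _ _]; congr (_, _) => //; exact/restrP.
have t2 : cent P (fun w : Omj => (restr C w.2.2.2, w.2.2.1 m))
    (fun w : Omj => ((restr A w.2.1, restr S w.2.1), (restr C w.2.1, restr B w.2.1, w.1))) = cent LL bb cc.
  rewrite -cent_LL; apply: cent_eq => // w w' _ _ /=.
  - by move=> [/restrP e1 /restrP e2 /restrP e3 /restrP e4 e5]; congr (_, _) => //; apply/vcx/PiT; split.
  - move=> [/vcx/PiT[e1 e2 e3 e4] e5]; congr (_, _, (_, _, _)) => //; exact/restrP.
  - by move=> [/restrP e1 e2 _ _ _ _ _]; congr (_, _); [exact/ccy|exact/vcv].
  by move=> [/ccy e1 /vcv e2 _ _]; congr (_, _) => //; exact/restrP.
have t3 : cent P (fun w : Omj => restr S w.2.2.2)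
    (fun w : Omj => (restr Pi w.2.1, restr T w.2.1, w.2.2.1 m, restr C w.2.2.2, w.1)) =
    cent LL (vres S cv) (fun z => (cc z, bb z)).
  rewrite -cent_LL; apply: cent_eq => // w w' _ _ /=.
  - move=> [/restrP e1 /restrP e2 e3 /restrP e4 e5]; rewrite /cc /bb; congr (_, _, (_, _)) => //.
    + by apply/vcx/inU.
    + exact/ccy.
    + exact/vcv.
  - move=> [/vcx/inU[e1 e2] e3 /ccy e4 /vcv e5]; congr (_, _, _, _, _) => //; exact/restrP.
  - by move=> [/restrP e1 _ _ _ _ _]; exact/vcv.
  by move=> [/vcv e1 _ _ _ _]; exact/restrP.
have t4 : cent P (fun w : Omj => restr S w.2.2.2)
    (fun w : Omj => (restr S w.2.2.1, (restr Pi w.2.1, restr T w.2.1, w.2.2.1 m, restr C w.2.2.2, w.1))) <=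
    \sum_(i in S) cent LL (cv i) (fun z => ((cq z, cx i z), cy i z)).
  rewrite (@cent_eq _ _ _ hP _ _ _ _ _ (fun w => vres S cv (Zp w)) _ (fun w => (vres S cy (Zp w), (cc (Zp w), bb (Zp w))))).
  - rewrite (cent_LL (vres S cv) (fun z => (vres S cy z, (cc z, bb z)))).
    apply: (le_trans (cent_vres_le cv _ S hL)); apply: ler_sum => i iS.
    apply: cent_cond => // z z' _ _ [/vresP e1 /vresP e2 e3 _ _]; congr (_, _, _) => //; last exact: e1.
    by apply: e2; rewrite inE (subsetP ST).
  - move=> w w' _ _ [/restrP e0 /restrP e1 /restrP e2 e3 /restrP e4 e5]; rewrite /cc /bb; congr (_, (_, _, (_, _))) => //.
    + exact/vcy.
    + by apply/vcx/inU.
    + exact/ccy.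
    + exact/vcv.
  - move=> w w' _ _ [/vcy e0 /vcx/inU[e1 e2] e3 /ccy e4 /vcv e5]; congr (_, (_, _, _, _, _)) => //; exact/restrP.
  - by move=> w w' _ _ [/restrP e1 _ _ _ _ _ _]; exact/vcv.
  by move=> w w' _ _ [/vcv e1 _ _ _ _ _]; exact/restrP.
have t5 : cent LL bb cc + cent LL (vres S cv) (fun z => (cc z, bb z)) =
   cent LL (fun z => (cy m z, vres T cv z)) (fun z => (vres (T :|: Pi) cx z, cq z)).
  rewrite -/cc -(cent_eq hL (A := fun z => (bb z, vres S cv z)) (A' := fun z => (cy m z, vres T cv z)) (B := cc)) //; last 2 first.
  - move=> z z' _ _ [e1 /vresP e2 /vresP e3 _ _]; rewrite /bb; congr (_, _) => //.
    by apply/vresP => i; rewrite -TE inE => /orP[/e2|/e3].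
  - move=> z z' _ _ [e1 /vresP e2 _ _]; rewrite /bb; congr (_, _, _) => //; apply/vresP => i iS; apply: e2.
      by rewrite -TE inE iS.
    by rewrite -TE inE iS orbT.
  rewrite (cent_chain hL bb (vres S cv) cc); congr (_ + _); apply: (cent_eq hL) => // z z' _ _; rewrite /bb /cc.
  - by move=> [-> -> -> ->].
  - by move=> [-> -> -> ->].
  - by move=> [-> _ _ _ _].
  - by move=> [-> _ _ _ _].
rewrite t1 t2 t3 -t5; move: t4; lra.
Qed.

End RateBound.

(** * A common block length for all quantizers *)

Section QuantizerFamily.
Context {R : realType} {I Qt : finType} {Xa Ya Yh : I -> finType}.
Local Notation XX := {dffun forall i, Xa i}.
Local Notation YY := {dffun forall i, Ya i}.
Context (ch : XX -> YY -> R) (hch : forall x, pmf (ch x)).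
Context (pq : Qt -> R) (hpq : pmf pq) (g : Qt -> XX -> R) (hg : forall q, pmf (g q)).
Context (px : forall i, Qt -> Xa i -> R).
Arguments px : clear implicits.
Context (hpx : forall i q, pmf (px i q)).
Context (pyh : forall i, Qt -> Xa i -> Ya i -> Yh i -> R).
Arguments pyh : clear implicits.
Context (hpyh : forall i q x y, pmf (pyh i q x y)).
Context (ns : seq I) (uns : uniq ns) (x0 : XX) (y0 : YY).
Local Notation A := (Qt * @XT I Xa)%type.
Local Notation YT := (@YT I Ya).
Local Notation VT := (@VT I Yh).
Local Notation Lm := (Lam ch pq g px ns x0).
Local Notation mu i := (mui (Ya := Ya) ch pq g px ns x0 i).
Local Notation rr i := (ry pyh x0 y0 i).

Lemma samelaw_qlaw i : samelaw (qlaw (mu i) (rr i)) (Lam' ch pq g px pyh ns x0 y0) id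
  (fun w => ((ai ns x0 i w.1, yi i w.1), w.2 i)).
Proof.
move=> phi; rewrite [LHS]Ex_jn [RHS]Ex_jn Ex_push; apply: eq_Ex => l _.
rewrite -(Ex_prd1 i _ (fun j => pmf_ry hpyh x0 y0 j (ai ns x0 j l) (yi j l))).
by [].
Qed.

Lemma quantizer_family (delta : R) : 0 < delta ->
  exists n : nat, (0 < n)%N /\ exists (Dd : finType) (pD : I -> Dd -> R)
    (q : I -> {ffun 'I_n -> A} -> {ffun 'I_n -> YT} -> Dd -> {ffun 'I_n -> VT}),
  [/\ forall i, pmf (pD i),
      forall i a y phi, Ex (pD i) (fun D => phi (q i a y D)) = Ex (prd (fun s => rr i (a s) (y s))) phi
    & forall i, cent (jn (prd (fun _ : 'I_n => mu i)) (fun _ => pD i))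
        (fun w => q i [ffun s => (w.1 s).1] [ffun s => (w.1 s).2] w.2) (fun w => ([ffun s => (w.1 s).1], w.2)) <=
      n%:R * (hVa ch pq g px pyh ns x0 y0 i - hV ch pq g px pyh ns x0 y0 i + delta)].
Proof.
move=> dl0; have hL := pmf_Lam hch hpq hg hpx ns x0.
have hmu i : pmf (mu i) by exact: pmf_push.
have hr i a y : pmf (rr i a y) by exact: pmf_ry.
have [N0 hN] := eventually_fin (fun i => block_quantizer (hmu i) (hr i) dl0).
pose n := N0.+1; exists n; split=> //.
pose Ty := {Dd : finType & ((Dd -> R) * ({ffun 'I_n -> A} -> {ffun 'I_n -> YT} -> Dd -> {ffun 'I_n -> VT}))%type}.
have /boolp.choice[f hf] : forall i, exists y : Ty,
  [/\ pmf (projT2 y).1,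
      forall a t phi, Ex (projT2 y).1 (fun D => phi ((projT2 y).2 a t D)) = Ex (prd (fun s => rr i (a s) (t s))) phi
    & cent (jn (prd (fun _ : 'I_n => mu i)) (fun _ => (projT2 y).1))
        (fun w => (projT2 y).2 [ffun s => (w.1 s).1] [ffun s => (w.1 s).2] w.2) (fun w => ([ffun s => (w.1 s).1], w.2)) <=
      n%:R * (hVA (mu i) (rr i) - hVAY (mu i) (rr i) + delta)].
  move=> i; have [Dd [pD [q [h1 h2 h3]]]] := hN n (leqnSn N0) i isT.
  by exists (existT _ Dd (pD, q)).
pose DT i : finType := projT1 (f i).
pose pd i : DT i -> R := (projT2 (f i)).1.
have hpd i : pmf (pd i) by have [] := hf i.
have d0 i : DT i.
  have h : exists x : DT i, xpredT x by have [x _] := pmf_inhab (hpd i); exists x.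
  exact: (xchoose h).
(* The dither alphabets differ from node to node; their disjoint union serves as a common one. *)
exists {i : I & DT i}, (fun i => pr (pd i) (@tg I DT i)), (fun i a y D => (projT2 (f i)).2 a y (utg (d0 i) D)).
split=> [i|i a y phi|i]; first exact: pmf_push.
  by rewrite Ex_push; have [_ h _] := hf i; rewrite -h; apply: eq_Ex => D _; rewrite utgK.
have [_ _ h] := hf i.
have <- : hVA (mu i) (rr i) = hVa ch pq g px pyh ns x0 y0 i.
  apply: samelaw_cent; exact: (samelaw_comp (fun w => (w.2, w.1.1)) (samelaw_qlaw i)).
have <- : hVAY (mu i) (rr i) = hV ch pq g px pyh ns x0 y0 i.
  apply: samelaw_cent; exact: (samelaw_comp (fun w => (w.2, w.1)) (samelaw_qlaw i)).
apply: le_trans h; rewrite le_eqVlt; apply/orP; left; apply/eqP.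
have hi : injective (fun x : {ffun 'I_n -> A} * DT i => (x.1, @tg I DT i x.2)).
  by move=> [a D] [a' D'] [-> /eqP]; rewrite eq_Tagged /= => /eqP ->.
pose sV (x : {ffun 'I_n -> A * YT} * DT i) := (projT2 (f i)).2 [ffun s => (x.1 s).1] [ffun s => (x.1 s).2] x.2.
transitivity (cent (jn (prd (fun _ : 'I_n => mu i)) (fun _ => pd i)) sV (fun x => ([ffun s => (x.1 s).1], @tg I DT i x.2))).
  apply: samelaw_cent => phi; rewrite !Ex_jn; apply: eq_Ex => w _; rewrite Ex_push.
  by apply: eq_Ex => D _; rewrite /sV /= utgK.
have hJ : pmf (jn (prd (fun _ : 'I_n => mu i)) (fun _ => pd i)) by apply: pmf_jn => //; exact: pmf_prd.
apply: (cent_eq hJ) => // w w' _ _; rewrite /sV.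
- by move=> [-> e]; congr (_, _); move/eqP: e; rewrite eq_Tagged => /eqP.
- by move=> [-> ->].
- by move=> [-> _ _].
- by move=> [-> _ _].
Qed.

End QuantizerFamily.

(** * The extended network with time sharing, superposition and compression *)

Section Net1.
Context {R : realType} {nn : nat} {Qt : finType} {Xa Ya Yh : 'I_nn.+2 -> finType}.
Local Notation I := 'I_nn.+2.
Local Notation XX := {dffun forall i, Xa i}.
Local Notation YY := {dffun forall i, Ya i}.
Context (ch : XX -> YY -> R) (chP : is_channel ch).
Context (pq : Qt -> R) (hpq : pmf pq) (g : Qt -> XX -> R) (hg : forall q, pmf (g q)).
Context (px : forall i : I, Qt -> Xa i -> R).
Arguments px : clear implicits.
Context (hpx : forall i q, pmf (px i q)).
Context (pyh : forall i : I, Qt -> Xa i -> Ya i -> Yh i -> R).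
Arguments pyh : clear implicits.
Context (hpyh : forall i q x y, pmf (pyh i q x y)).
Context (K : nat) (pi : 'I_K.+1 -> I) (pinj : injective pi) (x0 : XX) (y0 : YY).
Local Notation wp := (wpi pi).
Definition nsp : seq I := [seq wpi pi j | j <- enum 'I_K].
Local Notation ns := nsp.
Local Notation U := (@U0 I Qt Xa).
Local Notation XT := (@XT I Xa).
Local Notation YT := (@YT I Ya).
Local Notation VT := (@VT I Yh).
Local Notation Lm := (Lam ch pq g px ns x0).
Local Notation Lm' := (Lam' ch pq g px pyh ns x0 y0).

Lemma uniq_nsp : uniq ns.
Proof. by rewrite map_inj_uniq ?enum_uniq //; exact: wpi_inj. Qed.

Lemma mem_nsp i : (i \in ns) = (i \in tx pi).
Proof.
apply/mapP/imsetP => [[j _ ->]|[j _ ->]]; first by exists j.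
by exists j => //; rewrite mem_enum.
Qed.

Lemma tail_wpi (j : 'I_K) i : i \in tail ns (wp j) -> exists2 j' : 'I_K, (j < j')%N & i = wp j'.
Proof.
rewrite /tail /ns index_map; last exact: wpi_inj.
rewrite index_enum_ord -map_drop => /mapP[j' hj ->]; exists j' => //.
have : val j' \in drop j.+1 (map val (enum 'I_K)) by rewrite -map_drop; exact: (@map_f _ _ val _ j' hj).
by rewrite val_enum_ord drop_iota mem_iota add0n => /andP[].
Qed.

Lemma tail_cf i : i \notin tx pi -> tail ns i = [::].
Proof. by rewrite -mem_nsp => h; exact: tail_notin. Qed.

Context (nb : nat) (Dd : finType) (pD : I -> Dd -> R) (hpD : forall i, pmf (pD i)).
Context (vqn : I -> {ffun 'I_nb -> Qt * XT} -> {ffun 'I_nb -> YT} -> Dd -> {ffun 'I_nb -> VT}).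

Definition U1 : finType := {ffun 'I_nb -> U}.
Definition S1 : finType := ({ffun 'I_nb -> Qt} * {ffun I -> Dd})%type.
Definition pS : S1 -> R := jn (prd (fun _ => pq)) (fun _ => prd pD).
Definition O1n : finType := (S1 * {ffun 'I_nb -> YY})%type.
Definition Ob1 : finType := (S1 * {ffun 'I_nb -> YT})%type.
Definition obs1 (i : I) (o : O1n) : Ob1 := (o.1, [ffun r => obs0 i (o.2 r)]).
Definition enc1 (s : S1) (i : I) (a : {ffun I -> U1}) (r : 'I_nb) : XX :=
  st x0 (s.1 r) [ffun i' => a i' r] (i :: tail ns i).
(** Node i holds its own version of the letters of all nodes; [W1n_coh] says which of these versions
    have to agree. *)
Definition W1n (a : {ffun I -> {ffun I -> U1}}) : O1n -> R :=
  jn pS (fun s => prd (fun r => W0 ch [ffun i => enc1 s i (a i) r])).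
Definition p1n (i : I) : U1 -> R := prd (fun _ : 'I_nb => p0 g px ns i).
Definition kp1 (u : {ffun I -> U1}) : O1n -> R := W1n [ffun=> u].
(** A compressing relay has no successors, so its input is the entry of its own table at the default
    vector. The quantizer is then a function of the relay's own letter and observation. *)
Definition yq1 (i : I) (u : U1) (ob : Ob1) : {ffun 'I_nb -> VT} :=
  vqn i [ffun r => (ob.1.1 r, @tg I Xa i (u r (ob.1.1 r, dres x0 [::] x0) i))] ob.2 (ob.1.2 i).

Let hp0 i : pmf (p0 g px ns i). Proof. exact: pmf_p0. Qed.
Let hch x : pmf (ch x). Proof. by have [h1 h2] := chP x; split. Qed.
Lemma pmf_pS : pmf pS. Proof. by apply: pmf_jn => [|_]; exact: pmf_prd. Qed.
Lemma pmf_W1n a : pmf (W1n a).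
Proof. by apply: pmf_jn => [|s]; [exact: pmf_pS|apply: pmf_prd => r; exact: pmf_W0]. Qed.
Lemma pmf_p1n i : pmf (p1n i). Proof. exact: pmf_prd. Qed.

Lemma impl_W1n : impl (W0 ch) obs0 W1n obs1 nb.
Proof.
apply: (@impl_open R I _ _ _ _ _ _ (W0 ch) obs0 W1n obs1 S1 pS nb enc1 (fun s y => (s, y)) (fun s y => (s, y)) x0 y0).
- exact: pmf_pS.
- by [].
by move=> a phi; rewrite Ex_jn.
Qed.

Lemma W1n_coh (a : {ffun I -> {ffun I -> U1}}) (u : {ffun I -> U1}) :
  (forall i, i \notin tx pi -> a i i = u i) ->
  (forall j j' : 'I_K, (j <= j')%N -> a (wp j) (wp j') = u (wp j')) -> W1n a =1 kp1 u.
Proof.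
move=> h1 h2 [s y]; rewrite /kp1 /W1n /jn /=; congr (_ * _); apply: eq_prd => r z.
congr (W0 ch _ z); apply/ffunP => i; rewrite !ffunE; apply: eq_st => i'; rewrite in_cons !ffunE.
case: (boolP (i \in tx pi)) => [/imsetP[j _ ->]|hi].
  case/orP => [/eqP ->|/tail_wpi[j' hj ->]]; first by rewrite h2.
  by rewrite h2 // ltnW.
by rewrite (tail_cf hi) in_nil orbF => /eqP ->; rewrite h1.
Qed.

Local Notation Om1 := (@Om1 I Qt Xa Ya nb Dd).
Local Notation Omlaw := (Om1law ch pq g px ns x0 pD (n := nb)).
Local Notation VVn := (VV (Yh := Yh) ns x0 vqn).
Local Notation Al := (Alaw p1n kp1).

Definition mA (o : Om1) : @A1 I U1 O1n :=
  ([ffun i => [ffun r => (o.1 r).2.1 i]], (([ffun r => (o.1 r).1], o.2), [ffun r => (o.1 r).2.2])).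

Lemma law_mA : samelaw Al Omlaw id mA.
Proof.
move=> phi; rewrite /Alaw /Om1law !Ex_jn.
pose F q (u : {ffun 'I_nb -> {ffun I -> U}}) y D : R :=
  phi ([ffun i => [ffun r => u r i]], ((q, D), y)).
transitivity (Ex (prd (fun _ : 'I_nb => prd (p0 g px ns))) (fun u => Ex (prd (fun _ : 'I_nb => pq)) (fun q =>
   Ex (prd (fun r => ch (xv ns x0 (q r) (u r)))) (fun y => Ex (prd pD) (F q u y))))).
  rewrite (Ex_prd_transpose (fun i => p0 g px ns i)); apply: eq_Ex => u _.
  rewrite /kp1 /W1n /pS Ex_jn Ex_jn; apply: eq_Ex => q _; rewrite [RHS]Ex_swap; apply: eq_Ex => D _.
  rewrite /F /=; apply: eq_Ex_law; apply: eq_prd => r y; rewrite /W0; congr (ch _ y).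
  apply/ffunP => i; rewrite [LHS]ffunE [RHS]ffunE ffunE /enc1 /xi; congr (st x0 _ _ _ i); apply/ffunP => i'.
  by rewrite !ffunE.
rewrite Ex_swap.
transitivity (Ex (prd (fun _ : 'I_nb => pq)) (fun q =>
   Ex (prd (fun r => jn (prd (p0 g px ns)) (fun u => ch (xv ns x0 (q r) u)))) (fun uy =>
     Ex (prd pD) (F q [ffun r => (uy r).1] [ffun r => (uy r).2])))).
  apply: eq_Ex => q _.
  exact: (Ex_prd_zip (fun _ : 'I_nb => prd (p0 g px ns)) (fun r u => ch (xv ns x0 (q r) u)) (fun u y => Ex (prd pD) (F q u y))).
rewrite (Ex_prd_zip (fun _ : 'I_nb => pq) (fun _ q => jn (prd (p0 g px ns)) (fun u => ch (xv ns x0 q u)))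
  (fun q (uy : {ffun 'I_nb -> {ffun I -> U} * YY}) => Ex (prd pD) (F q [ffun r => (uy r).1] [ffun r => (uy r).2]))).
apply: eq_Ex => w _; apply: eq_Ex => D _; rewrite /F /mA /=.
congr (phi (_, (_, _))).
  by apply/ffunP => i; rewrite !ffunE; apply/ffunP => r; rewrite !ffunE.
by apply/ffunP => r; rewrite !ffunE.
Qed.

Lemma ent_Al (T : eqType) (F : @A1 I U1 O1n -> T) : ent Al F = ent Omlaw (fun o => F (mA o)).
Proof. exact: (samelaw_ent (samelaw_comp F law_mA)). Qed.

Lemma ent_p1n i : ent (p1n i) id = nb%:R * ent (p0 g px ns i) id.
Proof.
have hp1 := pmf_p1n i.
transitivity (ent (p1n i) (fun f : U1 => [ffun c => id (f c)])).
  by apply: ent_eq => // v v' _ _; [move/ffunP => e; apply/ffunP => c; have := e c; rewrite !ffunE|move=> ->].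
by rewrite (ent_prd (fun _ : 'I_nb => id)) ?sumr_const ?card_ord ?mulr_natl.
Qed.

Lemma ent_aU C : ent Al (vres C (@aU I U1 O1n)) = nb%:R * \sum_(i in C) ent (p0 g px ns i) id.
Proof.
have := @ent_fst _ _ _ (prd p1n) kp1 _ (vres C (fun i (f : {ffun I -> U1}) => f i)) (fun u => pmf_W1n _).
rewrite (ent_vres_prd C pmf_p1n) mulr_sumr => e; rewrite -[RHS](_ : \sum_(j in C) ent (p1n j) id = _).
  by rewrite -e.
by apply: eq_bigr => i _; exact: ent_p1n.
Qed.

Definition bset (k : nat) : {set I} := [set wp j | j : 'I_K & (k <= j)%N].
Definition zl (S : {set I}) (m : I) (l : @base I Qt Xa Ya) := ((vres S (lu (Ya := Ya)) l, l.1), yi m l).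

Lemma av_mA i (o : Om1) : i \notin tx pi -> av obs1 yq1 i (mA o) = ([ffun r => (o.1 r).2.1 i], VVn i o).
Proof.
move=> hi; rewrite /av /mA /= ffunE; congr (_, _); rewrite /yq1 /VV /=; congr (vqn i _ _ _).
  have ex q (u : {ffun I -> U}) : xv ns x0 q u i = u i (q, dres x0 [::] x0) i.
    by rewrite ffunE /xi (tail_cf hi) /= ffunE.
  by apply/ffunP => r; rewrite [LHS]ffunE [RHS]ffunE /ai ex !ffunE.
by apply/ffunP => r; rewrite !ffunE.
Qed.

Lemma ent_Wf (k : 'I_K.+1) (j : nat) (C S : {set I}) : C \subset ~: tx pi -> S = C :|: bset j ->
  ent Al (Wf obs1 yq1 (zk pi obs1 k j) C) =
  ent Omlaw (fun o => (([ffun r => zl S (pi k) (o.1 r)], vres C VVn o), o.2)).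
Proof.
move=> hC hS; rewrite ent_Al; have hO := pmf_Om1law hch hpq hg hpx ns x0 nb hpD.
have cf i : i \in C -> i \notin tx pi by move=> iC; have := subsetP hC i iC; rewrite inE.
apply: ent_eq => // w w' _ _; rewrite /Wf /zk /zl /=.
  move=> [/ffunP e1 /vresP e2 e3]; congr (_, (_, (_, _))).
  - apply/vresP => i iC; rewrite !av_mA ?cf //; congr (_, _); last exact: e2.
    apply/ffunP => r; rewrite !ffunE; have := e1 r; rewrite !ffunE => -[/vresP h _ _].
    by apply: h; rewrite hS inE iC.
  - apply/xresP => j' hj; rewrite !ffunE; apply/ffunP => r; rewrite !ffunE.
    have := e1 r; rewrite !ffunE => -[/vresP h _ _]; apply: h; rewrite hS inE; apply/orP; right.
    by apply: imset_f; move: hj; rewrite !inE.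
  - congr (_, _) => //; apply/ffunP => r; have := e1 r; rewrite !ffunE; by case.
  - apply/ffunP => r; rewrite !ffunE; have := e1 r; rewrite !ffunE; by case.
move=> [/vresP e1 /xresP e2 /ffunP e3 e4 /ffunP e5]; congr (_, _, _) => //; last first.
  by apply/vresP => i iC; have := e1 i iC; rewrite !av_mA ?cf // => -[].
apply/ffunP => r; rewrite !ffunE; congr (_, _, _).
- apply/vresP => i; rewrite hS inE => /orP[iC|/imsetP[j' hj ->]].
    have := e1 i iC; rewrite !av_mA ?cf // => -[/ffunP /(_ r)]; by rewrite !ffunE.
  have := e2 j'; rewrite !ffunE => h; have {}h := h _.
  have /ffunP/(_ r) : [ffun r => (w.1 r).2.1 (wp j')] = [ffun r => (w'.1 r).2.1 (wp j')].
    by apply: h; rewrite inE; move: hj; rewrite inE.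
  by rewrite !ffunE.
- by have := e3 r; rewrite !ffunE.
by have := e5 r; rewrite !ffunE.
Qed.

Section Rate.
Context (delta : R).
Context (hlaw : forall i (a : {ffun 'I_nb -> Qt * XT}) (y : {ffun 'I_nb -> YT}) phi,
  Ex (pD i) (fun D => phi (vqn i a y D)) = Ex (prd (fun s => ry pyh x0 y0 i (a s) (y s))) phi).
Local Notation hv := (hV ch pq g px pyh ns x0 y0).
Local Notation hva := (hVa ch pq g px pyh ns x0 y0).
Context (hrate : forall i,
  cent (jn (prd (fun _ : 'I_nb => mui ch pq g px ns x0 i)) (fun _ => pD i))
    (fun w => vqn i [ffun s => (w.1 s).1] [ffun s => (w.1 s).2] w.2) (fun w => ([ffun s => (w.1 s).1], w.2)) <=
  nb%:R * (hva i - hv i + delta)).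
Local Notation lvv := (@lv I Qt Xa Ya Yh).
Local Notation e0 i := (ent (p0 g px ns i) id).

(** Successors of a transmitter have larger layer index and compressing relays have none; this is
    the closure that screening requires. *)
Lemma closed_bset (C : {set I}) j : C \subset ~: tx pi ->
  forall i, i \in C :|: bset j -> {subset tail ns i <= C :|: bset j}.
Proof.
move=> hC i; rewrite inE => /orP[iC|/imsetP[j' hj ->]].
  by rewrite tail_cf => [i'|]; rewrite ?in_nil //; have := subsetP hC i iC; rewrite inE.
move=> i' /tail_wpi[j2 h2 ->]; rewrite inE; apply/orP; right; apply: imset_f.
by move: hj; rewrite !inE => hj; apply: leq_trans hj (ltnW h2).
Qed.

Definition outc (m : I) (C S : {set I}) : R :=
  cent Lm' (fun w => (yi m w.1, vres C lvv w)) (fun w => (vres S (lx ns x0) w.1, w.1.1)).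

Lemma ent_zl (m : I) (C S : {set I}) : (forall i, i \in S -> {subset tail ns i <= S}) ->
  ent Lm' (fun w => (zl S m w.1, vres C lvv w)) = \sum_(i in S) e0 i + ent pq id + outc m C S.
Proof.
move=> hS; have hL := pmf_Lam' hch hpq hg hpx hpyh ns x0 y0.
transitivity (ent Lm' (fun w => ((yi m w.1, vres C lvv w), (vres S (lu (Ya := Ya)) w.1, w.1.1)))).
  apply: ent_eq => // w w' _ _ e; first exact: (congr1 (fun x => ((x.2, x.1.1), x.1.2)) e).
  exact: (congr1 (fun x => ((x.1.2, x.2), x.1.1)) e).
rewrite entE (ent_lu hch hpq hg hpx hpyh ns x0 y0 S); congr (_ + _).
exact: (cent_screen_ux hch hpq hg hpx hpyh uniq_nsp x0 y0 hS
  (fun yv => (@tg I Ya m (yv.1 m), [ffun i => if i \in C then Some (yv.2 i) else None]))).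
Qed.

Lemma sum_bset k (F : I -> R) : \sum_(i in bset k) F i = \sum_(j < K | (k <= j)%N) F (wp j).
Proof.
by rewrite big_imset /=; [apply: eq_bigl => j; rewrite inE|move=> j j' _ _; exact: wpi_inj].
Qed.

Lemma sum_cf (C : {set I}) k (F : I -> R) : C \subset ~: tx pi ->
  \sum_(i in C :|: bset k) F i = \sum_(i in C) F i + \sum_(j < K | (k <= j)%N) F (wp j).
Proof.
move=> hC; rewrite -sum_bset (big_setID C) /=; congr (_ + _); apply: eq_bigl => i; rewrite !inE.
  by case: (i \in C); rewrite ?andbF.
case: (boolP (i \in bset k)) => [/imsetP[j _ e]|_]; last by case: (i \in C).
rewrite orbT andbT e; apply/negP => h; have := subsetP hC _ h.
by rewrite inE => /negP; apply; exact: imset_f.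
Qed.

(** Entropies of letters, of q and of the dither occur in both block bounds and cancel. Of the [hV]
    sums the part over T k \ C remains, and the excess of the quantizers is delta for each relay in
    [T k]. *)
Lemma net1_rate (rho : R) (T : 'I_K.+1 -> {set I}) : (forall k, T k \subset ~: tx pi) ->
  (forall (k : 'I_K.+1) (C : {set I}), (0 < k)%N -> C \subset T k ->
    rho + #|T k|%:R * delta <= outc (pi k) C (C :|: bset k) - outc (pi k) (T k) (T k :|: bset 0) +
      \sum_(i in T k :\: C) hv i) ->
  forall (k : 'I_K.+1) (C : {set I}), (0 < k)%N -> C \subset T k ->
    nb%:R * rho + cent Al (Wf obs1 yq1 (zk pi obs1 k 0) (T k)) (vres (T k) (@aU I U1 O1n)) <=
    ent Al (Wf obs1 yq1 (zk pi obs1 k k) C) - ent Al (vres C (@aU I U1 O1n)) +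
    \sum_(j < K | (j < k)%N) ent (p1n (wp j)) id.
Proof.
move=> hT H k C k0 hC; have hCt := subset_trans hC (hT k).
have hA : pmf Al by apply: pmf_Alaw => [i|u]; [exact: pmf_p1n|exact: pmf_W1n].
have eT : ent Al (fun a => (Wf obs1 yq1 (zk pi obs1 k 0) (T k) a, vres (T k) (@aU I U1 O1n) a)) =
          ent Al (Wf obs1 yq1 (zk pi obs1 k 0) (T k)).
  apply: ent_eq => // a a' _ _; last by move=> e; exact: (congr1 fst e).
  move=> e; rewrite e; congr (_, _); have /vresP e1 := congr1 fst e.
  by apply/vresP => i iT; have := congr1 fst (e1 i iT).
rewrite {1}/cent eT (ent_Wf k (hT k) (erefl (T k :|: bset 0))) (ent_Wf k hCt (erefl (C :|: bset k))) !ent_aU.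
have lo := block_lower hch hpq hg hpx hpyh ns hpD hlaw (zl (C :|: bset k) (pi k)) C.
have hz i l l' : i \in T k -> zl (T k :|: bset 0) (pi k) l = zl (T k :|: bset 0) (pi k) l' -> ai ns x0 i l = ai ns x0 i l'.
  move=> iT e; have /vresP eu := congr1 (fun x => x.1.1) e; have eq : l.1 = l'.1 := congr1 (fun x => x.1.2) e.
  have hi : i \notin tx pi by have := subsetP (hT k) i iT; rewrite inE.
  rewrite /ai eq; congr (_, tg _); rewrite !ffunE; apply: xi_eq => i'.
  by rewrite (tail_cf hi) mem_seq1 => /eqP ->; apply: eu; rewrite inE iT.
have up := block_upper hch hpq hg hpx hpyh hpD hlaw hrate hz.
apply: (le_trans (lerD (lexx _) (lerB up (lexx _)))); apply: (le_trans _ (lerD (lerB lo (lexx _)) (lexx _))).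
rewrite !ent_zl; try exact: closed_bset.
rewrite !sum_cf //.
have -> : \sum_(j < K | (j < k)%N) ent (p1n (wp j)) id = nb%:R * \sum_(j < K | (j < k)%N) e0 (wp j).
  by rewrite mulr_sumr; apply: eq_bigr => j _; exact: ent_p1n.
have es : \sum_(j < K | (0 <= j)%N) e0 (wp j) = \sum_(j < K | (k <= j)%N) e0 (wp j) + \sum_(j < K | (j < k)%N) e0 (wp j).
  by rewrite (bigID (fun j : 'I_K => (k <= j)%N)) /=; congr (_ + _); apply: eq_bigl => j; rewrite -ltnNge.
have eh : \sum_(i in T k) hv i = \sum_(i in T k :\: C) hv i + \sum_(i in C) hv i.
  by rewrite [LHS](big_setID C) /= (setIidPr hC) addrC.
have ed : \sum_(i in T k) (delta - hv i) = #|T k|%:R * delta - \sum_(i in T k) hv i.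
  by rewrite sumrB sumr_const mulr_natl.
have h := ler_wpM2l (ler0n R nb) (H k C k0 hC).
rewrite es ed eh; move: h; lra.
Qed.

Theorem net1_code (rho Rt : R) (T : 'I_K.+1 -> {set I}) : (0 < K)%N -> (0 < nb)%N -> Rt < rho ->
  (forall k, T k \subset ~: tx pi) ->
  (forall (k : 'I_K.+1) (C : {set I}), (0 < k)%N -> C \subset T k ->
    rho + #|T k|%:R * delta <= outc (pi k) C (C :|: bset k) - outc (pi k) (T k) (T k :|: bset 0) +
      \sum_(i in T k :\: C) hv i) ->
  exists2 t : nat, (0 < t)%N & forall (eps : R) (B : nat), 0 < eps -> (0 < B)%N ->
    exists N0 : nat, forall N : nat, (N0 <= N)%N -> forall (M : finType) (m0 : M),
    ln #|M|%:R <= N%:R * (t%:R * Rt) ->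
    pccode (W0 ch) obs0 (pi ord0) (pi ord_max) {ffun 'I_B -> M} ((B + K) * N * t) eps.
Proof.
move=> K0 nb0 hR hT H; have nbR : 0 < nb%:R :> R by rewrite ltr0n.
have [s0 _] := pmf_inhab pmf_pS.
pose u0 : U1 := [ffun=> [ffun=> x0]].
pose ob0 : Ob1 := (s0, [ffun=> @tg I Ya ord0 (y0 ord0)]).
pose o0 : O1n := (s0, [ffun=> y0]).
have hR' : nb%:R * Rt < nb%:R * rho by rewrite ltr_pM2l.
have [t t0 ht] := superletter_rate pinj pmf_p1n (fun u => pmf_W1n _) pmf_W1n W1n_coh u0 ob0 o0 hT K0 hR' (net1_rate hT H).
exists (t * nb)%N; first by rewrite muln_gt0 t0.
move=> eps B eps0 B0; have [N0 hN] := ht eps B eps0 B0; exists N0 => N lN M m0 hM.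
rewrite mulnA; apply: (pccode_impl x0 impl_W1n).
  by apply/eqP => /pinj /(congr1 val) /= e; have := K0; rewrite e.
by apply: hN => //; move: hM; rewrite natrM -[_ * _ * Rt]mulrA.
Qed.

End Rate.
End Net1.

Lemma exists_lb {R : realType} (F : finType) (a : F -> R) : (forall x, 0 < a x) -> exists2 e, 0 < e & forall x, e <= a x.
Proof.
move=> a0; exists (\sum_x (a x)^-1 + 1)^-1.
  by rewrite invr_gt0 ltr_wpDl // sumr_ge0 // => x _; rewrite invr_ge0 ltW.
move=> x; rewrite -[leRHS]invrK lef_pV2 ?posrE ?invr_gt0 //.
  rewrite (bigD1 x) //= -addrA lerDl addr_ge0 // sumr_ge0 // => y _; by rewrite invr_ge0 ltW.
by rewrite ltr_wpDl // sumr_ge0 // => y _; rewrite invr_ge0 ltW.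
Qed.

(** The maximum starts from the value at [i0], so [i0] itself has to be admissible. *)
Lemma fmax_gt {R : realType} (I : finType) (A : pred I) i0 (F : I -> R) c :
  A i0 -> c < fmax A i0 F -> exists2 i, A i & c < F i.
Proof.
move=> h0; case: (pickP (fun i => A i && (c < F i))) => [i /andP[Ai ci] _|al]; first by exists i.
have le i : A i -> F i <= c by move=> Ai; have := al i; rewrite Ai /= => /negbT; rewrite -leNgt.
have : fmax A i0 F <= c by rewrite /fmax; apply/bigmax_leP; split=> //; exact: le.
by rewrite leNgt => /negP.
Qed.

Lemma fmin_le {R : realType} (I : finType) (A : pred I) i0 (F : I -> R) i : A i -> fmin A i0 F <= F i.
Proof. by move=> Ai; rewrite /fmin; exact: bigmin_le_cond. Qed.

(** * Matching the index sets of the theorem *)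

Section Assemble.
Context {R : realType} {nn : nat} {Qt : finType} {Xa Ya Yh : 'I_nn.+2 -> finType}.
Local Notation I := 'I_nn.+2.
Local Notation XX := {dffun forall i, Xa i}.
Local Notation YY := {dffun forall i, Ya i}.
Context (ch : XX -> YY -> R) (chP : is_channel ch).
Context (pq : Qt -> R) (hpq : pmf pq) (g : Qt -> XX -> R) (hg : forall q, pmf (g q)).
Context (px : forall i : I, Qt -> Xa i -> R).
Arguments px : clear implicits.
Context (hpx : forall i q, pmf (px i q)).
Context (pyh : forall i : I, Qt -> Xa i -> Ya i -> Yh i -> R).
Arguments pyh : clear implicits.
Context (hpyh : forall i q x y, pmf (pyh i q x y)).
Context (Mset : {set I}) (Msub : Mset \subset relays nn) (dst1 : #|Xa ord_max| = 1%N).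
Local Notation K := (#|Mset|).+1.
Context (pi : 'I_K.+1 -> I) (pinj : injective pi) (pi0 : pi ord0 = ord0) (piM : pi ord_max = ord_max).
Context (piE : [set pi j | j : 'I_K.+1] = ord0 |: (ord_max |: Mset)) (x0 : XX) (y0 : YY).
Local Notation ns := (nsp pi).
Local Notation jP := (joint_pmf ch Mset pq g px pyh).
Local Notation Lm' := (Lam' ch pq g px pyh ns x0 y0).

Lemma tx_dfE : tx pi = ord0 |: Mset.
Proof.
have nM : ord_max \notin Mset by apply/negP => /(subsetP Msub); rewrite inE /= ltnn.
have n0 : ord_max != ord0 :> I by [].
apply/setP => i; apply/imsetP/idP => [[j _ ->]|hi].
  have : wpi pi j \in [set pi j | j : 'I_K.+1] by exact: imset_f.
  rewrite piE !inE => /or3P[->//|/eqP e|->]; last by rewrite orbT.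
  have : widen_ord (leqnSn K) j = ord_max by apply: pinj; rewrite piM.
  by move/(congr1 val) => /= ej; have := ltn_ord j; rewrite ej ltnn.
have : i \in [set pi j | j : 'I_K.+1] by rewrite piE; move: hi; rewrite !inE => /orP[->|->]; rewrite ?orbT.
case/imsetP => j _ ei; have jK : (j < K)%N.
  have := ltn_ord j; rewrite ltnS leq_eqVlt => /orP[/eqP ej|//].
  have jm : j = ord_max by exact: val_inj.
  by move: hi; rewrite ei jm piM !inE (negbTE nM) (negbTE n0).
by exists (Ordinal jK) => //; rewrite ei /wpi; congr pi; exact: val_inj.
Qed.

Lemma bset_dfE (k : nat) : bset pi k = [set pi j | j : 'I_K.+1 & (k <= j < K)%N].
Proof.
apply/setP => i; apply/imsetP/imsetP => [[j hj ->]|[j hj ->]].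
  by exists (widen_ord (leqnSn K) j) => //; rewrite inE /= ltn_ord andbT; move: hj; rewrite inE.
move: hj; rewrite inE => /andP[h1 h2]; exists (Ordinal h2); first by rewrite inE.
by rewrite /wpi; congr pi; exact: val_inj.
Qed.

Let nsE i : (i \in ns) = (i \in ord0 |: Mset).
Proof. by rewrite mem_nsp tx_dfE. Qed.

Let hch x : pmf (ch x). Proof. by have [h1 h2] := chP x; split. Qed.

Let law : samelaw jP Lm' (@Zp nn Qt Xa Ya Yh) (Zl ns x0).
Proof.
apply: joint_law => //; first exact: uniq_nsp.
by rewrite /nsp enum_ordSl.
Qed.

Lemma pmf_jP : pmf jP.
Proof.
split=> [w|].
  rewrite /joint_pmf; apply: mulr_ge0; last by apply: prodr_ge0 => i _; exact: pmf_ge0.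
  apply: mulr_ge0; last exact: pmf_ge0.
  apply: mulr_ge0; last by apply: prodr_ge0 => i _; exact: pmf_ge0.
  by apply: mulr_ge0; [exact: pmf_ge0|apply: sumr_ge0 => x _; exact: pmf_ge0].
have h := law (fun=> 1).
have e : Ex jP (fun=> 1) = \sum_w jP w by apply: eq_bigr => w _; rewrite mulr1.
by rewrite -e h Ex_cst //; exact: pmf_Lam'.
Qed.

Lemma cent_LL_Lam (T T' : eqType) (A : QQ -> T) (B : QQ -> T') (A' : base * {ffun I -> VT} -> T) (B' : base * {ffun I -> VT} -> T') :
  (forall w, A (Zl ns x0 w) = A' w) -> (forall w, B (Zl ns x0 w) = B' w) -> cent (LL jP) A B = cent Lm' A' B'.
Proof.
move=> hA hB; apply: samelaw_cent => phi; rewrite Ex_push.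
by rewrite (law (fun z => phi (A z, B z))); apply: eq_Ex => w _; rewrite hA hB.
Qed.

Lemma outc_LL (m : I) (C S : {set I}) :
  cent (LL jP) (fun z => (cy m z, vres C (@cv nn Qt Xa Ya Yh) z)) (fun z => (vres S (@cx nn Qt Xa Ya Yh) z, cq z)) =
  outc ch pq g px pyh pi x0 y0 m C S.
Proof.
apply: cent_LL_Lam => w; congr (_, _).
  by rewrite /cy /Zl /= ffunE.
by apply/ffunP => i; rewrite !ffunE; case: ifP => // _; rewrite /cx /Zl /= ffunE.
Qed.

Lemma hV_LL i : cent (LL jP) (@cv nn Qt Xa Ya Yh i) (fun z => ((cq z, cx i z), cy i z)) = hV ch pq g px pyh ns x0 y0 i.
Proof. by apply: cent_LL_Lam => w //; rewrite /cq /cx /cy /Zl /ai /yi /= !ffunE. Qed.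

(** The agreeing set [C] of the random-map bound is the complement in [T] of the set over which the
    theorem minimises. *)
Lemma rate_outc (k : 'I_K.+1) (C T S A B Pi : {set I}) : C \subset T -> S = T :\: C ->
  A = [set pi j | j : 'I_K.+1 & (j < k)%N] ->
  B = [set pi j | j : 'I_K.+1 & (k <= j < K)%N] ->
  Pi = [set pi j | j : 'I_K.+1 & (j < K)%N] ->
  (cmi jP (fun w => (restr A w.2.1, restr S w.2.1))
         (fun w => (restr (T :\: S) w.2.2.2, w.2.2.1 (pi k)))
         (fun w => (restr (T :\: S) w.2.1, restr B w.2.1, w.1)) -
   cmi jP (fun w => restr S w.2.2.1) (fun w => restr S w.2.2.2)
         (fun w => (restr Pi w.2.1, restr T w.2.1, w.2.2.1 (pi k), restr (T :\: S) w.2.2.2, w.1))) * ln 2 <=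
  outc ch pq g px pyh pi x0 y0 (pi k) C (C :|: bset pi k) -
  outc ch pq g px pyh pi x0 y0 (pi k) T (T :|: bset pi 0) + \sum_(i in T :\: C) hV ch pq g px pyh ns x0 y0 i.
Proof.
move=> CT SE AE BE PE.
have TS : T :\: S = C by rewrite SE setDDr setDv set0U; exact/setIidPr.
have AB : A :|: B = Pi.
  rewrite AE BE PE; apply/setP => i; rewrite inE; apply/orP/imsetP => [[]/imsetP[j]|[j]]; rewrite inE => hj ->.
  - exists j => //; rewrite inE; apply: leq_trans hj _; by rewrite -ltnS.
  - by exists j => //; rewrite inE; case/andP: hj.
  case: (ltnP j k) => h; [left|right]; apply: imset_f; rewrite inE // h.
  exact: hj.
have ST : S \subset T by rewrite SE subsetDl.
have := rate_bound pmf_jP (pi k) AB ST.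
rewrite TS !outc_LL bset_dfE -BE (_ : bset pi 0 = Pi); last by rewrite bset_dfE PE.
move=> /le_trans; apply; rewrite lerD2l SE; apply: ler_sum => i _; by rewrite hV_LL.
Qed.

End Assemble.

Theorem theorem2 (R : realType) (n : nat) (Xa Ya : 'I_n.+2 -> finType)
    (ch : {dffun forall i, Xa i} -> {dffun forall i, Ya i} -> R)
    (chP : is_channel ch)
    (src_no_output : #|Ya ord0| = 1%N)
    (dst_no_input : #|Xa ord_max| = 1%N)
    (rate : R) :
  (exists (Mset : {set 'I_n.+2}), Mset \subset relays n /\
   exists (pi : 'I_(#|Mset|).+2 -> 'I_n.+2),
     [/\ injective pi, pi ord0 = ord0, pi ord_max = ord_max
       & [set pi j | j : 'I_(#|Mset|).+2] = ord0 |: (ord_max |: Mset)] /\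
   exists (Qt : finType) (Yh : 'I_n.+2 -> finType)
          (pq : Qt -> R) (g : Qt -> {dffun forall i, Xa i} -> R)
          (px : forall i : 'I_n.+2, Qt -> Xa i -> R)
          (pyh : forall i : 'I_n.+2, Qt -> Xa i -> Ya i -> Yh i -> R),
     ((forall q, 0 <= pq q) /\ \sum_q pq q = 1) /\
     ((forall q x, 0 <= g q x) /\ (forall q, \sum_x g q x = 1)) /\
     ((forall i q xi, 0 <= px i q xi) /\ (forall i q, \sum_xi px i q xi = 1)) /\
     ((forall i q xi yi yhi, 0 <= pyh i q xi yi yhi) /\
      (forall i q xi yi, \sum_yhi pyh i q xi yi yhi = 1)) /\
     let P := joint_pmf ch Mset pq g px pyh in
     let Q  := fun w : Qt * ({dffun forall i, Xa i} * ({dffun forall i, Ya i} * {dffun forall i, Yh i})) => w.1 in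
     let X  := fun w : Qt * ({dffun forall i, Xa i} * ({dffun forall i, Ya i} * {dffun forall i, Yh i})) => w.2.1 in
     let Y  := fun w : Qt * ({dffun forall i, Xa i} * ({dffun forall i, Ya i} * {dffun forall i, Yh i})) => w.2.2.1 in
     let Yhat := fun w : Qt * ({dffun forall i, Xa i} * ({dffun forall i, Ya i} * {dffun forall i, Yh i})) => w.2.2.2 in
     let NM := relays n :\: Mset in
     (* 0-based index m = k - 1, k = 2, ..., M+2 *)
     forall m : 'I_(#|Mset|).+2, (0 < m)%N ->
       let A  := [set pi j | j : 'I_(#|Mset|).+2 & (j < m)%N] in                      (* pi(1:k-1) *)
       let B  := [set pi j | j : 'I_(#|Mset|).+2 & (m <= j < #|Mset|.+1)%N] in       (* pi(k:M+1) *)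
       let Pi := [set pi j | j : 'I_(#|Mset|).+2 & (j < #|Mset|.+1)%N] in            (* pi(1:M+1) *)
       rate <
       fmax (fun Tk : {set 'I_n.+2} => Tk \subset NM) set0 (fun Tk =>
         fmin (fun S : {set 'I_n.+2} => S \subset Tk) set0 (fun S =>
           cmi P (fun w => (restr A (X w), restr S (X w)))
                 (fun w => (restr (Tk :\: S) (Yhat w), Y w (pi m)))
                 (fun w => (restr (Tk :\: S) (X w), restr B (X w), Q w))
           - cmi P (fun w => restr S (Y w))
                   (fun w => restr S (Yhat w))
                   (fun w => (restr Pi (X w), restr Tk (X w), Y w (pi m),
                              restr (Tk :\: S) (Yhat w), Q w))))) ->
  achievable ch rate.

Proof.
move=> [Mset [Msub [pi [[pinj pi0 piM piE] [Qt [Yh [pq [g [px [pyh [hpq [[g0 g1] [[px0 px1] [[py0 py1] H]]]]]]]]]]]]]].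
have hg q : pmf (g q) by split=> //; exact: g0.
have hpx i q : pmf (px i q) by split=> //; exact: px0.
have hpyh i q x y : pmf (pyh i q x y) by split=> //; exact: py0.
have [q0 _] := pmf_inhab hpq; have [x0 _] := pmf_inhab (hg q0).
have [y0 _] := pmf_inhab (pmf_W0 chP [ffun=> x0]).
have [r0|r0] := lerP rate 0; first exact: achievable_npos.
have l2 : 0 < ln 2 :> R by rewrite ln_gt0 // ltr1n.
set K := (#|Mset|).+1.
pose f (k : 'I_K.+1) (T S : {set 'I_n.+2}) : R :=
  cmi (joint_pmf ch Mset pq g px pyh)
    (fun w => (restr [set pi j | j : 'I_K.+1 & (j < k)%N] w.2.1, restr S w.2.1))
    (fun w => (restr (T :\: S) w.2.2.2, w.2.2.1 (pi k)))
    (fun w => (restr (T :\: S) w.2.1, restr [set pi j | j : 'I_K.+1 & (k <= j < K)%N] w.2.1, w.1)) -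
  cmi (joint_pmf ch Mset pq g px pyh)
    (fun w => restr S w.2.2.1) (fun w => restr S w.2.2.2)
    (fun w => (restr [set pi j | j : 'I_K.+1 & (j < K)%N] w.2.1, restr T w.2.1, w.2.2.1 (pi k), restr (T :\: S) w.2.2.2, w.1)).
have /boolp.choice[T hT] (k : 'I_K.+1) : exists T : {set 'I_n.+2}, T \subset relays n :\: Mset /\
    ((0 < k)%N -> forall S : {set 'I_n.+2}, S \subset T -> rate < f k T S).
  (* The index 0 belongs to the source, which decodes nothing and gets the empty set. *)
  case: (posnP k) => [k0|k0]; first by exists set0; rewrite sub0set.
  have [T TN hT] := fmax_gt (sub0set _) (H k k0); exists T; split=> // _ S ST.
  exact: lt_le_trans hT (fmin_le _ _ ST).
have [e e0 he] : exists2 e : R, 0 < e & forall k : 'I_K.+1, (0 < k)%N -> forall S : {set 'I_n.+2},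
    S \subset T k -> rate + e <= f k (T k) S.
  pose a (x : 'I_K.+1 * {set 'I_n.+2}) : R :=
    if (0 < x.1)%N && (x.2 \subset T x.1) then f x.1 (T x.1) x.2 - rate else 1.
  have [|e e0 he] := @exists_lb R _ a.
    by move=> x; rewrite /a; case: ifP => // /andP[k0 ST]; rewrite subr_gt0; apply: (hT x.1).2.
  exists e => // k k0 S ST; have := he (k, S); rewrite /a /= k0 ST /=; lra.
(* As [T k] has at most n + 2 elements, the quantizers cost at most e ln 2 / 2, half of the margin.
   The other half keeps [rho] above the rate, and [Rt] lies strictly between. *)
pose delta := e * ln 2 / (2 * n.+2%:R).
have n2 : 0 < n.+2%:R :> R by rewrite ltr0n.
have el : 0 < e * ln 2 by exact: mulr_gt0.
have d0 : 0 < delta by apply: divr_gt0 => //; exact: mulr_gt0.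
have hch x : pmf (ch x) by have [h1 h2] := chP x; split.
have [nb [nb0 [Dd [pD [vqn [hpD hlaw hrate]]]]]] := quantizer_family hch hpq hg hpx hpyh (nsp pi) x0 y0 d0.
pose rho := (rate + e / 2) * ln 2; pose Rt := (rate + e / 4) * ln 2.
have hRt : Rt < rho by rewrite ltr_pM2r // ltrD2l; lra.
have hT' k : T k \subset ~: tx pi.
  apply/subsetP => i /(subsetP (hT k).1); rewrite tx_dfE // !inE negb_or.
  by case/and3P => -> h _; rewrite -lt0n h.
have Hk (k : 'I_K.+1) (C : {set 'I_n.+2}) : (0 < k)%N -> C \subset T k ->
    rho + #|T k|%:R * delta <= outc ch pq g px pyh pi x0 y0 (pi k) C (C :|: bset pi k) -
      outc ch pq g px pyh pi x0 y0 (pi k) (T k) (T k :|: bset pi 0) +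
      \sum_(i in T k :\: C) hV ch pq g px pyh (nsp pi) x0 y0 i.
  move=> k0 CT; have h1 := he k k0 (T k :\: C) (subsetDl _ _).
  have h2 : f k (T k) (T k :\: C) * ln 2 <= _ := rate_outc chP hpq hg hpx hpyh Msub dst_no_input pinj piM piE x0 y0 CT
    (erefl _) (erefl _) (erefl _) (erefl _).
  apply: le_trans h2; apply: (le_trans _ (ler_wpM2r (ltW l2) h1)).
  have h3 : #|T k|%:R * delta <= n.+2%:R * delta.
    have c : (#|T k| <= #|{: 'I_n.+2}|)%N by exact: max_card.
    by rewrite card_ord in c; apply: ler_wpM2r; [exact: ltW|rewrite ler_nat].
  have h4 : n.+2%:R * delta = e * ln 2 / 2 by rewrite /delta; move: n2; move: (n.+2%:R : R) => z z0; field; rewrite gt_eqF.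
  by rewrite /rho; move: h3; rewrite h4; lra.
have [t t0 ht] := net1_code chP hpq hg hpx hpyh pinj hpD hlaw hrate (isT : (0 < K)%N) nb0 hRt hT' Hk.
apply: (achievable_of chP x0 t0 r0 (Rt := t%:R * Rt) (K := K)).
  by rewrite -mulrA ltr_pM2l ?ltr0n // ltr_pM2r // ltrDl divr_gt0.
move=> eps eps0 B B0; have := ht eps B eps0 B0.
by rewrite pi0 piM.
Qed.
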